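(* Let $c>0$, let $0<s<1$, and let $\epsilon>0$. For every $u\in H^s(B)$, the approximation $$\pi_\epsilon u=\sum_{(m,n,\ell):\ \chi_{m,n}\le 1/\epsilon}\langle u,\psi_{m,n,\ell}\rangle\,\psi_{m,n,\ell}$$ satisfies $$\|\pi_\epsilon u-u\|_{L^2(B)}\le \epsilon^{s/2}(1+c^2)^{s/2}\|u\|_{H^s(B)}.$$
   Context: $B=B(0,1)\subset\mathbb{R}^3$ is the open unit ball, $c>0$ is fixed, functions are complex valued, and $\langle u,v\rangle=\int_B u\,\overline v\,dx$. 3D PSWFs. Let $\mathcal F^c:L^2(B)\to L^2(B)$, $\mathcal F^c[g](x)=\int_B e^{ic\,x\cdot y}g(y)\,dy$. It is known (Slepian) that there is a complete orthonormal system $\{\psi_{m,n,\ell}\}$ of $L^2(B)$, indexed by $m,n\in\mathbb N=\{0,1,2,\dots\}$ and $\ell\in\mathbb Z$ with $|\ell|\le m$, of real-valued analytic functions such that $$\mathcal F^c[\psi_{m,n,\ell}]=\alpha_{m,n}\psi_{m,n,\ell},\qquad \mathcal D_c[\psi_{m,n,\ell}]=\chi_{m,n}\psi_{m,n,\ell}\ \text{ in }B,$$ where the $\alpha_{m,n}=\alpha_{m,n}(c)\in\mathbb C\setminus\{0\}$ tend to $0$, and where, in spherical coordinates with $r=|x|$ and $\Delta_{\mathbb S^2}$ the Laplace–Beltrami operator on the unit sphere, $$\mathcal D_c=-(1-r^2)\partial_r^2-\frac2r\partial_r+4r\partial_r-\frac1{r^2}\Delta_{\mathbb S^2}+c^2r^2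 .$$ More precisely, $\psi_{m,n,\ell}(x)$ is a radial function times the real orthonormal spherical harmonic $Y_{m,\ell}(x/|x|)$ of degree $m$; the eigenvalues satisfy $0<\chi_{m,0}<\chi_{m,1}<\chi_{m,2}<\cdots$ for each $m$ and $\chi_{m,n}\to+\infty$. Sobolev norm. $\|u\|_{H^1(B)}^2=\|u\|_{L^2(B)}^2+\|\nabla u\|_{L^2(B)}^2$, and for $0<s<1$ the space $H^s(B)$ is the Hilbert interpolation space of exponent $s$ between $L^2(B)$ and $H^1(B)$, with the interpolation norm (normalized so that interpolating $L^2$ with a weighted $L^2$ space of weight $w$ gives exactly the weighted $L^2$ norm with weight $w^s$). *)

(* Defs.v *)
From HB Require Import structures.
From mathcomp Require Import all_boot all_order all_algebra.
From mathcomp Require Import all_classical all_reals all_analysis.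
From mathcomp Require Import complex.

Set Implicit Arguments.
Unset Strict Implicit.
Unset Printing Implicit Defensive.

Import Order.TTheory GRing.Theory Num.Theory.
Import numFieldNormedType.Exports.

Local Open Scope classical_set_scope.
Local Open Scope ring_scope.

Section euclidean_space.
Variable R : realType.
Local Notation R3 := (R * R * R)%type.

Definition dot3 (x y : R3) : R := x.1.1 * y.1.1 + x.1.2 * y.1.2 + x.2 * y.2.

(* The library's norm on [R * R * R] is the sup norm, hence this one. *)
Definition enorm (x : R3) : R := Num.sqrt (dot3 x x).

Definition B3 : set R3 := [set x | enorm x < 1].

Definition leb3 := ((@lebesgue_measure R \x @lebesgue_measure R)
  \x @lebesgue_measure R)%E.

Definition basis3 (i : 'I_3) : R3 :=
  ((i == 0 :> nat)%:R, (i == 1 :> nat)%:R, (i == 2 :> nat)%:R).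

Definition partial (i : 'I_3) (f : R3 -> R) : R3 -> R :=
  fun x => 'D_(basis3 i) f x.

Definition lapl (f : R3 -> R) (x : R3) : R :=
  \sum_(i < 3) partial i (partial i f) x.

Definition smooth (f : R3 -> R) : Prop := forall (l : seq 'I_3),
  continuous (foldr partial f l) /\
  forall (i : 'I_3) (x : R3), derivable (foldr partial f l) x (basis3 i).

Definition test_function (phi : R3 -> R) : Prop :=
  [/\ smooth phi, compact (closure [set x | phi x != 0]) &
      closure [set x | phi x != 0] `<=` B3].

Definition monomial3 (i j k : nat) (x : R3) : R :=
  x.1.1 ^+ i * x.1.2 ^+ j * x.2 ^+ k.

(* Around each point of [A], [f] is the sum of an absolutely convergent power
   series in three variables (summed here along cubes). *)
Definition real_analytic_on (A : set R3) (f : R3 -> R) : Prop :=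
  forall x, A x -> exists (a : nat -> nat -> nat -> R) (rho : R), 0 < rho /\
    forall y, enorm (y - x) < rho ->
      summable [set: nat * nat * nat] (fun k =>
        (a k.1.1 k.1.2 k.2 * monomial3 k.1.1 k.1.2 k.2 (y - x))%:E) /\
      (\sum_(i < N) \sum_(j < N) \sum_(k < N)
         a i j k * monomial3 i j k (y - x)) @[N --> \oo] --> f y.

End euclidean_space.

Section function_spaces.
Variable R : realType.
Local Notation R3 := (R * R * R)%type.

Definition cintegral (D : set R3) (f : R3 -> R[i]) : R[i] :=
  Complex (\int[@leb3 R]_(x in D) complex.Re (f x))
          (\int[@leb3 R]_(x in D) complex.Im (f x)).

Definition inner (u v : R3 -> R[i]) : R[i] :=
  cintegral (@B3 R) (fun x => u x * conjc (v x)).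

Definition L2_norm (u : R3 -> R[i]) : \bar R :=
  ((\int[@leb3 R]_(x in @B3 R) ((Normc.normc (u x) ^+ 2)%R%:E)) `^ (2^-1)%R)%E.

Definition L2 (u : R3 -> R[i]) : Prop :=
  [/\ measurable_fun (@B3 R) (fun x => complex.Re (u x)),
      measurable_fun (@B3 R) (fun x => complex.Im (u x)) & (L2_norm u < +oo)%E].

(* Real test functions suffice: the identity is linear in [phi]. *)
Definition weak_gradient (v : R3 -> R[i]) (g : 'I_3 -> R3 -> R[i]) : Prop :=
  (forall i, L2 (g i)) /\
  forall (i : 'I_3) (phi : R3 -> R), test_function phi ->
    cintegral (@B3 R) (fun x => v x * (partial i phi x)%:C%C) =
    - cintegral (@B3 R) (fun x => g i x * (phi x)%:C%C).

Definition H1 (v : R3 -> R[i]) : Prop := L2 v /\ exists g, weak_gradient v g.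

(* A chosen weak gradient; it is unique up to null sets. *)
Definition wgrad (v : R3 -> R[i]) : 'I_3 -> R3 -> R[i] :=
  xget (fun _ _ => 0) [set g | weak_gradient v g].

Definition H1_norm (v : R3 -> R[i]) : \bar R :=
  ((L2_norm v `^ 2%R + \sum_(i < 3) L2_norm (wgrad v i) `^ 2%R) `^ (2^-1)%R)%E.

End function_spaces.

Section hilbert_interpolation.
Variable R : realType.

(* Quadratic K-functional (squared) of the pair (X0, X1), where X1 is a
   subspace of X0 and N0, N1 are the norms. *)
Definition K2 (V : zmodType) (X1 : set V) (N0 N1 : V -> \bar R) (t : R) (u : V)
    : \bar R :=
  ereal_inf [set (N0 (u - v)%R `^ 2%R + (t ^+ 2)%R%:E * N1 v `^ 2%R)%E | v in X1].

(* For X0 = L^2 and X1 = L^2(w), K2 t u is the integral of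
   t^2 w / (1 + t^2 w) |u|^2, and integrating t^(-1-2s) t^2 w / (1 + t^2 w)
   over t > 0 gives w^s times the integral below; dividing by that integral
   therefore yields exactly the norm of L^2(w^s). *)
Definition interp_const (s : R) : R :=
  (\int[@lebesgue_measure R]_(t in `]0, +oo[) (t `^ (1 - 2 * s) / (1 + t ^+ 2)))^-1.

Definition interp_norm (V : zmodType) (X1 : set V) (N0 N1 : V -> \bar R)
    (s : R) (u : V) : \bar R :=
  (((interp_const s)%:E * \int[@lebesgue_measure R]_(t in `]0%R, +oo[)
      ((t `^ (- 1 - 2 * s))%R%:E * K2 X1 N0 N1 t u)) `^ (2^-1)%R)%E.

Definition Hs_norm (s : R) (u : R * R * R -> R[i]) : \bar R :=
  interp_norm [set v | H1 v] (@L2_norm R) (@H1_norm R) s u.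

Definition Hs (s : R) (u : R * R * R -> R[i]) : Prop :=
  L2 u /\ (Hs_norm s u < +oo)%E.

End hilbert_interpolation.

Section prolate_functions.
Variable R : realType.
Local Notation R3 := (R * R * R)%type.

Definition expi (t : R) : R[i] := Complex (cos t) (sin t).

Definition finite_fourier (c : R) (g : R3 -> R[i]) (x : R3) : R[i] :=
  cintegral (@B3 R) (fun y => expi (c * dot3 x y) * g y).

(* Laplace-Beltrami operator on the unit sphere: the Euclidean Laplacian of the
   0-homogeneous extension. Only the values of [f] on the sphere matter. *)
Definition sphere_lapl (f : R3 -> R) (w : R3) : R :=
  lapl (fun y => f ((enorm y)^-1 *: y)) w.

(* Meaningful for x <> 0, where x = r w with r > 0 and w on the unit sphere. *)
Definition Dc (c : R) (f : R3 -> R) (x : R3) : R :=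
  let r := enorm x in
  let w := r^-1 *: x in
  let ray := fun t : R => f (t *: w) in
  - (1 - r ^+ 2) * derive1n 2 ray r - 2 / r * derive1 ray r + 4 * r * derive1 ray r
  - (r ^+ 2)^-1 * sphere_lapl (fun w' => f (r *: w')) w
  + c ^+ 2 * r ^+ 2 * f x.

Definition sph_point (theta phi : R) : R3 :=
  (sin theta * cos phi, sin theta * sin phi, cos theta).

Definition sphere_inner (f g : R3 -> R) : R :=
  \int[@lebesgue_measure R]_(theta in `[0, pi])
    \int[@lebesgue_measure R]_(phi in `[0, 2 * pi])
      (f (sph_point theta phi) * g (sph_point theta phi) * sin theta).

Definition homogeneous_poly (m : nat) (P : R3 -> R) : Prop :=
  exists a : nat -> nat -> R, forall x : R3,
    P x = \sum_(i < m.+1) \sum_(j < m.+1 | (i + j <= m)%N)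
            a i j * monomial3 i j (m - i - j)%N x.

Definition spherical_harmonic (m : nat) (f : R3 -> R) : Prop :=
  exists P : R3 -> R, [/\ homogeneous_poly m P, (forall x, lapl P x = 0) &
    forall w, enorm w = 1 -> f w = P w].

Definition pswf_index : set (nat * nat * int) :=
  [set k | (absz k.2 <= k.1.1)%N].

Definition orthonormal_harmonics (Y : nat -> int -> R3 -> R) : Prop :=
  (forall m l, (absz l <= m)%N -> spherical_harmonic m (Y m l)) /\
  (forall m l m' l', (absz l <= m)%N -> (absz l' <= m')%N ->
     sphere_inner (Y m l) (Y m' l') = ((m == m') && (l == l'))%:R).

Definition cpsi (psi : nat -> nat -> int -> R3 -> R) (k : nat * nat * int)
    : R3 -> R[i] := fun x => (psi k.1.1 k.1.2 k.2 x)%:C%C.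

(* Completeness is density of the linear span in L^2(B). *)
Definition complete_orthonormal (I : choiceType) (D : set I)
    (e : I -> R3 -> R[i]) : Prop :=
  [/\ (forall k, D k -> L2 (e k)),
      (forall k k', D k -> D k' -> inner (e k) (e k') = (k == k')%:R) &
      forall u, L2 u -> forall delta : R, 0 < delta ->
        exists (F : seq I) (a : I -> R[i]), [set` F] `<=` D /\
          (L2_norm (fun x => (u x - \sum_(k <- F) a k * e k x)%R) < delta%:E)%E].

Record pswf_system (c : R) (Y : nat -> int -> R3 -> R)
    (psi : nat -> nat -> int -> R3 -> R)
    (alpha : nat -> nat -> R[i]) (chi : nat -> nat -> R) : Prop := PswfSystem {
  pswf_harmonics : orthonormal_harmonics Y;
  pswf_complete : complete_orthonormal pswf_index (cpsi psi);
  pswf_analytic : forall m n l, pswf_index (m, n, l) ->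
    real_analytic_on (@B3 R) (psi m n l);
  pswf_fourier : forall m n l, pswf_index (m, n, l) -> forall x, B3 x ->
    finite_fourier c (cpsi psi (m, n, l)) x = alpha m n * cpsi psi (m, n, l) x;
  (* off the origin, where spherical coordinates are defined *)
  pswf_differential : forall m n l, pswf_index (m, n, l) ->
    forall x, B3 x -> x != 0 -> Dc c (psi m n l) x = chi m n * psi m n l x;
  pswf_radial : forall m n l, pswf_index (m, n, l) ->
    exists rad : R -> R, forall x, B3 x -> x != 0 ->
      psi m n l x = rad (enorm x) * Y m l ((enorm x)^-1 *: x);
  pswf_alpha_neq0 : forall m n, alpha m n != 0;
  (* limits along the cofinite filter of the pairs (m, n) *)
  pswf_alpha_cvg0 : forall delta : R, 0 < delta ->
    finite_set [set k : nat * nat | delta <= Normc.normc (alpha k.1 k.2)];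
  pswf_chi_gt0 : forall m, 0 < chi m 0%N;
  pswf_chi_incr : forall m n, chi m n < chi m n.+1;
  pswf_chi_cvgy : forall M : R,
    finite_set [set k : nat * nat | chi k.1 k.2 <= M]
}.

(* The index set is finite by [pswf_chi_cvgy], so this is a genuine finite sum. *)
Definition pswf_proj (psi : nat -> nat -> int -> R3 -> R)
    (chi : nat -> nat -> R) (eps : R) (u : R3 -> R[i]) : R3 -> R[i] := fun x =>
  \sum_(k \in [set k : nat * nat * int |
                 pswf_index k /\ (chi k.1.1 k.1.2 <= 1 / eps)%R])
     (inner u (cpsi psi k) * cpsi psi k x).

End prolate_functions.

(* Main.v *)
(* The operator D_c is associated with the form
     a(v, w) = int_B grad v . grad w - (x . grad v) (x . grad w) + c^2 |x|^2 v w,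
   which is degenerate at the boundary and satisfies
   0 <= a(v, v) <= (1 + c^2) |v|_{H^1}^2. The integral equation shows that psi_k
   extends to a smooth function P on R^3, and D_c P = - div G + c^2 |x|^2 P with
   G = grad P - (x . grad P) x. As G is tangent to the unit sphere, testing the
   weak gradient of v against G times cutoffs that exhaust the ball gives, in the
   limit, a(v, psi_k) = chi_k <v, psi_k> for every v in H^1, without boundary
   term. Bessel's inequality for the form a then bounds the sum of
   chi_k |<v, psi_k>|^2 by (1 + c^2) |v|_{H^1}^2, whence, Q being the projection
   on the modes with chi_k > 1 / eps and W = 1 / (eps (1 + c^2)),
     W |Q v|^2 <= |v|_{H^1}^2.
   Minimizing |Q u - Q v|^2 + t^2 W |Q v|^2 over Q v bounds the K-functional of u
   from below by t^2 W / (1 + t^2 W) |Q u|^2; integrating in t gives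
   W^s |Q u|^2 <= |u|_{H^s}^2. *)

From HB Require Import structures.
Require Import Defs.
From mathcomp Require Import all_boot all_order all_algebra.
From mathcomp Require Import all_classical all_reals all_analysis.
From mathcomp Require Import measurable_realfun complex ring lra.
Set Implicit Arguments.
Unset Strict Implicit.
Unset Printing Implicit Defensive.
Import Order.TTheory GRing.Theory Num.Theory.
Import numFieldNormedType.Exports.
Local Open Scope ring_scope.

(** The obstacle is the boundary: an eigenfunction is given only in the open ball, and [v] in [H1]
    only through a weak gradient there, with neither a trace nor a smooth approximation. The proof
    therefore leaves [v] alone and cuts off the explicit field [G]. The gradient of the cutoff grows
    like n, but it is radial, and [x . G = (1 - |x|^2) (x . grad P)]. The extra term thus contains
    [n (1 - |x|^2)] instead of [n]; with cutoffs built from [exp (- 1/t)] it stays bounded uniformly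
    in n and tends to 0 at each point of the ball, so dominated convergence removes it.

    Since [psi] is real, [P] can be taken to be the real part of the Fourier integral of [psi]
    divided by [alpha]. All estimates are then proved for real functions and applied to real and
    imaginary parts separately.

    Infinite expansions are never summed: Bessel's inequality is proved for finite sets of modes,
    and completeness enters as density, with an arbitrarily small error. The weighted integral in
    [t] is computed exactly by scaling, so that the normalization of the interpolation norm cancels
    without evaluating [interp_const]. *)

(** * Measurability on the ball *)

(* [leb3] lives on the product of the measurable types [measurableTypeR R],
   whose display differs from the default one that is inferred for [R]. *)
Notation R3m R :=
  (measurableTypeR R * measurableTypeR R * measurableTypeR R)%type.
Notation measurable3 := (@measurable _ (R3m _)).
Notation measurable_fun3 D f := (@measurable_fun _ _ (R3m _) _ D f).

Section measurability.
Local Open Scope classical_set_scope.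
Context {R : realType}.
Local Notation R3 := (R * R * R)%type.
Local Notation mu := (@leb3 R).

(** Balls of the product topology are boxes, so the countably many boxes with rational corners that
    lie in [U] already cover it. *)
Lemma open_measurable3 (U : set R3) : open U -> measurable3 U.
Proof.
move=> oU.
pose box (p : rat * rat * rat * (rat * rat * rat)) : set R3 :=
  (`]ratr p.1.1.1, ratr p.2.1.1[ `*` `]ratr p.1.1.2, ratr p.2.1.2[)
   `*` `]ratr p.1.2, ratr p.2.2[.
pose F p := if `[< box p `<=` U >] then box p else set0.
have -> : U = \bigcup_p F p.
  apply/seteqP; split => x; last first.
    by move=> [p _]; rewrite /F; case: ifPn => // /asboolP; apply.
  move=> Ux; have /nbhs_ballP[e /= e0 xeU] : nbhs x U by exact: open_nbhs_nbhs.
  have rat_around (a : R) : exists2 pq : rat * rat,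
      ratr pq.1 < a < ratr pq.2 & a - e < ratr pq.1 /\ ratr pq.2 < a + e.
    have [p] := @rat_in_itvoo R (a - e) a ltac:(lra).
    have [q] := @rat_in_itvoo R a (a + e) ltac:(lra).
    rewrite !in_itv/= => /andP[q1 q2] /andP[p1 p2].
    by exists (p, q) => //=; rewrite q1 p2.
  case: x Ux xeU => [[x1 x2] x3] _ xeU.
  have [[p1 q1] /= pq1 [p1e q1e]] := rat_around x1.
  have [[p2 q2] /= pq2 [p2e q2e]] := rat_around x2.
  have [[p3 q3] /= pq3 [p3e q3e]] := rat_around x3.
  exists (p1, p2, p3, (q1, q2, q3)) => //; rewrite /F.
  rewrite asboolT; first by rewrite /box/=; split; [split|]; rewrite /= in_itv.
  move=> [[y1 y2] y3] [[]] /=; rewrite !in_itv/= => a b c; apply: xeU.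
  split; [split|] => /=; rewrite /ball/= ltr_distl.
  - by rewrite /=; lra.
  - by rewrite /=; lra.
  - by rewrite /=; lra.
apply: countable_bigcupT_measurable => [|p]; first exact: countableP.
rewrite /F; case: ifPn => // _.
apply: (measurableX (T1 := (measurableTypeR R * measurableTypeR R)%type));
  last exact: measurable_itv.
by apply: (measurableX (T1 := measurableTypeR R) (T2 := measurableTypeR R));
  exact: measurable_itv.
Qed.

Lemma continuous_measurable_fun3 (D : set R3) (f : R3 -> R) :
  measurable3 D -> continuous f -> measurable_fun3 D f.
Proof.
move=> mD /continuousP cf; apply: (measurability _ (RGenOpens.measurableE R)).
move=> _ [_ [a [b ->] <-]]; apply: measurableI => //; apply: open_measurable3.
exact/cf/interval_open.
Qed.

Lemma continuous_fst3 : continuous (fun x : R3 => x.1.1).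
Proof. by move=> x; apply: cvg_comp; exact: cvg_fst. Qed.

Lemma continuous_snd3 : continuous (fun x : R3 => x.1.2).
Proof. by move=> x; apply: cvg_comp; [exact: cvg_fst|exact: cvg_snd]. Qed.

Lemma continuous_trd3 : continuous (fun x : R3 => x.2).
Proof. by move=> x; exact: cvg_snd. Qed.

Lemma continuous_dot3r (y : R3) : continuous (dot3 y).
Proof.
move=> x; apply: cvgD; [apply: cvgD|].
- by apply: cvgM; [exact: cvg_cst|exact: continuous_fst3].
- by apply: cvgM; [exact: cvg_cst|exact: continuous_snd3].
- by apply: cvgM; [exact: cvg_cst|exact: continuous_trd3].
Qed.

Lemma continuous_dot3xx : continuous (fun x : R3 => dot3 x x).
Proof.
move=> x; apply: cvgD; [apply: cvgD|].
- by apply: cvgM; exact: continuous_fst3.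
- by apply: cvgM; exact: continuous_snd3.
- by apply: cvgM; exact: continuous_trd3.
Qed.

Lemma B3E (x : R3) : @B3 R x <-> dot3 x x < 1.
Proof.
rewrite /B3/= /enorm -{1}(sqrtr1 R) ltr_sqrt//.
Qed.

Lemma open_B3 : open (@B3 R).
Proof.
have -> : @B3 R = (fun x : R3 => dot3 x x) @^-1` `]-oo, 1[.
  by apply/seteqP; split => x; rewrite /= in_itv/= => /B3E.
by move: continuous_dot3xx => /continuousP; apply; exact: interval_open.
Qed.

Lemma measurable_B3 : measurable3 (@B3 R).
Proof. by apply: open_measurable3; exact: open_B3. Qed.

Lemma dot3_ge0 (x : R3) : 0 <= dot3 x x.
Proof. by rewrite /dot3 !addr_ge0// -expr2 sqr_ge0. Qed.

Lemma B3_coord (x : R3) : @B3 R x ->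
  [/\ `|x.1.1| <= 1, `|x.1.2| <= 1 & `|x.2| <= 1].
Proof.
case: x => [[a b] c] /B3E; rewrite /dot3/= -!expr2 => h.
have := (sqr_ge0 a, sqr_ge0 b, sqr_ge0 c) => -[[a0 b0] c0].
by split; rewrite -(ler_pXn2r (n := 2))// ?nnegrE// expr1n real_normK ?num_real//;
  lra.
Qed.

Lemma leb3_box (A B C : set (measurableTypeR R)) :
  measurable A -> measurable B -> measurable C ->
  (mu ((A `*` B) `*` C) =
   lebesgue_measure A * lebesgue_measure B * lebesgue_measure C)%E.
Proof.
move=> mA mB mC.
pose lam : {sigma_finite_measure set (measurableTypeR R) -> \bar R} :=
  lebesgue_measure.
have mAB := measurableX mA mB.
rewrite [LHS](@product_measure1E _ _ _ _ R (lam \x lam)%E lam _ _ mAB mC).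
by rewrite [X in (X * _)%E](@product_measure1E _ _ _ _ R lam lam _ _ mA mB).
Qed.

Lemma leb3_B3_lty : (mu (@B3 R) < +oo)%E.
Proof.
pose I : set (measurableTypeR R) := `[(-1), 1].
have mI : measurable I by exact: measurable_itv.
apply: (@le_lt_trans _ _ (mu ((I `*` I) `*` I))).
  apply: le_measure; rewrite ?inE//; first exact: measurable_B3.
    by apply: measurableX => //; exact: measurableX.
  move=> x /B3_coord[]; rewrite !ler_norml => h1 h2 h3.
  by split; [split|]; rewrite /I/= in_itv/=.
rewrite leb3_box// /I !lebesgue_measure_itv/= !lte_fin.
have -> : -1 < 1 :> R by lra.
by rewrite -!EFinM ltry.
Qed.

Lemma compact_box :
  compact ((`[(-1 : R), 1] `*` `[(-1 : R), 1]) `*` `[(-1 : R), 1]).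
Proof.
pose I : set R := `[(-1), 1]%classic.
have cI : compact I by exact: segment_compact.
exact: (compact_setX (compact_setX cI cI) cI).
Qed.

Lemma B3_sub_box : @B3 R `<=` (`[(-1 : R), 1] `*` `[(-1 : R), 1]) `*` `[(-1 : R), 1].
Proof.
move=> x /B3_coord[]; rewrite !ler_norml => h1 h2 h3.
by split; [split|]; rewrite /= in_itv/=.
Qed.

(** Continuity on the whole space gives a bound on the closed box around the ball; continuity in the
    open ball alone would not. This is one reason for extending the eigenfunctions. *)
Lemma continuous_bounded_B3 (f : R3 -> R) : continuous f ->
  exists M, forall x, @B3 R x -> `|f x| <= M.
Proof.
move=> cf.
have /compact_bounded[M [_ HM]] :
    compact (f @` ((`[(-1 : R), 1] `*` `[(-1 : R), 1]) `*` `[(-1 : R), 1])).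
  by apply: continuous_compact compact_box; exact: continuous_subspaceT.
exists (`|M| + 1) => x /B3_sub_box Kx; apply: HM; last by exists x.
by rewrite (le_lt_trans (ler_norm _))// ltrDl.
Qed.

End measurability.

(** * Fourier integrals over the ball *)

Section trigonometric_taylor.
Context {R : realType}.
Implicit Types a h A B : R.

Lemma abs_sin_le (h : R) : `|sin h| <= `|h|.
Proof.
have [h0|h0] := leP 0 h.
  have [c cI] := @MVT_segment R sin cos 0 h h0 (fun x _ => is_derive_sin x)
    ltac:(by apply: continuous_subspaceT => x; exact: continuous_sin).
  rewrite sin0 !subr0 => ->; rewrite normrM -[leRHS]mul1r ler_wpM2r//.
  by rewrite ler_norml cos_geN1 cos_le1.
have [c cI] := @MVT_segment R sin cos h 0 (ltW h0) (fun x _ => is_derive_sin x)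
    ltac:(by apply: continuous_subspaceT => x; exact: continuous_sin).
rewrite sin0 !sub0r => /(congr1 Num.norm); rewrite normrN => ->.
rewrite normrM normrN -[leRHS]mul1r ler_wpM2r//.
by rewrite ler_norml cos_geN1 cos_le1.
Qed.

Lemma one_sub_cosE h : 1 - cos h = 2 * sin (h / 2) ^+ 2.
Proof.
have -> : cos h = cos (h / 2 + h / 2) by congr cos; field.
rewrite cosD -!expr2; have := cos2Dsin2 (h / 2); lra.
Qed.

Lemma one_sub_cos_le h : 1 - cos h <= h ^+ 2.
Proof.
rewrite one_sub_cosE.
have : sin (h / 2) ^+ 2 <= (h / 2) ^+ 2.
  by rewrite -(real_normK (num_real (sin _))) -(real_normK (num_real (h / 2)));
    rewrite ler_pXn2r ?nnegrE ?abs_sin_le.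
nra.
Qed.

Lemma one_sub_cos_le_abs h : 1 - cos h <= `|h|.
Proof.
rewrite one_sub_cosE.
have h1 := abs_sin_le (h / 2).
have h2 : `|sin (h / 2)| <= 1 by rewrite ler_norml sin_geN1 sin_le1.
rewrite -(real_normK (num_real (sin _))).
have -> : `|h| = 2 * `|h / 2|.
  by rewrite normrM (ger0_norm (x := 2^-1))//; field.
have := normr_ge0 (sin (h / 2)); nra.
Qed.

Lemma abs_sin_sub_le h : `|sin h - h| <= h ^+ 2.
Proof.
have der (x : R) : is_derive x 1 (fun h => sin h - h) (cos x - 1).
  exact: is_deriveB.
have cont : continuous (fun h : R => sin h - h).
  by move=> x; apply: cvgB => //; exact: continuous_sin.
have bnd (x y : R) : `|x| <= `|y| -> `|(cos x - 1) * y| <= y ^+ 2.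
  move=> xy; rewrite normrM -(real_normK (num_real y)) expr2 ler_wpM2r//.
  rewrite distrC (ger0_norm (x := 1 - cos x)) ?subr_ge0 ?cos_le1//.
  exact: le_trans (one_sub_cos_le_abs _) xy.
have [h0|h0] := leP 0 h.
  have [x xI] := @MVT_segment R (fun h => sin h - h) (fun x => cos x - 1) 0 h h0
    (fun x _ => der x) (continuous_subspaceT cont).
  rewrite sin0 subr0 !subr0 => ->; apply: bnd.
  by move: xI; rewrite in_itv/= => /andP[? ?]; rewrite !ger0_norm.
have [x xI] := @MVT_segment R (fun h => sin h - h) (fun x => cos x - 1) h 0
  (ltW h0) (fun x _ => der x) (continuous_subspaceT cont).
rewrite sin0 subr0 !sub0r => /(congr1 Num.norm); rewrite normrN => ->.
rewrite -(sqrrN h); apply: bnd.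
move: xI; rewrite in_itv/= => /andP[? ?].
by rewrite normrN !ler0_norm//; lra.
Qed.

(** The remainder is uniform in [a], so it survives integration over the ball; the Fourier integrals
    are differentiated in this way, without a theorem on derivatives under the integral sign. *)
Lemma cos_sin_taylor A B a h :
  `|(A * cos (a + h) + B * sin (a + h)) - (A * cos a + B * sin a)
    - h * (B * cos a - A * sin a)| <= 2 * (`|A| + `|B|) * h ^+ 2.
Proof.
rewrite cosD sinD.
have -> : A * (cos a * cos h - sin a * sin h) + B * (sin a * cos h + cos a * sin h)
    - (A * cos a + B * sin a) - h * (B * cos a - A * sin a)
  = A * (cos a * (cos h - 1) - sin a * (sin h - h)) +
    B * (sin a * (cos h - 1) + cos a * (sin h - h)) by ring.
have h1 : `|cos h - 1| <= h ^+ 2.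
  by rewrite distrC ger0_norm ?subr_ge0 ?cos_le1// one_sub_cos_le.
have h2 := abs_sin_sub_le h.
have ca : `|cos a| <= 1 by rewrite ler_norml cos_geN1 cos_le1.
have sa : `|sin a| <= 1 by rewrite ler_norml sin_geN1 sin_le1.
have bnd (p q u v : R) : `|p| <= 1 -> `|q| <= 1 -> `|u| <= h ^+ 2 ->
    `|v| <= h ^+ 2 -> `|p * u + q * v| <= 2 * h ^+ 2.
  move=> p1 q1 uh vh; rewrite (le_trans (ler_normD _ _))// !normrM.
  have := normr_ge0 p; have := normr_ge0 q; have := normr_ge0 u.
  by have := normr_ge0 v; nra.
apply: le_trans (ler_normD _ _) _.
have -> : 2 * (`|A| + `|B|) * h ^+ 2 = `|A| * (2 * h ^+ 2) + `|B| * (2 * h ^+ 2).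
  by ring.
rewrite (normrM A) (normrM B); apply: lerD; apply: ler_wpM2l => //.
- by rewrite -mulNr; apply: bnd; rewrite ?normrN.
- exact: bnd.
Qed.

End trigonometric_taylor.

Section fourier.
Local Open Scope classical_set_scope.
Context {R : realType}.
Local Notation R3 := (R * R * R)%type.
Local Notation mu := (@leb3 R).
Local Notation B := (@B3 R).
Variable c : R.
Implicit Types (a b : R) (g : R3 -> R) (x y k : R3).

(** For real [g], the parameters (1, 0) and (0, 1) give the real and imaginary parts of the finite
    Fourier transform. The family is closed under differentiation: the derivative in direction [k]
    replaces [a], [b], [g y] by [c b], [- c a], [(k . y) g y]. *)
Definition fou a b g x : R :=
  \int[mu]_(y in B) ((a * cos (c * dot3 x y) + b * sin (c * dot3 x y)) * g y).

Definition L1B g := mu.-integrable B (EFin \o g).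

Lemma dot3_sym x y : dot3 x y = dot3 y x.
Proof. by rewrite /dot3; ring. Qed.

Lemma dot3Dl x k y : dot3 (x + k) y = dot3 x y + dot3 k y.
Proof. by rewrite /dot3/=; ring. Qed.

Lemma dot3Zl a x y : dot3 (a *: x) y = a * dot3 x y.
Proof. by rewrite /dot3/=; rewrite /GRing.scale/=; ring. Qed.

Lemma dot3_le k y : B y -> `|dot3 k y| <= 3 * `|k|.
Proof.
move=> /B3_coord[h1 h2 h3]; rewrite /dot3.
have k1 : `|k.1.1| <= `|k| by rewrite !prod_normE !le_max lexx.
have k2 : `|k.1.2| <= `|k| by rewrite !prod_normE !le_max lexx !orbT.
have k3 : `|k.2| <= `|k| by rewrite !prod_normE !le_max lexx !orbT.
rewrite (le_trans (ler_normD _ _))//.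
have {k1 h1} : `|k.1.1 * y.1.1| <= `|k|.
  by rewrite normrM -[leRHS]mulr1 ler_pM.
have {k2 h2} : `|k.1.2 * y.1.2| <= `|k|.
  by rewrite normrM -[leRHS]mulr1 ler_pM.
have {k3 h3} : `|k.2 * y.2| <= `|k|.
  by rewrite normrM -[leRHS]mulr1 ler_pM.
have := ler_normD (k.1.1 * y.1.1) (k.1.2 * y.1.2); lra.
Qed.

Lemma L1B_bounded g (h : R3 -> R) (M : R) : L1B g -> measurable_fun3 B h ->
  (forall x, B x -> `|h x| <= M) -> L1B (fun x => h x * g x).
Proof.
move=> ig mh hM; have mB := @measurable_B3 R.
have [mg _] := integrableP _ _ _ ig.
have ig' : mu.-integrable B (EFin \o (fun x => `|M| * `|g x|)).
  have := integrableZl mB `|M| (integrable_abse ig).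
  by apply: eq_integrable => // x _; rewrite /= EFinM.
apply: (le_integrable mB _ _ ig').
  apply/measurable_EFinP/measurable_funM => //.
  exact/measurable_EFinP.
move=> x Bx /=; rewrite lee_fin normrM [leRHS]ger0_norm ?mulr_ge0//.
rewrite ler_wpM2r//; exact: le_trans (hM _ Bx) (ler_norm _).
Qed.

Lemma trig_measurable a b x (D : set R3) : measurable3 D ->
  measurable_fun3 D (fun y => a * cos (c * dot3 x y) + b * sin (c * dot3 x y)).
Proof.
move=> mD; apply: continuous_measurable_fun3 => // y.
have cd : {for y, continuous (fun y => c * dot3 x y)}.
  apply: cvgM; first exact: cvg_cst.
  exact: continuous_dot3r.
apply: cvgD; apply: cvgM; try exact: cvg_cst.
- by apply: (cvg_comp _ _ cd); exact: continuous_cos.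
- by apply: (cvg_comp _ _ cd); exact: continuous_sin.
Qed.

Lemma trig_bound a b (t : R) : `|a * cos t + b * sin t| <= `|a| + `|b|.
Proof.
apply: le_trans (ler_normD _ _) _; rewrite !normrM.
by apply: lerD; rewrite -[leRHS]mulr1 ler_wpM2l// ler_norml
  ?cos_geN1 ?cos_le1 ?sin_geN1 ?sin_le1.
Qed.

Lemma fou_integrable a b g x : L1B g ->
  L1B (fun y => (a * cos (c * dot3 x y) + b * sin (c * dot3 x y)) * g y).
Proof.
move=> ig; apply: L1B_bounded ig _ _.
  by apply: trig_measurable; exact: measurable_B3.
by move=> y _; exact: trig_bound.
Qed.

Lemma L1B_dot3 g k : L1B g -> L1B (fun y => dot3 k y * g y).
Proof.
move=> ig; apply: (L1B_bounded (M := 3 * `|k|)) => //.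
- apply: continuous_measurable_fun3; first exact: measurable_B3.
  exact: continuous_dot3r.
- by move=> y; exact: dot3_le.
Qed.

Lemma fou_bound a b g x : L1B g ->
  `|fou a b g x| <= (`|a| + `|b|) * \int[mu]_(y in B) `|g y|.
Proof.
move=> ig; have mB := @measurable_B3 R.
apply: le_trans (le_normr_Rintegral mB (fou_integrable _ _ _ ig)) _.
rewrite -RintegralZl//; last exact: integrable_norm.
apply: le_Rintegral => //.
- exact/integrable_norm/fou_integrable.
- have := integrableZl mB (`|a| + `|b|) (integrable_abse ig).
  by apply: eq_integrable => // y _; rewrite /= EFinM.
by move=> y By; rewrite normrM ler_wpM2r ?trig_bound.
Qed.

(** The constant is 18 = 2 * 3^2, with 2 from [cos_sin_taylor] and 3 from [dot3_le], where [k] is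
    measured in the sup norm. *)
Lemma fou_taylor a b g x k : L1B g ->
  `|fou a b g (x + k) - fou a b g x
      - fou (c * b) (- (c * a)) (fun y => dot3 k y * g y) x|
  <= 18 * (`|a| + `|b|) * c ^+ 2 * (\int[mu]_(y in B) `|g y|) * `|k| ^+ 2.
Proof.
move=> ig; have mB := @measurable_B3 R.
have i1 := fou_integrable a b (x + k) ig.
have i2 := fou_integrable a b x ig.
have i3 := fou_integrable (c * b) (- (c * a)) x (L1B_dot3 k ig).
have i12 : mu.-integrable B (EFin \o (fun y =>
   (a * cos (c * dot3 (x + k) y) + b * sin (c * dot3 (x + k) y)) * g y
   - (a * cos (c * dot3 x y) + b * sin (c * dot3 x y)) * g y)).
  exact: (integrableB mB i1 i2).
rewrite /fou -RintegralB// -RintegralB//.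
apply: le_trans (le_normr_Rintegral mB _) _; first exact: (integrableB mB i12 i3).
rewrite mulrAC -RintegralZl//; last exact: integrable_norm.
apply: le_Rintegral => //.
- exact/integrable_norm/(integrableB mB i12 i3).
- set M := _ * _ * _ * _.
  have := integrableZl mB M (integrable_abse ig).
  by apply: eq_integrable => // y _; rewrite /= EFinM.
move=> y By.
rewrite mulrA -!mulrBl normrM ler_wpM2r// dot3Dl mulrDr.
have -> : (c * b * cos (c * dot3 x y) + - (c * a) * sin (c * dot3 x y)) * dot3 k y
  = (c * dot3 k y) * (b * cos (c * dot3 x y) - a * sin (c * dot3 x y)) by ring.
apply: le_trans (cos_sin_taylor _ _ _ _) _.
have : dot3 k y ^+ 2 <= 9 * `|k| ^+ 2.
  rewrite -(real_normK (num_real (dot3 _ _))).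
  have -> : 9 * `|k| ^+ 2 = (3 * `|k|) ^+ 2 by ring.
  by rewrite ler_pXn2r ?nnegrE ?mulr_ge0// dot3_le.
rewrite exprMn => h.
have -> : 18 * (`|a| + `|b|) * c ^+ 2 * `|k| ^+ 2 =
  2 * (`|a| + `|b|) * (c ^+ 2 * (9 * `|k| ^+ 2)) by ring.
by rewrite ler_wpM2l ?mulr_ge0 ?addr_ge0// ler_wpM2l// sqr_ge0.
Qed.

End fourier.

Section quadratic_remainder.
Context {R : realType} {V W : normedModType R}.

(** A quadratic remainder is [o(|k|)]; the bound by [K] makes the linear map [df] continuous, as a
    differential must be. *)
Lemma quadratic_is_diff (f df : V -> W) (x : V) (M K : R) : linear df ->
  (forall k, `|df k| <= K * `|k|) ->
  (forall k, `|f (x + k) - f x - df k| <= M * `|k| ^+ 2) ->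
  is_diff x f df.
Proof.
move=> ldf bdf fM.
pose L : {linear V -> W} := HB.pack df (GRing.isLinear.Build R V W _ df ldf).
have Lc : continuous L.
  apply/linear_bounded_continuous/linear_boundedP.
  exists (`|K|); split; first by rewrite num_real.
  move=> r Kr y; apply: le_trans (bdf y) _; rewrite ler_wpM2r//.
  exact: le_trans (ler_norm _) (ltW Kr).
have Lo : f \o shift x = cst (f x) + L +o_ 0 id.
  have M0 : 0 < `|M| + 1 by rewrite ltr_wpDl.
  apply/eqaddoP => e e0; near=> k => /=.
  have -> : (f \o shift x - (cst (f x) + df)) k = f (x + k) - f x - df k.
    by rewrite !fctE/= opprD addrA [k + x]addrC.
  apply: le_trans (fM k) _.
  rewrite expr2 mulrA ler_wpM2r//.
  apply: (@le_trans _ _ ((`|M| + 1) * `|k|)).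
    by rewrite ler_wpM2r// (le_trans (ler_norm _))// lerDl.
  rewrite mulrC -ler_pdivlMr//; near: k; apply: nbhs0_le.
  exact: (@divr_gt0 R e _ e0 M0).
have dL := diff_unique Lc Lo.
have dfx : differentiable f x by apply/diff_locallyP; rewrite dL.
by apply: DiffDef => //; rewrite dL.
Unshelve. all: by end_near. Qed.

End quadratic_remainder.

Section fourier_diff.
Local Open Scope classical_set_scope.
Context {R : realType}.
Local Notation R3 := (R * R * R)%type.
Local Notation mu := (@leb3 R).
Local Notation B := (@B3 R).
Variable c : R.
Implicit Types (a b : R) (g : R3 -> R) (x y k : R3).

Lemma fou_linear a b g x : L1B g ->
  linear (fun k => fou c a b (fun y => dot3 k y * g y) x : R).
Proof.
move=> ig r k l; have mB := @measurable_B3 R.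
have i1 := fou_integrable c a b x (L1B_dot3 k ig).
have i2 := fou_integrable c a b x (L1B_dot3 l ig).
rewrite /fou /GRing.scale/= -RintegralZl// -RintegralD//; last first.
  by have := integrableZl mB r i1; apply: eq_integrable.
by apply: eq_Rintegral => y _; rewrite dot3Dl dot3Zl; ring.
Qed.

Lemma fou_dot3_bound a b g x k : L1B g ->
  `|fou c a b (fun y => dot3 k y * g y) x| <=
  (`|a| + `|b|) * (3 * \int[mu]_(y in B) `|g y|) * `|k|.
Proof.
move=> ig; have mB := @measurable_B3 R.
apply: le_trans (fou_bound _ _ _ _ (L1B_dot3 k ig)) _.
rewrite -mulrA ler_wpM2l ?addr_ge0// mulrAC -RintegralZl//; last first.
  exact: integrable_norm.
apply: le_Rintegral => //.
- exact/integrable_norm/L1B_dot3.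
- have := integrableZl mB (3 * `|k|) (integrable_abse ig).
  by apply: eq_integrable => // y _; rewrite /= EFinM.
by move=> y By; rewrite normrM ler_wpM2r ?dot3_le.
Qed.

Lemma is_diff_fou a b g x : L1B g ->
  is_diff x (fou c a b g)
    (fun k => fou c (c * b) (- (c * a)) (fun y => dot3 k y * g y) x : R).
Proof.
move=> ig; apply: quadratic_is_diff.
- exact: fou_linear.
- by move=> k; exact: fou_dot3_bound.
- by move=> k; exact: fou_taylor.
Qed.

Lemma fou_continuous a b g : L1B g -> continuous (fou c a b g).
Proof.
move=> ig x; apply: differentiable_continuous.
by case: (is_diff_fou a b x ig).
Qed.

Lemma fou_is_derive a b g x k : L1B g ->
  is_derive x k (fou c a b g)
    (fou c (c * b) (- (c * a)) (fun y => dot3 k y * g y) x).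
Proof.
move=> ig; have [dF dE] := is_diff_fou a b x ig; apply: DeriveDef.
- exact: diff_derivable.
- by rewrite deriveE// dE.
Qed.

Lemma fou_partial a b g i : L1B g ->
  partial i (fou c a b g) =
  fou c (c * b) (- (c * a)) (fun y => dot3 (basis3 R i) y * g y).
Proof.
by move=> ig; apply/funext => x; case: (fou_is_derive a b x (basis3 R i) ig).
Qed.

Lemma fou_smooth a b g : L1B g -> smooth (fou c a b g).
Proof.
move=> ig l.
have [a' [b' [g' [ig' ->]]]] : exists a' b' g', L1B g' /\
    foldr (@partial R) (fou c a b g) l = fou c a' b' g'.
  elim: l => [|i l [a' [b' [g' [ig' IH]]]]]; first by exists a, b, g.
  exists (c * b'), (- (c * a')), (fun y => dot3 (basis3 R i) y * g' y).
  by split; [exact: L1B_dot3|rewrite /= IH fou_partial].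
split; first exact: fou_continuous.
by move=> i x; case: (fou_is_derive a' b' x (basis3 R i) ig').
Qed.

End fourier_diff.

(** * The prolate operator in Cartesian coordinates *)

Section chain_rule.
Local Open Scope classical_set_scope.
Context {R : realType}.

Lemma is_derive_sliceP (V W : normedModType R) (f : V -> W) (x v : V) (df : W) :
  is_derive x v f df <-> is_derive (0 : R) 1 (fun h : R => f (h *: v + x)) df.
Proof.
have E : 'D_v f x = 'D_1 (fun h : R => f (h *: v + x)) 0.
  rewrite /derive; set g1 := fun h => h^-1 *: _; set g2 := fun h => h^-1 *: _.
  suff -> : g1 = g2 by [].
  by rewrite funeqE /g1 /g2 => h /=; rewrite addr0 scale0r add0r [_%:A]mulr1.
split=> -[d <-].
- by apply: DeriveDef; [exact: (derivable1P f x v).1 d|exact: esym E].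
- by apply: DeriveDef; [exact: (derivable1P f x v).2 d|exact: E].
Qed.

Lemma is_derive1_is_diff (W : normedModType R) (f : R -> W) (t : R) (df : W) :
  is_derive t 1 f df -> is_diff t f (fun k => k *: df).
Proof.
move=> [d <-]; have dd : differentiable f t by exact/derivable1_diffP.
by apply: DiffDef => //; rewrite deriv1E// derive1E.
Qed.

Lemma is_diff_is_derive1 (V W : normedModType R) (f df : V -> W) (x v : V) :
  is_diff x f df -> is_derive x v f (df v).
Proof.
by move=> [d <-]; apply: DeriveDef; [exact: diff_derivable|rewrite deriveE].
Qed.

(** Only the outer function needs a differential. The inner one is restricted to the line through
    [x] in direction [v], where having a derivative and being differentiable coincide. *)
Lemma is_derive_comp_diff (V W U : normedModType R) (f : V -> W) (F dF : W -> U)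
    (x v : V) (df : W) :
  is_derive x v f df -> is_diff (f x) F dF -> is_derive x v (F \o f) (dF df).
Proof.
move=> /is_derive_sliceP/is_derive1_is_diff df1 dF1; apply/is_derive_sliceP.
have dF1' : is_diff (f (0 *: v + x)) F dF by rewrite scale0r add0r.
have := is_diff_is_derive1 (1 : R) (is_diff_comp df1 dF1').
by rewrite /= scale1r.
Qed.

Lemma is_derive_comp1 (V : normedModType R) (f : V -> R) (g : R -> R)
    (x v : V) (df dg : R) :
  is_derive x v f df -> is_derive (f x) 1 g dg ->
  is_derive x v (g \o f) (df * dg).
Proof.
by move=> df1 /is_derive1_is_diff dg1; exact: (is_derive_comp_diff df1 dg1).
Qed.

Lemma is_derive_pair (V W U : normedModType R) (f : V -> W) (g : V -> U)
    (x v : V) (df : W) (dg : U) :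
  is_derive x v f df -> is_derive x v g dg ->
  is_derive x v (fun y => (f y, g y)) (df, dg).
Proof.
move=> /is_derive_sliceP/is_derive1_is_diff df1.
move=> /is_derive_sliceP/is_derive1_is_diff dg1; apply/is_derive_sliceP.
have := is_diff_is_derive1 (1 : R) (is_diff_pair df1 dg1).
by rewrite /= !scale1r.
Qed.

End chain_rule.

Section coordinates.
Local Open Scope classical_set_scope.
Context {R : realType}.
Local Notation R3 := (R * R * R)%type.
Implicit Types (x y k : R3) (i j : 'I_3).

Definition coord3 i x : R := dot3 (basis3 R i) x.

Lemma coord3E x : (coord3 0 x = x.1.1) * (coord3 1 x = x.1.2) *
  (coord3 2%R x = x.2).
Proof. by rewrite /coord3 /dot3 /basis3 /= !mul0r !mul1r !addr0 !add0r. Qed.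

Lemma big_ord3 (V : nmodType) (F : 'I_3 -> V) :
  \sum_(i < 3) F i = F 0 + F 1 + F 2%R.
Proof.
rewrite !big_ord_recl big_ord0 addr0 addrA; congr (_ + _ + _); congr F;
  exact: val_inj.
Qed.

Lemma dot3_coord3 x y : dot3 x y = \sum_(i < 3) coord3 i x * coord3 i y.
Proof. by rewrite big_ord3 !coord3E. Qed.

Lemma coord3_basis3 i j : coord3 i (basis3 R j) = (i == j)%:R.
Proof.
rewrite /coord3 /dot3 /basis3/=.
by case: i j => [[|[|[|//]]] ?] [[|[|[|//]]] ?]; rewrite -val_eqE/=; ring.
Qed.

Lemma coord3Dl i (a : R) x y : coord3 i (a *: x + y) = a * coord3 i x + coord3 i y.
Proof. by rewrite /coord3 !(dot3_sym (basis3 R i)) dot3Dl dot3Zl. Qed.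

Lemma basis3_decomp x : x = \sum_(i < 3) coord3 i x *: basis3 R i.
Proof.
have ext (u v : R3) : u.1.1 = v.1.1 -> u.1.2 = v.1.2 -> u.2 = v.2 -> u = v.
  by case: u v => [[? ?] ?] [[? ?] ?] /= -> -> ->.
rewrite big_ord3 !coord3E; apply: ext; rewrite /= /GRing.scale/=; ring.
Qed.

Lemma linear_coord3 (f : R3 -> R) (fl : forall a x y, f (a *: x + y) = a * f x + f y)
  x : \sum_(i < 3) coord3 i x * f (basis3 R i) = f x.
Proof.
have f0 : f 0 = 0.
  by have := fl 1 0 0; rewrite scale1r addr0 mul1r => /eqP; rewrite -subr_eq subrr
    => /eqP.
have -> : f x = f (coord3 0 x *: basis3 R 0 + (coord3 1 x *: basis3 R 1 +
    (coord3 2%R x *: basis3 R 2%R + 0))).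
  by rewrite addr0 addrA {1}(basis3_decomp x) big_ord3.
by rewrite !fl f0 big_ord3; ring.
Qed.

Lemma is_derive_linear3 (f : R3 -> R)
    (fl : forall a x y, f (a *: x + y) = a * f x + f y) x v :
  is_derive x v f (f v).
Proof.
apply: is_diff_is_derive1.
have fE k : f k = k.1.1 * f (basis3 R 0) + k.1.2 * f (basis3 R 1)
    + k.2 * f (basis3 R 2%R).
  by rewrite -(linear_coord3 fl) big_ord3 !coord3E.
apply: (@quadratic_is_diff _ _ _ _ _ _ 0
  (`|f (basis3 R 0)| + `|f (basis3 R 1)| + `|f (basis3 R 2%R)|)).
- by move=> a k l; rewrite fl.
- move=> k; have k1 : `|k.1.1| <= `|k| by rewrite !prod_normE !le_max lexx.
  have k2 : `|k.1.2| <= `|k| by rewrite !prod_normE !le_max lexx !orbT.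
  have k3 : `|k.2| <= `|k| by rewrite !prod_normE !le_max lexx !orbT.
  rewrite fE (le_trans (ler_normD _ _))// [leRHS]mulrDl lerD//.
    rewrite (le_trans (ler_normD _ _))// [leRHS]mulrDl lerD//.
      by rewrite normrM mulrC ler_wpM2l.
    by rewrite normrM mulrC ler_wpM2l.
  by rewrite normrM mulrC ler_wpM2l.
- move=> k; have := fl 1 x k; rewrite scale1r mul1r => ->.
  have -> : f x + f k - f x - f k = 0 by ring.
  by rewrite normr0 mul0r.
Qed.

Lemma is_derive_coord3 i x v : is_derive x v (coord3 i) (coord3 i v).
Proof. exact/is_derive_linear3/coord3Dl. Qed.

Lemma is_derive_dot3xx x v : is_derive x v (fun y => dot3 y y) (2 * dot3 x v).
Proof.
have -> : (fun y => dot3 y y) =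
    coord3 0 * coord3 0 + coord3 1 * coord3 1 + coord3 2%R * coord3 2%R.
  by apply/funext => y; rewrite !fctE dot3_coord3 big_ord3.
have d i := is_deriveM (is_derive_coord3 i x v) (is_derive_coord3 i x v).
apply: is_derive_eq (is_deriveD (is_deriveD (d 0) (d 1)) (d 2%R)) _.
by rewrite dot3_coord3 big_ord3 /GRing.scale/=; ring.
Qed.

Lemma enorm_ge0 x : 0 <= enorm x. Proof. exact: sqrtr_ge0. Qed.

Lemma sqr_enorm x : enorm x ^+ 2 = dot3 x x.
Proof. by rewrite sqr_sqrtr ?dot3_ge0. Qed.

Lemma enorm_gt0 x : (0 < enorm x) = (x != 0).
Proof.
rewrite sqrtr_gt0 lt_def dot3_ge0 andbT; apply/idP/idP; apply: contra.
  by move=> /eqP ->; rewrite /dot3/= !mulr0 !addr0.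
case: x => [[a b] d]; rewrite /dot3/= -!expr2 !paddr_eq0 ?addr_ge0 ?sqr_ge0//.
by rewrite !sqrf_eq0 => /andP[/andP[/eqP-> /eqP->] /eqP->].
Qed.

Lemma is_derive_enorm_inv x v : x != 0 ->
  is_derive x v (fun y => (enorm y)^-1) (- (dot3 x v * (enorm x)^-1 ^+ 3)).
Proof.
move=> x0; have n0 : 0 < enorm x by rewrite enorm_gt0.
have d0 : 0 < dot3 x x by rewrite -sqr_enorm exprn_gt0.
have dn : is_derive x v (@enorm R) (2 * dot3 x v * (2 * enorm x)^-1).
  exact: (is_derive_comp1 (is_derive_dot3xx x v) (is_derive1_sqrt d0)).
have dV : is_derive (enorm x) 1 (fun t => t^-1) (- enorm x ^- 2 *: 1).
  by apply: is_deriveV; rewrite ?gt_eqF//; exact: is_derive_id.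
apply: is_derive_eq (is_derive_comp1 dn dV) _.
by rewrite /GRing.scale/=; field; rewrite gt_eqF.
Qed.

End coordinates.

(** * The Laplacian of the sphere and [Dc] in terms of Cartesian second derivatives *)

Section two_jets.
Local Open Scope classical_set_scope.
Context {R : realType}.
Local Notation R3 := (R * R * R)%type.
Implicit Types (x y k w : R3) (i j : 'I_3).

(** [P1 k] and [P2 k l] are the directional derivatives of first and second order. Carrying them as
    data that are linear in the directions turns each computation with [Dc] into algebra at a single
    point. *)
Record jet2 (P : R3 -> R) (P1 : R3 -> R3 -> R) (P2 : R3 -> R3 -> R3 -> R) :=
  Jet2 {
    jet_diff : forall x, is_diff x P (fun k => P1 k x : R);
    jet_diff1 : forall k x, is_diff x (P1 k) (fun l => P2 k l x : R);
    jet_lin1 : forall x a k l, P1 (a *: k + l) x = a * P1 k x + P1 l x;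
    jet_lin2l : forall x m a k l, P2 (a *: k + l) m x = a * P2 k m x + P2 l m x;
    jet_lin2r : forall x m a k l, P2 m (a *: k + l) x = a * P2 m k x + P2 m l x
  }.

Lemma is_derive_scale3 (f : R3 -> R) x v (df : R) : is_derive x v f df ->
  is_derive x v (fun y => f y *: y) (f x *: v + df *: x).
Proof.
move=> dfx.
have d i := is_deriveM dfx (is_derive_coord3 i x v).
have -> : (fun y => f y *: y) =
    (fun y => ((f * coord3 0) y, (f * coord3 1) y, (f * coord3 2%R) y)).
  by apply/funext => -[[a b] e]; rewrite !fctE !coord3E.
apply: is_derive_eq (is_derive_pair (is_derive_pair (d 0) (d 1)) (d 2%R)) _.
rewrite !coord3E; case: x v {dfx d} => [[a b] e] [[a' b'] e'] /=.
by congr (_, _, _); congr (_ + _); exact: mulrC.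
Qed.

Lemma open_neq0 : open [set y : R3 | y != 0].
Proof.
have -> : [set y : R3 | y != 0] = (fun y => dot3 y y) @^-1` `]0, +oo[.
  by apply/seteqP; split => y /=; rewrite in_itv/= andbT -enorm_gt0 sqrtr_gt0.
by move: (@continuous_dot3xx R) => /continuousP; apply; exact: interval_open.
Qed.

Variables (P : R3 -> R) (P1 : R3 -> R3 -> R) (P2 : R3 -> R3 -> R3 -> R).
Hypothesis jP : jet2 P P1 P2.

(** The retraction onto the sphere of radius [r], through which [sphere_lapl] extends a function off
    the sphere. *)
Let q (r : R) y := r *: ((enorm y)^-1 *: y).

Let dq r y v : y != 0 -> is_derive y v (q r)
  (r *: ((enorm y)^-1 *: v + - (dot3 y v * (enorm y)^-1 ^+ 3) *: y)).
Proof.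
move=> y0; apply: is_deriveZ; apply: is_derive_scale3.
exact: is_derive_enorm_inv.
Qed.

Let P1_sum k x : P1 k x = \sum_(j < 3) coord3 j k * P1 (basis3 R j) x.
Proof. by rewrite (linear_coord3 (jet_lin1 jP x)). Qed.

Lemma jet_lin1Z (a : R) k x : P1 (a *: k) x = a * P1 k x.
Proof.
have z : P1 0 x = 0.
  have := jet_lin1 jP x 1 0 0; rewrite scale1r addr0 mul1r => /eqP.
  by rewrite -subr_eq subrr => /eqP.
by rewrite -[a *: k]addr0 (jet_lin1 jP) z addr0.
Qed.

Lemma jet_lin2Zl (a : R) m k x : P2 (a *: k) m x = a * P2 k m x.
Proof.
have z : P2 0 m x = 0.
  have := jet_lin2l jP x m 1 0 0; rewrite scale1r addr0 mul1r => /eqP.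
  by rewrite -subr_eq subrr => /eqP.
by rewrite -[a *: k]addr0 (jet_lin2l jP) z addr0.
Qed.

Lemma jet_lin2Zr (a : R) m k x : P2 m (a *: k) x = a * P2 m k x.
Proof.
have z : P2 m 0 x = 0.
  have := jet_lin2r jP x m 1 0 0; rewrite scale1r addr0 mul1r => /eqP.
  by rewrite -subr_eq subrr => /eqP.
by rewrite -[a *: k]addr0 (jet_lin2r jP) z addr0.
Qed.

Let partial_q r i y : y != 0 ->
  partial i (fun y => P (q r y)) y =
  r * (enorm y)^-1 * P1 (basis3 R i) (q r y)
  - r * ((enorm y)^-1 ^+ 3 * coord3 i y) *
    \sum_(j < 3) coord3 j y * P1 (basis3 R j) (q r y).
Proof.
move=> y0.
have [_ ] := is_derive_comp_diff (dq r (basis3 R i) y0) (jet_diff jP (q r y)).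
rewrite /partial => ->.
rewrite jet_lin1Z addrC (jet_lin1 jP) jet_lin1Z (P1_sum y).
by rewrite (dot3_sym y) -/(coord3 i y); ring.
Qed.

(** The classical splitting on the unit sphere: the flat Laplacian minus the second normal
    derivative minus the mean curvature 2 times the normal derivative. The powers of [r] come from
    the dilation. *)
Lemma sphere_lapl_jet2 (r : R) w : enorm w = 1 ->
  sphere_lapl (fun y => P (r *: y)) w =
  r ^+ 2 * (\sum_(i < 3) P2 (basis3 R i) (basis3 R i) (r *: w)
            - P2 w w (r *: w)) - 2 * r * P1 w (r *: w).
Proof.
move=> w1; have w0 : w != 0 by rewrite -enorm_gt0 w1.
have qw : q r w = r *: w by rewrite /q w1 invr1 scale1r.
have ww : dot3 w w = 1 by rewrite -sqr_enorm w1 expr1n.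
rewrite /sphere_lapl /lapl.
have second i : partial i (partial i (fun y => P (q r y))) w =
   - (r * coord3 i w * P1 (basis3 R i) (r *: w))
   + r ^+ 2 * (P2 (basis3 R i) (basis3 R i) (r *: w)
               - coord3 i w * P2 (basis3 R i) w (r *: w))
   - (r * (1 - 3 * coord3 i w ^+ 2) * P1 w (r *: w)
      + r * coord3 i w * (P1 (basis3 R i) (r *: w)
        + r * (P2 w (basis3 R i) (r *: w) - coord3 i w * P2 w w (r *: w)))).
  pose rho y := (enorm y)^-1.
  pose G := (fun y => r * rho y * P1 (basis3 R i) (q r y)
    - r * (rho y ^+ 3 * coord3 i y) *
      \sum_(j < 3) coord3 j y * P1 (basis3 R j) (q r y)).
  (* The formula for the first derivative is available only off the origin; since differentiation is
     local, its validity near [w] allows a second one. *)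
  have nearG : \forall y \near w, partial i (fun y => P (q r y)) y = G y.
    have : \forall y \near w, y != 0.
      by apply: (open_nbhs_nbhs (A := [set y : R3 | y != 0]));
        split; [exact: open_neq0|exact: w0].
    by apply: filterS => y; exact: partial_q.
  rewrite {1}/partial (near_eq_derive _ nearG).
  have drho := is_derive_enorm_inv (basis3 R i) w0.
  rewrite w1 invr1 expr1n mulr1 dot3_sym -/(coord3 i w) in drho.
  have dqw := dq r (basis3 R i) w0.
  rewrite w1 invr1 expr1n mulr1 scale1r dot3_sym -/(coord3 i w) in dqw.
  have dP1 k := is_derive_comp_diff dqw (jet_diff1 jP k (q r w)).
  have dP1E k : P2 k (r *: (basis3 R i + - coord3 i w *: w)) (q r w) =
      r * (P2 k (basis3 R i) (r *: w) - coord3 i w * P2 k w (r *: w)).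
    by rewrite qw jet_lin2Zr addrC (jet_lin2r jP); ring.
  have dS := is_derive_sum (fun j => is_deriveM
    (is_derive_coord3 j w (basis3 R i)) (dP1 (basis3 R j))).
  have d1 := is_deriveM (is_deriveZ r drho) (dP1 (basis3 R i)).
  have d2 := is_deriveM (is_deriveZ r
    (is_deriveM (is_deriveX 3 drho) (is_derive_coord3 i w (basis3 R i)))) dS.
  have -> : G = (r \*: (fun y => (enorm y)^-1)) * (P1 (basis3 R i) \o q r)
      - (r \*: ((fun y => (enorm y)^-1) ^+ 3 * coord3 i)) *
        (\sum_(j < 3) coord3 j * (P1 (basis3 R j) \o q r)).
    apply/funext => y; rewrite /G !fctE /GRing.scale/= /rho.
    by congr (_ - _ * _); rewrite fct_sumE.
  have [_ ->] := is_deriveB d1 d2.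
  have SE : \sum_(j < 3) (coord3 j w *: P2 (basis3 R j)
        (r *: (basis3 R i + - coord3 i w *: w)) (q r w) +
      (P1 (basis3 R j) \o q r) w *: coord3 j (basis3 R i)) =
      P1 (basis3 R i) (r *: w)
      + r * (P2 w (basis3 R i) (r *: w) - coord3 i w * P2 w w (r *: w)).
    pose f m : R := r * (P2 m (basis3 R i) (r *: w) - coord3 i w * P2 m w (r *: w)).
    have fl (t : R) m l : f (t *: m + l) = t * f m + f l.
      by rewrite /f !(jet_lin2l jP); ring.
    rewrite -/(f w) -(linear_coord3 fl) (P1_sum (basis3 R i)) -big_split.
    apply: eq_bigr => j _; rewrite dP1E /= qw addrC; congr (_ + _); exact: mulrC.
  have TE : (\sum_(j < 3) coord3 j * (P1 (basis3 R j) \o q r)) w = P1 w (r *: w).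
    by rewrite fct_sumE -qw (P1_sum w).
  rewrite SE TE dP1E coord3_basis3 eqxx !fctE /= w1 invr1 qw.
  set x := r *: w.
  by rewrite /GRing.scale/= /GRing.scale/=; ring.
rewrite (eq_bigr _ (fun i _ => second i)).
have H1 := P1_sum w (r *: w).
have H2 := linear_coord3 (fun a k l => jet_lin2l jP (r *: w) w a k l) w.
have H3 := linear_coord3 (fun a k l => jet_lin2r jP (r *: w) w a k l) w.
have H4 := dot3_coord3 w w.
rewrite ww in H4; set x := r *: w in H1 H2 H3 *.
rewrite !big_ord3 in H1 H2 H3 H4 *.
set s1 := P1 w x in H1 *; set s2 := P2 w w x in H2 H3 *.
(* The terms are grouped so that only the contractions in [H1] to [H4] occur. As [|w| = 1], the
   coefficient [3 - 3 |w|^2] vanishes, and two copies of [- r s1] remain. *)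
transitivity (- r * (coord3 0 w * P1 (basis3 R 0) x +
     coord3 1 w * P1 (basis3 R 1) x + coord3 2%R w * P1 (basis3 R 2%R) x)
  + r ^+ 2 * (P2 (basis3 R 0) (basis3 R 0) x + P2 (basis3 R 1) (basis3 R 1) x
      + P2 (basis3 R 2%R) (basis3 R 2%R) x -
    (coord3 0 w * P2 (basis3 R 0) w x + coord3 1 w * P2 (basis3 R 1) w x
     + coord3 2%R w * P2 (basis3 R 2%R) w x))
  - (r * (3 - 3 * (coord3 0 w * coord3 0 w + coord3 1 w * coord3 1 w
       + coord3 2%R w * coord3 2%R w)) * s1
     + r * (coord3 0 w * P1 (basis3 R 0) x +
       coord3 1 w * P1 (basis3 R 1) x + coord3 2%R w * P1 (basis3 R 2%R) x)
     + r ^+ 2 * ((coord3 0 w * P2 w (basis3 R 0) x + coord3 1 w * P2 w (basis3 R 1) x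
     + coord3 2%R w * P2 w (basis3 R 2%R) x) - (coord3 0 w * coord3 0 w
       + coord3 1 w * coord3 1 w + coord3 2%R w * coord3 2%R w) * s2))).
  by ring.
by rewrite H3 H2 -H4 -H1; ring.
Qed.

(** The term in [2 / r] cancels against the mean curvature term of the sphere, and the second normal
    derivative that the sphere subtracts is restored. The outcome has no singular coefficient, so it
    makes sense at the origin too. *)
Lemma Dc_jet2 (c : R) x : x != 0 ->
  Dc c P x = - (\sum_(i < 3) P2 (basis3 R i) (basis3 R i) x) + P2 x x x
    + 4 * P1 x x + c ^+ 2 * dot3 x x * P x.
Proof.
move=> x0; have r0 : 0 < enorm x by rewrite enorm_gt0.
rewrite /Dc.
set r := enorm x in r0 *; set w := r^-1 *: x.
have xE : x = r *: w by rewrite /w scalerA divff ?scale1r// gt_eqF.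
have w1 : enorm w = 1.
  rewrite /enorm /w dot3Zl dot3_sym dot3Zl -sqr_enorm -/r.
  by rewrite expr2 mulKf ?mulVf ?gt_eqF// sqrtr1.
have dray t : is_derive t (1 : R) (fun t : R => t *: w) w.
  by have := is_diff_is_derive1 (1 : R) (is_diff_scalel t w); rewrite scale1r.
have ray1 : derive1 (fun t => P (t *: w)) = (fun t => P1 w (t *: w)).
  apply/funext => t; rewrite derive1E.
  by case: (is_derive_comp_diff (dray t) (jet_diff jP (t *: w))).
have ray2 : derive1n 2 (fun t => P (t *: w)) r = P2 w w (r *: w).
  rewrite derive1nS derive1n1 ray1 derive1E.
  by case: (is_derive_comp_diff (dray r) (jet_diff1 jP w (r *: w))).
have P2x m : P2 x m x = r * P2 w m x by rewrite {1}xE jet_lin2Zl.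
rewrite ray2 ray1 sphere_lapl_jet2// -xE P2x -sqr_enorm -/r.
have -> : P2 w x x = r * P2 w w x by rewrite {1}xE jet_lin2Zr.
have -> : P1 x x = r * P1 w x by rewrite {1}xE jet_lin1Z.
by field; rewrite gt_eqF.
Qed.

End two_jets.

(** * Smooth extension of the eigenfunctions and their equation on the whole ball *)

Section prolate_pde.
Local Open Scope classical_set_scope.
Context {R : realType}.
Local Notation R3 := (R * R * R)%type.
Local Notation B := (@B3 R).
Implicit Types (x y k w : R3) (i : 'I_3).

Definition fou1 (c a b : R) (g : R3 -> R) k : R3 -> R :=
  fou c (c * b) (- (c * a)) (fun y => dot3 k y * g y).

Definition fou2 (c a b : R) (g : R3 -> R) k l : R3 -> R :=
  fou1 c (c * b) (- (c * a)) (fun y => dot3 k y * g y) l.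

Lemma fou_jet2 (c a b : R) (g : R3 -> R) : L1B g ->
  jet2 (fou c a b g) (fou1 c a b g) (fou2 c a b g).
Proof.
move=> ig; split.
- by move=> x; exact: is_diff_fou.
- by move=> k x; apply: is_diff_fou; exact: L1B_dot3.
- by move=> x r k l; exact: (fou_linear c (c * b) (- (c * a)) x ig r k l).
- move=> x m r k l; rewrite /fou2 /fou1.
  have sw n : (fun y => dot3 m y * (dot3 n y * g y)) =
      (fun y => dot3 n y * (dot3 m y * g y)).
    by apply/funext => y; ring.
  rewrite !sw; exact: (fou_linear c _ _ x (L1B_dot3 m ig) r k l).
- by move=> x m r k l; exact: (fou_linear c _ _ x (L1B_dot3 m ig) r k l).
Qed.

Lemma enormZ (r : R) x : enorm (r *: x) = `|r| * enorm x.
Proof.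
by rewrite /enorm dot3Zl dot3_sym dot3Zl mulrA -expr2 sqrtrM ?sqr_ge0// sqrtr_sqr.
Qed.

(** The radial derivatives depend on values along the ray near [r < 1], and the spherical part on
    values on the sphere of radius [r]; all these points lie in the ball. *)
Lemma Dc_eq_on_ball (c : R) (f h : R3 -> R) x : (forall y, B y -> f y = h y) ->
  B x -> x != 0 -> Dc c f x = Dc c h x.
Proof.
move=> fh Bx x0; have r0 : 0 < enorm x by rewrite enorm_gt0.
have r1 : enorm x < 1 by [].
rewrite /Dc; set r := enorm x in r0 r1 *; set w := r^-1 *: x.
have w1 : enorm w = 1.
  by rewrite /w enormZ ger0_norm ?invr_ge0 ?ltW// -/r mulVf ?gt_eqF.
clearbody r; clearbody w.
have ray_eq t : `|t| < 1 -> f (t *: w) = h (t *: w).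
  by move=> t1; apply: fh; rewrite /B3/= enormZ w1 mulr1.
have ray_near t : `|t| < 1 -> \forall s \near t, f (s *: w) = h (s *: w).
  move=> t1; have : \forall s \near t, `|s| < 1.
    have ct : `|s| @[s --> t] --> `|t| by exact: norm_continuous.
    by have := @cvgr_lt R R (nbhs t) _ _ _ ct 1 t1; exact.
  by apply: filterS => s; exact: ray_eq.
have ray1 t : `|t| < 1 ->
    derive1 (fun t : R => f (t *: w)) t = derive1 (fun t : R => h (t *: w)) t.
  by move=> /ray_near nE; rewrite !derive1E; exact: near_eq_derive.
have rn : `|r| < 1 by rewrite ger0_norm// ltW.
have ray2 : derive1n 2 (fun t : R => f (t *: w)) r =
    derive1n 2 (fun t : R => h (t *: w)) r.
  rewrite !(derive1nS _ 1) !derive1n1 derive1E [RHS]derive1E; apply: near_eq_derive.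
  have : \forall s \near r, `|s| < 1.
    have ct : `|s| @[s --> r] --> `|r| by exact: norm_continuous.
    by have := @cvgr_lt R R (nbhs r) _ _ _ ct 1 rn; exact.
  by apply: filterS => s; exact: ray1.
have sphere_eq : sphere_lapl (fun w' => f (r *: w')) w =
    sphere_lapl (fun w' => h (r *: w')) w; last first.
  by rewrite ray2 (ray1 r rn) sphere_eq (fh x Bx).
rewrite /sphere_lapl.
suff E : (fun y => f (r *: ((enorm y)^-1 *: y))) =
    (fun y => h (r *: ((enorm y)^-1 *: y))) by exact: (congr1 (fun F => lapl F w) E).
apply/funext => y; apply: fh.
rewrite /B3/= !enormZ normfV (ger0_norm (ltW r0)) (ger0_norm (enorm_ge0 y)).
(* At [y = 0] the convention [0^-1 = 0] sends [y] to the origin, which is in the ball as well. *)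
move: (enorm y) => n; have [->|n0] := eqVneq n 0; first by rewrite !mulr0.
by rewrite (mulVf n0) mulr1.
Qed.

(** As [psi] is real, it is the real part of its Fourier integral divided by [al]. With
    [al = a1 + i a2] and [n = |al|^2], the inverse [(a1 - i a2) / n] yields [a = a1 / n] and
    [b = a2 / n]. *)
Lemma eigen_fou (c : R) (al : R[i]) (psi : R3 -> R) : L1B psi -> al != 0 ->
  (forall x, B x -> finite_fourier c (fun y => (psi y)%:C%C) x = al * (psi x)%:C%C) ->
  exists a b, forall x, B x -> psi x = fou c a b psi x.
Proof.
move=> ipsi al0 ev; case: al al0 ev => [a1 a2] al0 ev.
pose n := a1 ^+ 2 + a2 ^+ 2.
have n0 : n != 0.
  apply: contra al0; rewrite /n paddr_eq0 ?sqr_ge0// !sqrf_eq0.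
  by move=> /andP[/eqP -> /eqP ->].
exists (a1 / n), (a2 / n) => x Bx.
have := ev x Bx; rewrite /finite_fourier /cintegral /=.
move=> /eqP; rewrite eq_complex /= !mulr0 subr0 add0r => /andP[/eqP e1 /eqP e2].
have mB := @measurable_B3 R.
have E1 : fou c 1 0 psi x = a1 * psi x.
  rewrite -e1; apply: eq_Rintegral => y _.
  by rewrite /expi /=; ring.
have E2 : fou c 0 1 psi x = a2 * psi x.
  rewrite -e2; apply: eq_Rintegral => y _.
  by rewrite /expi /=; ring.
have -> : fou c (a1 / n) (a2 / n) psi x =
    a1 / n * fou c 1 0 psi x + a2 / n * fou c 0 1 psi x.
  have i1 := fou_integrable c 1 0 x ipsi; have i2 := fou_integrable c 0 1 x ipsi.
  rewrite /fou -!RintegralZl// -RintegralD//; last 2 first.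
  - by have := integrableZl mB (a1 / n) i1; apply: eq_integrable.
  - by have := integrableZl mB (a2 / n) i2; apply: eq_integrable.
  by apply: eq_Rintegral => y _; ring.
by rewrite E1 E2; move: n0; rewrite /n => n0; field.
Qed.

Lemma ball_pde (c chi a b : R) (psi : R3 -> R) : L1B psi ->
  (forall x, B x -> psi x = fou c a b psi x) ->
  (forall x, B x -> x != 0 -> Dc c psi x = chi * psi x) ->
  forall x, B x ->
    - (\sum_(i < 3) fou2 c a b psi (basis3 R i) (basis3 R i) x)
    + fou2 c a b psi x x x + 4 * fou1 c a b psi x x
    + c ^+ 2 * dot3 x x * fou c a b psi x = chi * fou c a b psi x.
Proof.
move=> ipsi psiE pde.
have jP := fou_jet2 c a b ipsi.
have main x : B x -> x != 0 ->
    - (\sum_(i < 3) fou2 c a b psi (basis3 R i) (basis3 R i) x)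
    + fou2 c a b psi x x x + 4 * fou1 c a b psi x x
    + c ^+ 2 * dot3 x x * fou c a b psi x = chi * fou c a b psi x.
  move=> Bx x0; rewrite -(Dc_jet2 jP)// -psiE// -pde//.
  by apply: esym; exact: Dc_eq_on_ball.
move=> x Bx; have [x0|/(main _ Bx)//] := eqVneq x 0.
set P := fou c a b psi; set P1 := fou1 c a b psi; set P2 := fou2 c a b psi.
have cP : continuous P by exact: fou_continuous.
have cP1 k : continuous (P1 k) by apply: fou_continuous; exact: L1B_dot3.
have cP2 k l : continuous (P2 k l).
  by apply: fou_continuous; apply: L1B_dot3; exact: L1B_dot3.
(* The origin is reached by continuity along one axis. By linearity in the directions the factors
   [t] can be pulled out, which leaves a continuous function [D] of one variable that vanishes for
   small nonzero [t]. *)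
pose e := basis3 R 0.
have ee : dot3 e e = 1 by rewrite -/(coord3 0 e) coord3_basis3.
pose lhs x := - (\sum_(i < 3) P2 (basis3 R i) (basis3 R i) x)
  + P2 x x x + 4 * P1 x x + c ^+ 2 * dot3 x x * P x - chi * P x.
pose D (t : R) := - (\sum_(i < 3) P2 (basis3 R i) (basis3 R i) (t *: e))
  + t * t * P2 e e (t *: e) + 4 * (t * P1 e (t *: e))
  + c ^+ 2 * (t * t) * P (t *: e) - chi * P (t *: e).
have DE t : lhs (t *: e) = D t.
  rewrite /lhs /P1 /P2 (jet_lin1Z jP) (jet_lin2Zl jP) (jet_lin2Zr jP).
  by rewrite dot3Zl dot3_sym dot3Zl ee /D -/P1 -/P2; ring.
have D0 t : t != 0 -> `|t| < 1 -> D t = 0.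
  move=> t0 t1; rewrite -DE /lhs -main ?subrr//.
    by rewrite /B3/= enormZ /enorm ee sqrtr1 mulr1.
  by rewrite -enorm_gt0 enormZ /enorm ee sqrtr1 mulr1 normr_gt0.
suff : lhs (0 *: e) = 0.
  by rewrite scale0r -x0 => /eqP; rewrite subr_eq0 => /eqP.
rewrite DE.
have ct : continuous (fun t : R => t *: e) by move=> t; exact: scalel_continuous.
have cc (F : R3 -> R) : continuous F -> continuous (fun t : R => F (t *: e)).
  by move=> cF t; apply: continuous_comp; [exact: ct|exact: cF].
have cD : {for 0, continuous D}.
  have cidR : {for (0 : R), continuous (fun t : R => t)} by exact: cvg_id.
  rewrite /D; apply: cvgB; last by apply: cvgM; [exact: cvg_cst|exact: cc].
  apply: cvgD; [apply: cvgD; [apply: cvgD|]|].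
  - by apply: cvgN; under eq_fun do rewrite big_ord3; rewrite big_ord3;
      apply: cvgD; [apply: cvgD|]; exact: cc.
  - by apply: cvgM; [exact: cvgM|exact: cc].
  - by apply: cvgM; [exact: cvg_cst|apply: cvgM => //; exact: cc].
  - by apply: cvgM; [apply: cvgM; [exact: cvg_cst|exact: cvgM]|exact: cc].
have /continuous_withinNx cD' := cD.
have nD : \forall t \near 0^', 0 = D t.
  near=> t; apply/esym/D0; near: t; first exact: nbhs_dnbhs_neq.
  exact: dnbhs0_lt.
have D0' : D t @[t --> 0^'] --> (0 : R).
  exact: (cvg_trans (near_eq_cvg nD) (cvg_cst 0)).
exact: (cvg_unique _ cD' D0').
Unshelve. all: by end_near. Qed.

End prolate_pde.

(** * Square integrable functions *)

Section square_integrable.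
Local Open Scope classical_set_scope.
Context {R : realType}.
Local Notation R3 := (R * R * R)%type.
Local Notation mu := (@leb3 R).
Local Notation B := (@B3 R).
Implicit Types (f g h : R3 -> R) (u : R3 -> R[i]).

Definition L2B f := measurable_fun3 B f /\ L1B (fun x => f x ^+ 2).

Definition ip f g : R := \int[mu]_(x in B) (f x * g x).

Lemma L1B_le f g : measurable_fun3 B f -> L1B g ->
  (forall x, B x -> `|f x| <= g x) -> L1B f.
Proof.
move=> mf ig fg; apply: (le_integrable (@measurable_B3 R) _ _ ig).
  exact/measurable_EFinP.
by move=> x Bx /=; rewrite lee_fin (le_trans (fg _ Bx))// ler_norm.
Qed.

Lemma L1BD f g : L1B f -> L1B g -> L1B (fun x => f x + g x).
Proof. by move=> fi gi; exact: (integrableD (@measurable_B3 R) fi gi). Qed.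

Lemma L1BB f g : L1B f -> L1B g -> L1B (fun x => f x - g x).
Proof. by move=> fi gi; exact: (integrableB (@measurable_B3 R) fi gi). Qed.

Lemma L1BZ (a : R) f : L1B f -> L1B (fun x => a * f x).
Proof.
move=> fi; have := integrableZl (@measurable_B3 R) a fi.
by apply: eq_integrable => //; exact: measurable_B3.
Qed.

Lemma L1B_norm f : L1B f -> L1B (fun x => `|f x|).
Proof. exact: integrable_norm. Qed.

Lemma L1B_eq f g : (forall x, B x -> f x = g x) -> L1B f -> L1B g.
Proof.
move=> fg; apply: eq_integrable; first exact: measurable_B3.
by move=> x; rewrite inE => /fg /= ->.
Qed.

Lemma L1B_cst (a : R) : L1B (fun=> a).
Proof.
apply/integrableP; split; first exact: measurable_cst.
under eq_integral do rewrite abse_EFin.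
rewrite integral_cst; last exact: measurable_B3.
by rewrite lte_mul_pinfty// leb3_B3_lty.
Qed.

Lemma ipE f g (Ih : forall x, B x -> f x = g x) :
  \int[mu]_(x in B) f x = \int[mu]_(x in B) g x.
Proof. by apply: eq_Rintegral => x; rewrite inE => /Ih. Qed.

Lemma L2B_mul f g : L2B f -> L2B g -> L1B (fun x => f x * g x).
Proof.
move=> [mf if2] [mg ig2].
apply: (L1B_le (g := fun x => f x ^+ 2 + g x ^+ 2)).
- exact: measurable_funM.
- exact: L1BD.
- move=> x _; rewrite ler_norml.
  by have := sqr_ge0 (f x - g x); have := sqr_ge0 (f x + g x);
    rewrite sqrrD sqrrB; nra.
Qed.

Lemma L2B_cst (a : R) : L2B (fun=> a).
Proof. by split; [exact: measurable_cst|exact: L1B_cst]. Qed.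

Lemma L2B_L1B f : L2B f -> L1B f.
Proof.
move=> Lf; apply: L1B_eq (L2B_mul Lf (L2B_cst 1)) => x _.
by rewrite mulr1.
Qed.

Lemma L2BD f g : L2B f -> L2B g -> L2B (fun x => f x + g x).
Proof.
move=> Lf Lg; have [mf if2] := Lf; have [mg ig2] := Lg.
split; first exact: measurable_funD.
have := L1BD (L1BD if2 ig2) (L1BZ 2 (L2B_mul Lf Lg)).
by apply: L1B_eq => x _; ring.
Qed.

Lemma L2B_bounded_mul f h (M : R) : L2B f -> measurable_fun3 B h ->
  (forall x, B x -> `|h x| <= M) -> L2B (fun x => h x * f x).
Proof.
move=> [mf if2] mh hM; split; first exact: measurable_funM.
apply: (L1B_le (g := fun x => M ^+ 2 * f x ^+ 2)).
- by apply: measurable_funX; exact: measurable_funM.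
- exact: L1BZ.
- move=> x Bx; rewrite ger0_norm ?sqr_ge0// exprMn ler_wpM2r ?sqr_ge0//.
  rewrite -(real_normK (num_real (h x))) ler_pXn2r ?nnegrE ?hM//.
  exact: le_trans (hM x Bx).
Qed.

Lemma L2BZ (a : R) f : L2B f -> L2B (fun x => a * f x).
Proof.
move=> Lf; apply: (L2B_bounded_mul (M := `|a|)) => //; exact: measurable_cst.
Qed.

Lemma L2BB f g : L2B f -> L2B g -> L2B (fun x => f x - g x).
Proof.
move=> Lf Lg; have := L2BD Lf (L2BZ (-1) Lg).
by under [X in L2B X -> _]eq_fun do rewrite mulN1r.
Qed.

Lemma ipC f g : ip f g = ip g f.
Proof. by apply: ipE => x _; exact: mulrC. Qed.

Lemma ipDl f g h : L2B f -> L2B g -> L2B h ->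
  ip (fun x => f x + g x) h = ip f h + ip g h.
Proof.
move=> Lf Lg Lh; rewrite /ip -RintegralD; [|exact: measurable_B3|exact: L2B_mul..].
by apply: ipE => x _; rewrite mulrDl.
Qed.

Lemma ipZl (a : R) f h : L2B f -> L2B h ->
  ip (fun x => a * f x) h = a * ip f h.
Proof.
move=> Lf Lh; rewrite /ip -RintegralZl; [|exact: measurable_B3|exact: L2B_mul].
by apply: ipE => x _; rewrite mulrA.
Qed.

Lemma ipBl f g h : L2B f -> L2B g -> L2B h ->
  ip (fun x => f x - g x) h = ip f h - ip g h.
Proof.
move=> Lf Lg Lh; rewrite /ip -RintegralB; [|exact: measurable_B3|exact: L2B_mul..].
by apply: ipE => x _; rewrite mulrBl.
Qed.

Lemma ip_ge0 f : 0 <= ip f f.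
Proof. by apply: Rintegral_ge0 => x _; rewrite -expr2 sqr_ge0. Qed.

Lemma ip_cauchy_schwarz f g : L2B f -> L2B g ->
  ip f g ^+ 2 <= ip f f * ip g g.
Proof.
move=> Lf Lg.
have key (t : R) : 0 <= ip f f - 2 * t * ip f g + t ^+ 2 * ip g g.
  have Ltg := L2BZ t Lg.
  pose h x := t * g x.
  have := ip_ge0 (fun x => f x - h x).
  rewrite ipBl//; last exact: L2BB.
  have hf k : L2B k -> ip h k = t * ip g k by move=> Lk; exact: ipZl.
  rewrite (ipC f) (ipC h) !ipBl// (ipC f h) hf// hf// (ipC g h) hf// (ipC g f).
  by lra.
have [g0|g0] := eqVneq (ip g g) 0.
  rewrite g0 mulr0; have [->|fg0] := eqVneq (ip f g) 0; first by rewrite expr0n.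
  (* With [ip g g = 0] the quadratic in [key] is affine in [t], and this [t] gives it the value
     -1. *)
  have := key ((ip f f + 1) / (2 * ip f g)); rewrite g0.
  have -> : 2 * ((ip f f + 1) / (2 * ip f g)) * ip f g = ip f f + 1 by field.
  by move=> h; exfalso; move: h; lra.
have gp : 0 < ip g g by rewrite lt_def g0 ip_ge0.
have := key (ip f g / ip g g).
have -> : ip f f - 2 * (ip f g / ip g g) * ip f g + (ip f g / ip g g) ^+ 2 * ip g g
  = (ip f f * ip g g - ip f g ^+ 2) / ip g g by field.
by rewrite pmulr_lge0 ?invr_gt0// subr_ge0.
Qed.

Local Notation re u := (fun x => complex.Re (u x)).
Local Notation im u := (fun x => complex.Im (u x)).

Lemma sqr_normc (z : R[i]) :
  Normc.normc z ^+ 2 = complex.Re z ^+ 2 + complex.Im z ^+ 2.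
Proof. by case: z => a b /=; rewrite sqr_sqrtr ?addr_ge0 ?sqr_ge0. Qed.

Lemma L2P u : L2 u <-> L2B (re u) /\ L2B (im u).
Proof.
have mB := @measurable_B3 R.
have m2 f : measurable_fun3 B f -> measurable_fun3 B (fun x => f x ^+ 2).
  exact: measurable_funX.
have mE f : measurable_fun3 B f -> measurable_fun3 B (EFin \o f).
  by move/measurable_EFinP.
split.
- move=> [mr mi fin].
  have ilt : (\int[mu]_(x in B) ((Normc.normc (u x) ^+ 2)%:E) < +oo)%E.
    by apply: lty_poweRy fin; rewrite invr_eq0.
  have i2 : L1B (fun x => Normc.normc (u x) ^+ 2).
    apply/integrableP; split.
      apply: mE; under eq_fun do rewrite sqr_normc.
      by apply: measurable_funD; exact: m2.
    apply: le_lt_trans ilt; rewrite le_eqVlt; apply/orP; left; apply/eqP.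
    by apply: eq_integral => x _; rewrite /= ger0_norm ?sqr_ge0.
  split; split => //; apply: (L1B_le _ i2); try exact: m2;
    by move=> x _; rewrite sqr_normc ger0_norm ?sqr_ge0// ?lerDl ?lerDr sqr_ge0.
- move=> [[mr ir] [mi ii]]; split => //.
  have [_] := integrableP _ _ _ (L1BD ir ii).
  move=> h; rewrite /L2_norm.
  apply: poweR_lty.
  apply: le_lt_trans h; rewrite le_eqVlt; apply/orP; left; apply/eqP.
  apply: eq_integral => x _ /=; rewrite sqr_normc ger0_norm//.
  by rewrite addr_ge0 ?sqr_ge0.
Qed.

Definition sqL2 u : R := ip (re u) (re u) + ip (im u) (im u).

Lemma L2_normE u : L2 u -> (L2_norm u = (sqL2 u)%:E `^ (2^-1)%R)%E.
Proof.
move=> /L2P[Lr Li]; rewrite /L2_norm; congr poweR.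
rewrite /sqL2 /ip -RintegralD; [|exact: measurable_B3|exact: L2B_mul..].
rewrite /Rintegral fineK; last first.
  apply: integrable_fin_num; first exact: measurable_B3.
  by apply: L1BD; exact: L2B_mul.
by apply: eq_integral => x _; rewrite sqr_normc !expr2.
Qed.

Lemma sqL2_ge0 u : 0 <= sqL2 u.
Proof. by rewrite addr_ge0 ?ip_ge0. Qed.

Lemma L2_norm_sqE u : L2 u -> (L2_norm u `^ 2%R = (sqL2 u)%:E)%E.
Proof.
by move=> Lu; rewrite L2_normE// -poweRrM mulVf// poweRe1// lee_fin sqL2_ge0.
Qed.

End square_integrable.

(** * Cutoff functions *)

Section flat_functions.
Local Open Scope classical_set_scope.
Context {R : realType}.
Implicit Types (p : {poly R}) (t x : R).

(** Induction along Horner's scheme: one half of the exponent absorbs the polynomial, the other half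
    the additional factor [x]. *)
Lemma poly_le_expR p (d : R) : 0 < d ->
  exists2 C, 0 <= C & forall x, 0 <= x -> `|p.[x]| <= C * expR (d * x).
Proof.
elim/poly_ind: p d => [|p a IH] d d0.
  by exists 0 => // x _; rewrite horner0 normr0 mul0r.
have [C C0 pC] := IH (d / 2) ltac:(by rewrite divr_gt0).
exists (C * (2 / d) + `|a|); first by rewrite addr_ge0// mulr_ge0// divr_ge0// ltW.
move=> x x0; rewrite hornerMXaddC.
apply: le_trans (ler_normD _ _) _; rewrite mulrDl; apply: lerD; last first.
  by rewrite ler_peMr// -expR0 ler_expR mulr_ge0// ltW.
rewrite normrM (ger0_norm x0).
have -> : expR (d * x) = expR (d / 2 * x) * expR (d / 2 * x).
  by rewrite -expRD; congr expR; field.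
have xe : x <= 2 / d * expR (d / 2 * x).
  have := expR_ge1Dx (d / 2 * x) => h.
  have : 2 / d * (d / 2 * x) <= 2 / d * expR (d / 2 * x).
    by rewrite ler_pM2l ?divr_gt0//; lra.
  by have -> : 2 / d * (d / 2 * x) = x by field; rewrite gt_eqF.
have -> : C * (2 / d) * (expR (d / 2 * x) * expR (d / 2 * x)) =
  (C * expR (d / 2 * x)) * (2 / d * expR (d / 2 * x)) by ring.
by rewrite ler_pM// pC.
Qed.

(* A family of smooth functions closed under differentiation, and under
   multiplication by negative powers of [t]. *)
Definition flat p t : R := if 0 < t then p.[t^-1] * expR (- t^-1) else 0.

Lemma flat_bounded p : exists2 C, 0 <= C & forall t, `|flat p t| <= C.
Proof.
have [C C0 pC] := poly_le_expR p (@ltr01 R); exists C => // t.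
rewrite /flat; case: ifPn => [t0|_]; last by rewrite normr0.
rewrite normrM (ger0_norm (expR_ge0 _)) expRN ler_pdivrMr ?expR_gt0//.
by have := pC t^-1; rewrite mul1r; apply; rewrite invr_ge0 ltW.
Qed.

Lemma flat_mulX p t : t != 0 -> flat ('X * p) t = flat p t / t.
Proof.
move=> t0; rewrite /flat; case: ifPn => _; last by rewrite mul0r.
by rewrite hornerM hornerX; ring.
Qed.

(** In the variable [X = 1/t], the derivative in [t] is [- X^2 d/dX]; here it is applied to
    [p(X) exp (- X)]. *)
Definition dflat p := 'X^2 * (p - p^`()).

Lemma is_derive_flat p t : is_derive t 1 (flat p) (flat (dflat p) t).
Proof.
have [t0|t0|->] := ltrgt0P t.
- have nearE : \forall y \near t, p.[y^-1] * expR (- y^-1) = flat p y.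
    have : \forall y \near t, 0 < y by exact: lt_nbhsr.
    by apply: filterS => y y0; rewrite /flat y0.
  apply: near_eq_is_derive nearE _.
  have dV : is_derive t 1 (fun t => t^-1) (- t ^- 2 *: 1).
    by apply: is_deriveV; rewrite ?gt_eqF//; exact: is_derive_id.
  have dp := is_derive_comp1 dV (is_derive_poly p t^-1).
  have de := is_derive_comp1 (is_deriveN dV) (is_derive_expR (- t^-1)).
  apply: is_derive_eq (is_deriveM dp de) _.
  rewrite /flat t0 /dflat hornerM hornerXn hornerD hornerN /GRing.scale/= exprVn; ring.
- have nearE : \forall y \near t, 0 = flat p y.
    have : \forall y \near t, y < 0 by exact: lt_nbhsl.
    by apply: filterS => y y0; rewrite /flat ltNge (ltW y0).
  apply: near_eq_is_derive nearE _.
  apply: is_derive_eq (is_derive_cst 0 t 1) _.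
  by rewrite /flat ltNge (ltW t0).
(* At 0: the boundedness of the flat function of [X^2 p] says that [flat p] is [O(t^2)], so its
   derivative there is 0. *)
have [C C0 FC] := flat_bounded ('X * ('X * p)).
have flat0 q : flat q 0 = 0 by rewrite /flat ltxx.
have fC (k : R) : `|flat p k| <= C * `|k| ^+ 2.
  have [->|k0] := eqVneq k 0; first by rewrite flat0 !normr0 expr0n mulr0.
  have := FC k; rewrite !flat_mulX// !normrM normfV -mulrA -invfM -expr2.
  by rewrite ler_pdivrMr// exprn_gt0// normr_gt0.
rewrite flat0; have df : is_diff (0 : R) (flat p) (fun=> 0 : R).
  apply: (@quadratic_is_diff R R R _ _ _ C 0).
  - by move=> a k l; rewrite scaler0 addr0.
  - by move=> k; rewrite normr0 mul0r.
  - by move=> k; rewrite add0r flat0 !subr0.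
exact: (is_diff_is_derive1 (1 : R) df).
Qed.

Lemma flat_continuous p : continuous (flat p).
Proof.
move=> t; apply: differentiable_continuous; apply/derivable1_diffP.
by case: (is_derive_flat p t).
Qed.

(** For [p = 1] this gives the limit 1 of the cutoffs, for [p = X + X^2] the limit 0 of the term
    produced by their gradients. *)
Lemma flat_cvg p : flat p t @[t --> +oo%R] --> p.[0].
Proof.
have -> : p.[0] = p.[0] * expR (- 0) by rewrite oppr0 expR0 mulr1.
have nearE : \forall t \near +oo%R, p.[t^-1] * expR (- t^-1) = flat p t.
  have : \forall t \near +oo%R, 0 < (t : R) by apply: (@nbhs_pinfty_gt R 0); rewrite num_real.
  by apply: filterS => y y0; rewrite /flat y0.
apply: cvg_trans (near_eq_cvg nearE) _.
have V0 : (fun t => t^-1) t @[t --> +oo%R] --> (0 : R).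
  apply/(@gtr0_cvgV0 R _ _ _ id); last exact: cvg_id.
  by apply: (@nbhs_pinfty_gt R 0); rewrite num_real.
apply: cvgM.
  apply: (cvg_comp _ _ V0); exact: continuous_horner.
by apply: (cvg_comp _ _ (cvgN V0)); exact: continuous_expR.
Qed.

End flat_functions.

Section smooth_functions.
Local Open Scope classical_set_scope.
Context {R : realType}.
Local Notation R3 := (R * R * R)%type.
Implicit Types (f g h : R3 -> R) (i : 'I_3).

(** [smooth] speaks of all iterated derivatives at once. Counting their order permits induction for
    products and compositions, whose first derivatives are sums of products of functions of lower
    order. *)
Fixpoint Cn (n : nat) f : Prop :=
  continuous f /\ if n is m.+1 then
    forall i, (forall x, derivable f x (basis3 R i)) /\ Cn m (partial i f)
  else True.

Lemma Cn_continuous n f : Cn n f -> continuous f.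
Proof. by case: n => [|n] []. Qed.

Lemma CnW n f : Cn n.+1 f -> Cn n f.
Proof.
elim: n f => [|n IH] f [cf df]; first by split.
by split => // i; have [? ?] := df i; split => //; exact: IH.
Qed.

Lemma smooth_Cn f n : smooth f -> Cn n f.
Proof.
elim: n f => [|n IH] f sf; first by split => //; case: (sf [::]).
split; first by case: (sf [::]).
move=> i; split; first by move=> x; have [_] := sf [::]; exact.
(* [foldr] applies the last index first, so an inner derivative corresponds to [rcons]. *)
by apply: IH => l; have := sf (rcons l i); rewrite foldr_rcons.
Qed.

Lemma Cn_smooth f : (forall n, Cn n f) -> smooth f.
Proof.
move=> Cf l; elim/last_ind: l f Cf => [|l i IH] f Cf.
  by split; [exact: Cn_continuous (Cf 0%N)|move=> i; have [_ /(_ i)[]] := Cf 1%N].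
rewrite foldr_rcons; apply: IH => n.
by have [_ /(_ i)[]] := Cf n.+1.
Qed.

Lemma partialE i f x df : is_derive x (basis3 R i) f df -> partial i f x = df.
Proof. by case. Qed.

Lemma Cn_step n f (df : 'I_3 -> R3 -> R) : continuous f ->
  (forall i x, is_derive x (basis3 R i) f (df i x)) ->
  (forall i, Cn n (df i)) -> Cn n.+1 f.
Proof.
move=> cf dfP Cdf; split => // i; split; first by move=> x; case: (dfP i x).
rewrite (_ : partial i f = df i)//.
by apply/funext => x; exact: partialE.
Qed.

Lemma Cn_is_derive n f i x : Cn n.+1 f ->
  is_derive x (basis3 R i) f (partial i f x).
Proof. by move=> [_ /(_ i)[/(_ x) d _]]; exact: DeriveDef. Qed.

Lemma CnD n f g : Cn n f -> Cn n g -> Cn n (f + g).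
Proof.
elim: n f g => [|n IH] f g Cf Cg.
  split => //; have [cf _] := Cf; have [cg _] := Cg.
  by move=> x; apply: cvgD; [exact: cf|exact: cg].
apply: (Cn_step (df := fun i => partial i f + partial i g)).
- have [cf _] := Cf; have [cg _] := Cg.
  by move=> x; apply: cvgD; [exact: cf|exact: cg].
- by move=> i x; exact: is_deriveD (Cn_is_derive i x Cf) (Cn_is_derive i x Cg).
- by move=> i; have [_ /(_ i)[_ ?]] := Cf; have [_ /(_ i)[_ ?]] := Cg; exact: IH.
Qed.

Lemma CnM n f g : Cn n f -> Cn n g -> Cn n (f * g).
Proof.
elim: n f g => [|n IH] f g Cf Cg.
  split => //; have [cf _] := Cf; have [cg _] := Cg.
  by move=> x; apply: cvgM; [exact: cf|exact: cg].
apply: (Cn_step (df := fun i => f * partial i g + g * partial i f)).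
- have [cf _] := Cf; have [cg _] := Cg.
  by move=> x; apply: cvgM; [exact: cf|exact: cg].
- by move=> i x; exact: is_deriveM (Cn_is_derive i x Cf) (Cn_is_derive i x Cg).
- move=> i; have [_ /(_ i)[_ ?]] := Cf; have [_ /(_ i)[_ ?]] := Cg.
  by apply: CnD; apply: IH => //; exact: CnW.
Qed.

Lemma smoothD f g : smooth f -> smooth g -> smooth (f + g).
Proof. by move=> sf sg; apply: Cn_smooth => n; apply: CnD; exact: smooth_Cn. Qed.

Lemma smoothM f g : smooth f -> smooth g -> smooth (f * g).
Proof. by move=> sf sg; apply: Cn_smooth => n; apply: CnM; exact: smooth_Cn. Qed.

Lemma smooth_cst (a : R) : smooth (cst a : R3 -> R).
Proof.
apply: Cn_smooth => n; elim: n a => [|n IH] a.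
  by split => // x; exact: cvg_cst.
apply: (Cn_step (df := fun=> cst 0)) => //.
by move=> x; exact: cvg_cst.
Qed.

Lemma smooth_coord3 i : smooth (coord3 i : R3 -> R).
Proof.
have cc : continuous (coord3 i : R3 -> R) by exact: continuous_dot3r.
apply: Cn_smooth => -[|n]; first by split.
apply: (Cn_step (df := fun j => cst (coord3 i (basis3 R j)))) => //.
- by move=> j x; exact: is_derive_coord3.
- by move=> j; apply: smooth_Cn; exact: smooth_cst.
Qed.

Lemma smoothN f : smooth f -> smooth (- f).
Proof.
move=> sf; rewrite (_ : - f = cst (-1) * f); first exact: smoothM (smooth_cst _) sf.
by apply/funext => x; rewrite !fctE mulN1r.
Qed.

Lemma smooth_sum (I : Type) (s : seq I) (F : I -> R3 -> R) :
  (forall j, smooth (F j)) -> smooth (\sum_(j <- s) F j).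
Proof.
by move=> sF; elim/big_ind: _; [exact: smooth_cst|exact: smoothD|move=> j _; exact: sF].
Qed.

Lemma smooth_continuous f : smooth f -> continuous f.
Proof. by move=> sf; have [] := sf [::]. Qed.

Lemma smooth_flat (p : {poly R}) f : smooth f -> smooth (flat p \o f).
Proof.
move=> sf; apply: Cn_smooth => n; elim: n p => [|n IH] p.
  split => // x; apply: continuous_comp; last exact: flat_continuous.
  exact: smooth_continuous.
apply: (Cn_step (df := fun i => partial i f * (flat (dflat p) \o f))).
- move=> x; apply: continuous_comp; last exact: flat_continuous.
  exact: smooth_continuous.
- move=> i x; apply: (is_derive_comp1 (dg := flat (dflat p) (f x))).
    exact: (Cn_is_derive i x (smooth_Cn 1 sf)).
  exact: is_derive_flat.
- move=> i; apply: CnM => //.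
  by have [_ /(_ i)[]] := smooth_Cn n.+1 sf.
Qed.

Lemma smooth_partial f i : smooth f -> smooth (partial i f).
Proof.
by move=> sf; apply: Cn_smooth => n; have [_ /(_ i)[]] := smooth_Cn n.+1 sf.
Qed.

Lemma smooth_is_derive f i x : smooth f ->
  is_derive x (basis3 R i) f (partial i f x).
Proof. by move=> sf; exact: Cn_is_derive (smooth_Cn 1 sf). Qed.

(* This tends to infinity in the ball and is negative outside of the ball of
   squared radius [1 - 1 / n], so that composing a flat function with it gives
   cutoffs that exhaust the ball. *)
Definition ballarg (n : nat) (x : R3) : R := n%:R * (1 - dot3 x x) - 1.

Lemma smooth_dot3xx : smooth (fun x : R3 => dot3 x x).
Proof.
have -> : (fun x : R3 => dot3 x x) = \sum_(i < 3) coord3 i * coord3 i.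
  by apply/funext => x; rewrite fct_sumE dot3_coord3.
by apply: smooth_sum => i; apply: smoothM; exact: smooth_coord3.
Qed.

Lemma ballargE n : ballarg n =
  cst n%:R * (cst 1 - (fun x : R3 => dot3 x x)) - cst 1.
Proof. by apply/funext => x. Qed.

Lemma smooth_ballarg n : smooth (ballarg n).
Proof.
rewrite ballargE; apply: smoothD; last exact/smoothN/smooth_cst.
apply: smoothM; first exact: smooth_cst.
by apply: smoothD; [exact: smooth_cst|exact/smoothN/smooth_dot3xx].
Qed.

Lemma partial_ballarg n i x : partial i (ballarg n) x = - 2 * n%:R * coord3 i x.
Proof.
apply: partialE; rewrite ballargE.
have d1 := is_deriveB (is_derive_cst (1 : R) x (basis3 R i))
  (is_derive_dot3xx x (basis3 R i)).
have d2 := is_deriveM (is_derive_cst (n%:R : R) x (basis3 R i)) d1.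
have d3 := is_deriveB d2 (is_derive_cst (1 : R) x (basis3 R i)).
apply: is_derive_eq d3 _.
by rewrite dot3_sym -/(coord3 i x) /GRing.scale/= !fctE; ring.
Qed.

Definition cutoff n : R3 -> R := flat 1 \o ballarg n.

(** Where the cutoff is nonzero, [ballarg n x > 0] forces [|x|^2 < 1 - 1/n], at a positive distance
    from the sphere. For [n = 0] the convention [0^-1 = 0] makes [K] the closed ball, and the
    inclusion in [B3] holds instead because the cutoff vanishes identically. *)
Lemma cutoff_test_function n f : smooth f -> test_function (cutoff n * f).
Proof.
move=> sf; pose K : set R3 := (fun x => dot3 x x) @^-1` `]-oo, 1 - n%:R^-1].
have cK : closed K.
  move: (@continuous_dot3xx R) => /continuous_closedP; apply.
  exact: interval_closed.
have sK : closure [set x | (cutoff n * f) x != 0] `<=` K.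
  apply: (@subset_trans _ (closure K)); last by rewrite -((closure_id K).1 cK).
  apply: closure_subset => x /=.
  rewrite /K/= in_itv/= !fctE mulf_eq0 negb_or => /andP[+ _].
  rewrite /cutoff /flat /= /ballarg; case: ifPn; last by rewrite eqxx.
  have [->|n0] := posnP n; first by rewrite mul0r; lra.
  have nR : 0 < n%:R :> R by rewrite ltr0n.
  move=> h _.
  have : n%:R^-1 * 1 <= n%:R^-1 * (n%:R * (1 - dot3 x x)).
    by rewrite ler_pM2l ?invr_gt0//; lra.
  by rewrite mulr1 mulKf ?gt_eqF//; lra.
have sB : closure [set x | (cutoff n * f) x != 0] `<=` @B3 R.
  have [n0|n0] := posnP n.
    have -> : [set x | (cutoff n * f) x != 0] = set0.
      apply/seteqP; split => // y; rewrite n0 /cutoff /flat /ballarg /= !fctE /=.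
      by rewrite mul0r; case: ifPn => [|_]; [lra|rewrite mul0r eqxx].
    by rewrite closure0.
  move=> x /sK; rewrite /K/= in_itv/= => h; apply/B3E; apply: le_lt_trans h _.
  by rewrite ltrBlDr ltrDl invr_gt0 ltr0n.
split => //.
  apply: smoothM => //; apply: smooth_flat; exact: smooth_ballarg.
apply: (subclosed_compact _ (@compact_box R)); first exact: closed_closure.
exact: subset_trans sB (@B3_sub_box R).
Qed.

End smooth_functions.

Section bounded_support.
Local Open Scope classical_set_scope.

Lemma integrable_bounded_support d (T : measurableType d) (R : realType)
    (mu : {measure set T -> \bar R}) (A : set T) (f : T -> R) (M : R) :
  measurable A -> (mu A < +oo)%E -> measurable_fun setT f ->
  (forall x, `|f x| <= M) -> (forall x, ~ A x -> f x = 0) ->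
  mu.-integrable setT (EFin \o f).
Proof.
move=> mA Afin mf fM fA.
have iA : mu.-integrable A (EFin \o f).
  apply: (le_integrable mA _ (g := EFin \o cst M)).
  - by apply/measurable_EFinP; exact: measurable_funTS.
  - by move=> x _ /=; rewrite lee_fin (le_trans (fM x))// ler_norm.
  - apply/integrableP; split.
      by apply/measurable_EFinP; exact: measurable_cst.
    by rewrite (eq_integral (cst (`|M|%:E)))// integral_cst// lte_mul_pinfty.
have := (integrable_mkcond _ mA).1 iA.
apply: eq_integrable => // x _; rewrite patchE; case: ifPn => //.
by rewrite notin_setE => /fA/= ->.
Qed.

End bounded_support.

(* The sigma-finite instance of the library for product measures is shadowed by
   the one for products of subprobabilities. *)
Section leb2.
Local Open Scope classical_set_scope.
Context {R : realType}.
Local Notation lam := (@lebesgue_measure R).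

Definition leb2 : set (measurableTypeR R * measurableTypeR R) -> \bar R :=
  (lam \x lam)%E.

HB.instance Definition _ := Measure.on leb2.

Lemma leb2E (A B : set (measurableTypeR R)) : measurable A -> measurable B ->
  leb2 (A `*` B) = (lam A * lam B)%E.
Proof. exact: (@product_measure1E _ _ _ _ R lam lam A B). Qed.

Let sigma_finite_leb2 : sigma_finite setT leb2.
Proof.
have /sigma_finiteP[F [TF ndF Foo]] := sigma_finiteT lam.
exists (fun n => F n `*` F n).
  rewrite -setXTT TF predeqE => -[x y]; split.
    move=> [/= [n _ Fnx] [k _ Gky]]; exists (maxn n k) => //; split.
    - by move: x Fnx; exact/subsetPset/ndF/leq_maxl.
    - by move: y Gky; exact/subsetPset/ndF/leq_maxr.
  by move=> [n _ []/= ? ?]; split; exists n.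
move=> k; have [mF Fk] := Foo k.
split; first exact: measurableX.
by rewrite leb2E// lte_mul_pinfty// ge0_fin_numE.
Qed.

HB.instance Definition _ :=
  Measure_isSigmaFinite.Build _ _ _ leb2 sigma_finite_leb2.

End leb2.

(** * Derivatives of test functions have integral zero *)

Section integration_by_parts.
Local Open Scope classical_set_scope.
Context {R : realType}.
Local Notation R3 := (R * R * R)%type.
Local Notation lam := (@lebesgue_measure R).
Local Notation mu := (@leb3 R).

Lemma integral_derive_compact_support (k dk : R -> R) : continuous dk ->
  (forall t : R, is_derive t (1 : R) k (dk t)) -> (forall t, 1 <= `|t| -> k t = 0) ->
  (\int[lam]_t (dk t)%:E = 0)%E.
Proof.
move=> cdk dkP k0.
have dk0 t : 1 < `|t| -> dk t = 0.
  move=> t1; have nearE : \forall y \near t, k y = 0.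
    have : \forall y \near t, 1 < `|y|.
      have ct : `|y| @[y --> t] --> `|t| by exact: norm_continuous.
      by have := @cvgr_gt R R (nbhs t) _ _ _ ct 1 t1; exact.
    by apply: filterS => y /ltW /k0.
  have [_ <-] := dkP t; rewrite (near_eq_derive _ nearE).
  exact: derive_cst.
(* The interval exceeds [[-1, 1]], so that its complement lies in [|t| > 1], where [k] vanishes near
   [t] and therefore [dk t = 0]. *)
have -> : (\int[lam]_t (dk t)%:E = \int[lam]_(t in `[(-2)%R, 2%R]) (dk t)%:E)%E.
  rewrite [RHS]integral_mkcond; apply: eq_integral => t _.
  rewrite patchE; case: ifPn => //; rewrite notin_setE/= in_itv/= => h.
  rewrite dk0// ltr_normr; apply: contrapT => /negP; rewrite negb_or -!leNgt => g.
  by apply: h; lra.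
have k2 : k 2 = 0 by apply: k0; rewrite ger0_norm//; lra.
have kN2 : k (-2) = 0 by apply: k0; rewrite normrN ger0_norm//; lra.
have ck : continuous k.
  by move=> t; apply: differentiable_continuous; apply/derivable1_diffP;
    case: (dkP t).
rewrite (@continuous_FTC2 _ _ k) ?k2 ?kN2 ?sube0//.
- lra.
- exact: continuous_subspaceT.
- split; first by move=> t _; case: (dkP t).
  + exact/cvg_at_right_filter/ck.
  + exact/cvg_at_left_filter/ck.
- by move=> t _; rewrite derive1E; case: (dkP t).
Qed.

Lemma is_derive_line (h : R3 -> R) i (g : R -> R3) t : smooth h ->
  (forall s t, g (s + t) = s *: basis3 R i + g t) ->
  is_derive t (1 : R) (h \o g) (partial i h (g t)).
Proof.
move=> sh gE; have /is_derive_sliceP := smooth_is_derive i (g t) sh.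
move=> dh; apply/is_derive_sliceP.
rewrite (_ : (fun s : R => _) = (fun s : R => h (s *: basis3 R i + g t)))//.
by apply/funext => s /=; rewrite [s *: 1]mulr1 gE.
Qed.

Variable h : R3 -> R.
Hypothesis th : test_function h.

Let supp x : ~ @B3 R x -> h x = 0.
Proof.
move=> nB; apply: contrapT => /eqP h0; apply: nB.
by have [_ _] := th; apply; exact: subset_closure.
Qed.

Let near_supp x : ~ @B3 R x -> \forall y \near x, h y = 0.
Proof.
move=> nB; have [_ _ sB] := th.
have : ~ closure [set x | h x != 0] x by move/sB.
rewrite -[~ _]/((~` closure _) x) => nc.
have oc : open (~` closure [set x | h x != 0]).
  exact/closed_openC/closed_closure.
have := open_nbhs_nbhs (conj oc nc); apply: filterS => y ny.
by apply: contrapT => /eqP h0; apply: ny; exact: subset_closure.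
Qed.

Variable i : 'I_3.

Let f := partial i h.

Let f_cont : continuous f.
Proof. by have [sh _ _] := th; exact: smooth_continuous (smooth_partial i sh). Qed.

Let f_supp x : ~ @B3 R x -> f x = 0.
Proof.
move=> /near_supp nE; rewrite /f /partial (near_eq_derive _ nE).
exact: derive_cst.
Qed.

Let f_bounded : exists M, forall x, `|f x| <= M.
Proof.
have [M fM] := continuous_bounded_B3 f_cont; exists `|M| => x.
have [Bx|/f_supp ->] := pselect (B3 x); last by rewrite normr0.
exact: le_trans (fM _ Bx) (ler_norm _).
Qed.

(** Fubini with the variable of differentiation innermost: each integral along a line is that of the
    derivative of a function supported in [[-1, 1]]. *)
Lemma integral_partial_test_function : \int[mu]_(x in @B3 R) f x = 0.
Proof.
pose lamS : {sigma_finite_measure set (measurableTypeR R) -> \bar R} := lam.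
have [sh _ _] := th; have [M fM] := f_bounded.
pose I : set (measurableTypeR R) := `[(-1), 1].
have mI : measurable I by exact: measurable_itv.
have lamI : (lam I < +oo)%E.
  by rewrite /I lebesgue_measure_itv/=; case: ifP => // _; rewrite -EFinB ltry.
have mII := measurableX mI mI.
have lamII : (@leb2 R (I `*` I) < +oo)%E.
  by rewrite leb2E// lte_mul_pinfty// ge0_fin_numE.
have mIII := measurableX mII mI.
have muIII : (mu ((I `*` I) `*` I) < +oo)%E.
  rewrite leb3_box// lte_mul_pinfty ?mule_ge0//.
    by rewrite fin_numM// ge0_fin_numE.
have inI (t : R) : ~ I t -> 1 < `|t|.
  rewrite /I/= in_itv/= => nt; rewrite ltr_normr.
  by apply: contrapT => /negP; rewrite negb_or -!leNgt => g; apply: nt; lra.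
have out (x : R3) (j : 'I_3) : 1 <= `|coord3 j x| -> ~ @B3 R x.
  move=> hj /B3E; rewrite dot3_coord3 big_ord3 -!expr2.
  have := (sqr_ge0 (coord3 0 x), sqr_ge0 (coord3 1 x), sqr_ge0 (coord3 2%R x)).
  move=> [[s0 s1] s2].
  have : 1 <= coord3 j x ^+ 2.
    by rewrite -(real_normK (num_real (coord3 j x))) -[leLHS](expr1n _ 2) ler_pXn2r ?nnegrE.
  case: j {hj} => [[|[|[|//]]] j3].
  - by rewrite (_ : Ordinal j3 = 0); [lra|exact: val_inj].
  - by rewrite (_ : Ordinal j3 = 1); [lra|exact: val_inj].
  - by rewrite (_ : Ordinal j3 = 2%R); [lra|exact: val_inj].
have outf x j : 1 < `|coord3 j x| -> f x = 0.
  by move=> /ltW/out/f_supp.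
have mf : measurable_fun3 setT f.
  by apply: continuous_measurable_fun3 => //; exact: measurableT.
have f_int : mu.-integrable setT (EFin \o f).
  apply: (integrable_bounded_support mIII muIII mf fM) => -[[a b] e] nI.
  apply: f_supp => /B3_coord[]; rewrite !ler_norml => h1 h2 h3; apply: nI.
  by split; [split|]; rewrite /I/= in_itv/=.
have -> : \int[mu]_(x in @B3 R) f x = \int[mu]_x f x.
  rewrite Rintegral_mkcond; apply: eq_Rintegral => x _.
  by rewrite patchE; case: ifPn => //; rewrite notin_setE => /f_supp.
rewrite /Rintegral.
suff -> : (\int[mu]_x (f x)%:E = 0)%E by [].
have line (g : R -> R3) : continuous g ->
    (forall s t, g (s + t) = s *: basis3 R i + g t) ->
    (forall t, coord3 i (g t) = t) -> (\int[lam]_t (f (g t))%:E = 0)%E.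
  move=> cg gE gt; apply: (@integral_derive_compact_support (h \o g)).
  - by move=> t; apply: continuous_comp; [exact: cg|exact: f_cont].
  - by move=> t; exact: is_derive_line.
  - by move=> t t1; apply: supp; apply: (out _ i); rewrite gt.
pose lam2 : {sigma_finite_measure set
  (measurableTypeR R * measurableTypeR R)%type -> \bar R} := @leb2 R.
have F2 := @integral12_prod_meas1 _ _ _ _ R lam2 lamS _ f_int.
have F1 := @integral21_prod_meas1 _ _ _ _ R lam2 lamS _ f_int.
have cpair (V W : topologicalType) (k : R -> V) (l : R -> W) :
    continuous k -> continuous l -> continuous (fun t => (k t, l t)).
  by move=> ck cl t; exact: (cvg_pair (ck t) (cl t)).
have cidR : continuous (fun t : R => t) by move=> t; exact: cvg_id.
have ccst (V : topologicalType) (v : V) : continuous (fun _ : R => v).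
  by move=> t; exact: cvg_cst.
have g_int (e : R) : (@leb2 R).-integrable setT (EFin \o (fun p => f (p, e))).
  apply: (integrable_bounded_support mII lamII (M := M)) => //.
  - exact: (@measurable_fun_pair1 _ _ _ _ (measurableTypeR R) _ f e mf).
  - move=> [a b] nI; apply: f_supp => /B3_coord[]; rewrite !ler_norml => h1 h2 h3.
    by apply: nI; split; rewrite /I/= in_itv/=.
(* The measure is [leb2] times a third factor: one use of Fubini isolates direction 2, while
   directions 0 and 1 need a second one inside [leb2]. *)
have [i0|[i1|i2]] : i = 0 \/ i = 1 \/ i = 2%R.
  case: i => [[|[|[|//]]] ?]; [left|right; left|right; right]; exact: val_inj.
- rewrite -F1; apply: integral0_eq => e _ /=; rewrite /fubini_G.
  rewrite -(@integral21_prod_meas1 _ _ _ _ R lamS lamS _ (g_int e)).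
  apply: integral0_eq => b _; rewrite /fubini_G/=.
  apply: (line (fun t => (t, b, e))) => [|s t|t]; rewrite ?i0 ?coord3E//.
    exact: cpair (cpair _ _ _ _ cidR (ccst _ b)) (ccst _ e).
  by rewrite /basis3/=; congr (_, _, _); rewrite /= /GRing.scale/= ?mulr1 ?mulr0 ?add0r.
- rewrite -F1; apply: integral0_eq => e _ /=; rewrite /fubini_G.
  rewrite -(@integral12_prod_meas1 _ _ _ _ R lamS lamS _ (g_int e)).
  apply: integral0_eq => a _; rewrite /fubini_F/=.
  apply: (line (fun t => (a, t, e))) => [|s t|t]; rewrite ?i1 ?coord3E//.
    exact: cpair (cpair _ _ _ _ (ccst _ a) cidR) (ccst _ e).
  by rewrite /basis3/=; congr (_, _, _); rewrite /= /GRing.scale/= ?mulr1 ?mulr0 ?add0r.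
- rewrite -F2; apply: integral0_eq => p _ /=; rewrite /fubini_F.
  apply: (line (fun t => (p, t))) => [|s t|t]; rewrite ?i2 ?coord3E//.
    exact: cpair (ccst _ p) cidR.
  case: p => a b; rewrite /basis3/=.
  by congr (_, _, _); rewrite /= /GRing.scale/= ?mulr1 ?mulr0 ?add0r.
Qed.

End integration_by_parts.

(** * Green's formula *)

Section green_identity.
Local Open Scope classical_set_scope.
Context {R : realType}.
Local Notation R3 := (R * R * R)%type.
Local Notation mu := (@leb3 R).
Local Notation B := (@B3 R).
Implicit Types (f h v : R3 -> R) (g : 'I_3 -> R3 -> R).

Lemma continuous_L2B f : continuous f -> L2B f.
Proof.
move=> cf; have [M fM] := continuous_bounded_B3 cf.
have := L2B_bounded_mul (L2B_cst 1)
  (continuous_measurable_fun3 (@measurable_B3 R) cf) fM.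
by under [X in L2B X -> _]eq_fun do rewrite mulr1.
Qed.

Lemma continuous_mul_L2B f h : continuous f -> L2B h -> L2B (fun x => f x * h x).
Proof.
move=> cf Lh; have [M fM] := continuous_bounded_B3 cf.
exact: L2B_bounded_mul Lh
  (continuous_measurable_fun3 (@measurable_B3 R) cf) fM.
Qed.

Definition real_weak_gradient v g := (forall i, L2B (g i)) /\
  forall i phi, test_function phi ->
    \int[mu]_(x in B) (v x * partial i phi x) =
    - \int[mu]_(x in B) (g i x * phi x).

Lemma test_functionM phi f : test_function phi -> smooth f ->
  test_function (f * phi).
Proof.
move=> [sphi cphi Bphi] sf.
have sub : closure [set x | (f * phi) x != 0] `<=` closure [set x | phi x != 0].
  by apply: closure_subset => x /=; rewrite !fctE mulf_eq0 negb_or => /andP[].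
split; first exact: smoothM.
- by apply: (subclosed_compact _ cphi sub); exact: closed_closure.
- exact: subset_trans sub Bphi.
Qed.

(** The product of [f] and a test function is again a test function. The lemma allows
    [bessel_energy] to subtract multiples of the extended eigenfunctions from [v]. *)
Lemma smooth_weak_gradient f : smooth f ->
  real_weak_gradient f (fun i => partial i f).
Proof.
move=> sf; have mB := @measurable_B3 R.
have Lp h : smooth h -> L2B h.
  by move=> sh; apply: continuous_L2B; exact: smooth_continuous.
split; first by move=> i; apply: Lp; exact: smooth_partial.
move=> i phi tphi; have [sphi _ _] := tphi.
apply/eqP; rewrite -addr_eq0 -RintegralD//; last 2 first.
- exact: (L2B_mul (Lp _ sf) (Lp _ (smooth_partial i sphi))).
- exact: (L2B_mul (Lp _ (smooth_partial i sf)) (Lp _ sphi)).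
apply/eqP; rewrite -[RHS](integral_partial_test_function (test_functionM tphi sf) i).
apply: eq_Rintegral => x _; apply: esym; apply: partialE.
apply: is_derive_eq
  (is_deriveM (smooth_is_derive i x sf) (smooth_is_derive i x sphi)) _.
by rewrite /GRing.scale/= [X in _ + X]mulrC.
Qed.

Lemma Rintegral_limit0 (F_ : nat -> R3 -> R) (F dom : R3 -> R) :
  (forall n, measurable_fun3 B (F_ n)) -> measurable_fun3 B F -> L1B dom ->
  (forall n x, B x -> `|F_ n x| <= dom x) ->
  (forall x, B x -> F_ n x @[n --> \oo] --> F x) ->
  (forall n, \int[mu]_(x in B) F_ n x = 0) -> \int[mu]_(x in B) F x = 0.
Proof.
move=> mF_ mF idom Fdom FF F0; have mB := @measurable_B3 R.
have iF_ n : L1B (F_ n) by apply: L1B_le idom _ => // x; exact: Fdom.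
have [|||||] := @dominated_convergence _ _ _ mu B mB (fun n => EFin \o F_ n)
  (EFin \o F) (EFin \o dom).
- by move=> n; apply/measurable_EFinP.
- exact/measurable_EFinP.
- by apply: aeW => x Bx; apply/cvg_EFin; [exact: nearW|exact: FF].
- exact: idom.
- by apply: aeW => x n Bx /=; rewrite lee_fin Fdom.
move=> _ _ lim; rewrite /Rintegral.
suff -> : (\int[mu]_(x in B) (F x)%:E = 0)%E by [].
have F0' n : (\int[mu]_(x in B) (F_ n x)%:E = 0)%E.
  have fin := integrable_fin_num mB (iF_ n).
  by rewrite -(fineK fin); congr EFin; exact: F0.
apply/esym; apply: cvg_unique lim => //.
have -> : [sequence \int[mu]_(x in B) (EFin \o F_ n) x]_n%E = cst 0%E.
  by apply/funext => n; exact: F0'.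
exact: cvg_cst.
Qed.

(** The density of the form [a(v, w)]. The gradients are separate arguments because weak gradients
    are determined only up to null sets. *)
Definition energy v g (w : R3 -> R) (k : 'I_3 -> R3 -> R) (c : R) (x : R3) : R :=
  \sum_(i < 3) g i x * k i x
  - (\sum_(i < 3) coord3 i x * g i x) * (\sum_(i < 3) coord3 i x * k i x)
  + c ^+ 2 * dot3 x x * (v x * w x).

Lemma cvgn_ballarg (x : R3) : B x -> ballarg n x @[n --> \oo] --> +oo%R.
Proof.
move=> /B3E x1; have p0 : 0 < 1 - dot3 x x by lra.
apply/cvgryPge => A; near=> n; rewrite /ballarg lerBrDr -ler_pdivrMr//.
by near: n; exact: nbhs_infty_ger.
Unshelve. all: by end_near. Qed.

(** At [t = ballarg n x] the factor [t + 1] is [n (1 - |x|^2)]. With [X = 1/t] one has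
    [(1/X + 1) X^2 = X + X^2], so the product is a flat function that does not depend on [n]. *)
Lemma flat_succ_mul (t : R) : (t + 1) * flat 'X^2 t = flat ('X + 'X^2) t.
Proof.
rewrite /flat; case: ifPn => t0; last by rewrite mulr0.
rewrite hornerD hornerX !hornerXn; field; rewrite ?gt_eqF//.
Qed.

Lemma is_derive_cutoff n i x : is_derive x (basis3 R i) (cutoff n)
  (- 2 * n%:R * coord3 i x * flat 'X^2 (ballarg n x)).
Proof.
have := is_derive_comp1 (smooth_is_derive i x (smooth_ballarg n))
  (is_derive_flat 1 (ballarg n x)).
by rewrite partial_ballarg /dflat -[1]/(1%:P) derivC subr0 mulr1.
Qed.

Section divergence.
Variables (c chi a b : R) (psi : R3 -> R).
Hypothesis Lpsi : L2B psi.
Hypothesis psiE : forall x, B x -> psi x = fou c a b psi x.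
Hypothesis pde : forall x, B x -> x != 0 -> Dc c psi x = chi * psi x.

Let ipsi := L2B_L1B Lpsi.
Let P := fou c a b psi.
Let sP : smooth P. Proof. exact: fou_smooth. Qed.
Let pE i : partial i P = fou1 c a b psi (basis3 R i).
Proof. exact: fou_partial. Qed.
Let jP := fou_jet2 c a b ipsi.

Definition radial (f : R3 -> R) : R3 -> R := \sum_(j < 3) coord3 j * partial j f.

(* Tangent to the unit sphere: the boundary term of Green's formula vanishes. *)
Definition tangential (f : R3 -> R) i : R3 -> R := partial i f - coord3 i * radial f.

Lemma radial_big f x : radial f x = \sum_(j < 3) coord3 j x * partial j f x.
Proof. by rewrite /radial fct_sumE. Qed.

Lemma tangentialE f i x :
  tangential f i x = partial i f x - coord3 i x * radial f x.
Proof. by []. Qed.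

Lemma smooth_radial f : smooth f -> smooth (radial f).
Proof.
move=> sf; apply: smooth_sum => j.
by apply: smoothM; [exact: smooth_coord3|exact: smooth_partial].
Qed.

Lemma smooth_tangential f i : smooth f -> smooth (tangential f i).
Proof.
move=> sf; apply: smoothD; first exact: smooth_partial.
by apply/smoothN/smoothM; [exact: smooth_coord3|exact: smooth_radial].
Qed.

(** The normal component vanishes to first order at the sphere, which compensates the factor [n] in
    the gradient of [cutoff n]. *)
Lemma tangential_normal f x :
  \sum_(i < 3) coord3 i x * tangential f i x = (1 - dot3 x x) * radial f x.
Proof.
have -> : \sum_(i < 3) coord3 i x * tangential f i x =
    \sum_(i < 3) (coord3 i x * partial i f x
      - coord3 i x * coord3 i x * radial f x).
  by apply: eq_bigr => i _; rewrite tangentialE mulrBr mulrA.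
by rewrite sumrB -mulr_suml -radial_big -dot3_coord3 mulrBl mul1r.
Qed.

Let radialE x : radial P x = fou1 c a b psi x x.
Proof.
rewrite radial_big -(linear_coord3 (jet_lin1 jP x) x).
by apply: eq_bigr => j _; rewrite pE.
Qed.

(** With [E = x . grad P], one has [div (E x) = x . grad E + 3 E] and [x . grad E = P2 x x x + E];
    together they account for the term [4 P1 x x] of [ball_pde]. *)
Lemma div_tangential x : B x -> \sum_(i < 3) partial i (tangential P i) x =
  (c ^+ 2 * dot3 x x - chi) * P x.
Proof.
move=> Bx; have := ball_pde ipsi psiE pde Bx.
set P1 := fou1 c a b psi; set P2 := fou2 c a b psi.
have dP1 i j : is_derive x (basis3 R j) (partial i P)
    (P2 (basis3 R i) (basis3 R j) x).
  by rewrite pE; exact: is_diff_is_derive1 (jet_diff1 jP (basis3 R i) x).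
have dE i : is_derive x (basis3 R i) (radial P)
    (P2 x (basis3 R i) x + P1 (basis3 R i) x).
  apply: is_derive_eq (is_derive_sum (fun j => is_deriveM
    (is_derive_coord3 j x (basis3 R i)) (dP1 j i))) _.
  have e2 : \sum_(j < 3) coord3 j x * P2 (basis3 R j) (basis3 R i) x
      = P2 x (basis3 R i) x.
    exact: (linear_coord3 (fun r k l => jet_lin2l jP x (basis3 R i) r k l) x).
  have e1 : \sum_(j < 3) coord3 j (basis3 R i) * P1 (basis3 R j) x
      = P1 (basis3 R i) x by exact: linear_coord3 (jet_lin1 jP x) (basis3 R i).
  rewrite -e2 -{}e1 -big_split.
  apply: eq_bigr => j _ /=; rewrite pE; congr (_ + _).
  exact: mulrC.
have dT i : partial i (tangential P i) x = P2 (basis3 R i) (basis3 R i) x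
    - (coord3 i x * (P2 x (basis3 R i) x + P1 (basis3 R i) x) + P1 x x).
  apply: partialE.
  apply: is_derive_eq (is_deriveB (dP1 i i)
    (is_deriveM (is_derive_coord3 i x (basis3 R i)) (dE i))) _.
  rewrite coord3_basis3 eqxx radialE -/P1.
  by congr (_ - (_ + _)); exact: mulr1.
rewrite (eq_bigr _ (fun i _ => dT i)).
have := linear_coord3 (fun r k l => jet_lin2r jP x x r k l) x.
have := linear_coord3 (jet_lin1 jP x) x.
rewrite -/P1 -/P2 !big_ord3 -/P => <- <- e; rewrite mulrBl -e.
move: (P1 (basis3 R 0) x) (P1 (basis3 R 1) x) (P1 (basis3 R 2%R) x) => p0 p1 p2.
move: (P2 x (basis3 R 0) x) (P2 x (basis3 R 1) x) (P2 x (basis3 R 2%R) x).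
move=> q0 q1 q2; move: (P x) (coord3 0 x) (coord3 1 x) (coord3 2%R x).
by move=> p x0 x1 x2; ring.
Qed.

End divergence.

Lemma green_identity (c chi a b : R) (psi : R3 -> R) v g : L2B psi ->
  (forall x, B x -> psi x = fou c a b psi x) ->
  (forall x, B x -> x != 0 -> Dc c psi x = chi * psi x) ->
  L2B v -> real_weak_gradient v g ->
  \int[mu]_(x in B)
    energy v g (fou c a b psi) (fun i => partial i (fou c a b psi)) c x =
  chi * ip v psi.
Proof.
move=> Lpsi psiE pde Lv [Lg wg].
have ipsi := L2B_L1B Lpsi; have mB := @measurable_B3 R.
set P := fou c a b psi.
have sP : smooth P by exact: fou_smooth.
have cP : continuous P by exact: smooth_continuous.
pose E := radial P; have cE : continuous E.
  exact/smooth_continuous/smooth_radial.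
pose G := tangential P; have cG i : continuous (G i).
  exact/smooth_continuous/smooth_tangential.
pose Q x := (c ^+ 2 * dot3 x x - chi) * P x.
have cQ : continuous Q.
  move=> x; apply: cvgM; last exact: cP.
  apply: cvgB; last exact: cvg_cst.
  by apply: cvgM; [exact: cvg_cst|exact: continuous_dot3xx].
have mc f : continuous f -> measurable_fun3 B f.
  by move=> cf; exact: continuous_measurable_fun3.
have cflat (p : {poly R}) n : continuous (fun x => flat p (ballarg n x)).
  move=> x; apply: continuous_comp; last exact: flat_continuous.
  exact/smooth_continuous/smooth_ballarg.
(* [- 2 K E] is [grad (cutoff n) . G], the factor [n] being absorbed by [flat_succ_mul]. *)
pose K (n : nat) (x : R3) := flat ('X + 'X^2) (ballarg n x).
(* This is [v div (cutoff G) + g . (cutoff G)], which integrates to 0 because [g] is a weak gradient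
   of [v]; [F] is its pointwise limit in the ball. *)
pose F_ (n : nat) x := v x * (cutoff n x * Q x - 2 * (K n x * E x))
  + cutoff n x * \sum_(i < 3) g i x * G i x.
pose F x := v x * Q x + \sum_(i < 3) g i x * G i x.
have F_0 n : \int[mu]_(x in B) F_ n x = 0.
  pose phi i : R3 -> R := cutoff n * G i.
  have tphi i : test_function (phi i).
    exact/cutoff_test_function/smooth_tangential.
  have L2phi i : L2B (phi i).
    by apply: continuous_L2B; have [/smooth_continuous] := tphi i.
  have L2dphi i : L2B (partial i (phi i)).
    apply: continuous_L2B; have [s _ _] := tphi i.
    exact/smooth_continuous/smooth_partial.
  have ii i : L1B (fun x => v x * partial i (phi i) x + g i x * phi i x).
    exact: L1BD (L2B_mul Lv (L2dphi i)) (L2B_mul (Lg i) (L2phi i)).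
  have key i : \int[mu]_(x in B) (v x * partial i (phi i) x + g i x * phi i x) = 0.
    rewrite RintegralD//; last 2 first.
    - exact: L2B_mul Lv (L2dphi i).
    - exact: L2B_mul (Lg i) (L2phi i).
    by rewrite wg// addNr.
  have dphi i x : partial i (phi i) x = cutoff n x * partial i (G i) x
      + G i x * (- 2 * n%:R * coord3 i x * flat 'X^2 (ballarg n x)).
    apply: partialE; apply: is_derive_eq (is_deriveM (is_derive_cutoff n i x)
      (smooth_is_derive i x (smooth_tangential i sP))) _ => //.
  transitivity (\int[mu]_(x in B)
    (v x * partial 0 (phi 0) x + g 0 x * phi 0 x
     + (v x * partial 1 (phi 1) x + g 1 x * phi 1 x)
     + (v x * partial 2%R (phi 2%R) x + g 2%R x * phi 2%R x))).
    apply: eq_Rintegral => x; rewrite inE => Bx; rewrite !dphi.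
    have := div_tangential Lpsi psiE pde Bx; rewrite -/P -/G -/(Q x) /F_ => <-.
    have KE : K n x * E x = n%:R * flat 'X^2 (ballarg n x) *
        \sum_(i < 3) coord3 i x * G i x.
      rewrite tangential_normal /K -flat_succ_mul -/E.
      have -> : ballarg n x + 1 = n%:R * (1 - dot3 x x) by rewrite /ballarg; ring.
      by ring.
    have phiE i : phi i x = cutoff n x * G i x by [].
    rewrite KE !big_ord3 !phiE.
    move: (partial 0 (G 0) x) (partial 1 (G 1) x) (partial 2%R (G 2%R) x).
    move=> p0 p1 p2; move: (G 0 x) (G 1 x) (G 2%R x) (cutoff n x) => t0 t1 t2 eta.
    move: (coord3 0 x) (coord3 1 x) (coord3 2%R x) (flat 'X^2 (ballarg n x)).
    move=> x0 x1 x2 f2; move: (g 0 x) (g 1 x) (g 2%R x) (v x) => g0 g1 g2 vx.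
    by ring.
  rewrite RintegralD; [|exact: mB|exact: L1BD (ii 0) (ii 1)|exact: ii].
  rewrite RintegralD; [|exact: mB|exact: ii|exact: ii].
  by rewrite !key !addr0.
have F0 : \int[mu]_(x in B) F x = 0.
  have [MQ QM] := continuous_bounded_B3 cQ.
  have [ME EM] := continuous_bounded_B3 cE.
  have [C1 C10 flat1] := flat_bounded (1 : {poly R}).
  have [C2 C20 flat2] := flat_bounded ('X + 'X^2 : {poly R}).
  have [M0 G0] := continuous_bounded_B3 (cG 0).
  have [M1 G1] := continuous_bounded_B3 (cG 1).
  have [M2 G2] := continuous_bounded_B3 (cG 2%R).
  (* The bound is uniform in [n]: flat functions are bounded, and [Q], [E] and [G] are bounded on
     the ball. *)
  pose dom x := (C1 * MQ + 2 * (C2 * ME)) * `|v x| + (C1 * M0 * `|g 0 x|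
    + C1 * M1 * `|g 1 x| + C1 * M2 * `|g 2%R x|).
  have mG : measurable_fun3 B (fun x => \sum_(i < 3) g i x * G i x).
    under eq_fun do rewrite big_ord3.
    by apply: measurable_funD; [apply: measurable_funD|];
      apply: measurable_funM; [case: (Lg 0)|exact: mc|case: (Lg 1)|exact: mc|
        case: (Lg 2%R)|exact: mc].
  have mv : measurable_fun3 B v by case: Lv.
  apply: (Rintegral_limit0 (F_ := F_) (dom := dom)) => //.
  - move=> n; apply: measurable_funD.
      apply: measurable_funM => //; apply: mc => x.
      apply: cvgB; first by apply: cvgM; [exact: cflat|exact: cQ].
      by apply: cvgM; [exact: cvg_cst|apply: cvgM; [exact: cflat|exact: cE]].
    by apply: measurable_funM => //; apply: mc; exact: cflat.
  - by apply: measurable_funD => //; apply: measurable_funM => //; exact: mc.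
  - apply: L1BD; first exact/L1BZ/L1B_norm/L2B_L1B.
    by apply: L1BD; [apply: L1BD|]; apply/L1BZ/L1B_norm/L2B_L1B.
  - move=> n x Bx; have q := QM x Bx; have e := EM x Bx.
    have c1 := flat1 (ballarg n x); have c2 := flat2 (ballarg n x).
    have gG i M : `|G i x| <= M -> `|cutoff n x * (g i x * G i x)| <= C1 * M * `|g i x|.
      move=> GM; rewrite !normrM mulrA mulrAC ler_wpM2r//.
      exact: ler_pM.
    rewrite /F_ /dom; apply: le_trans (ler_normD _ _) _; apply: lerD.
      rewrite normrM mulrC ler_wpM2r//; apply: le_trans (ler_normB _ _) _.
      apply: lerD; first by rewrite normrM ler_pM.
      by rewrite !normrM (ger0_norm (x := 2))// ler_wpM2l// ler_pM.
    rewrite big_ord3 (mulrDr _ (_ + _)) (mulrDr _ (g 0 x * G 0 x)).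
    apply: le_trans (ler_normD _ _) _; apply: lerD.
      by apply: le_trans (ler_normD _ _) _; apply: lerD; apply: gG; auto.
    by apply: gG; auto.
  - move=> x Bx; have s := cvgn_ballarg Bx.
    have c1 : cutoff n x @[n --> \oo] --> (1 : R).
      have := cvg_comp _ _ s (@flat_cvg R 1); rewrite hornerC; exact.
    have c2 : K n x @[n --> \oo] --> (0 : R).
      have := cvg_comp _ _ s (@flat_cvg R ('X + 'X^2)).
      by rewrite hornerD hornerX hornerXn expr0n addr0; exact.
    (* The limits 1 and 0 of [cutoff n x] and [K n x] are inserted to give [F] the shape of
       [F_ n]. *)
    rewrite /F -[X in _ + X]mul1r -[Q x]mul1r.
    rewrite -[1 * Q x]subr0 -[X in _ * Q x - X](mulr0 2) -[X in 2 * X](mul0r (E x)).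
    apply: cvgD; last by apply: cvgM => //; exact: cvg_cst.
    apply: cvgM; first exact: cvg_cst.
    apply: cvgB; first by apply: cvgM => //; exact: cvg_cst.
    by apply: cvgM; [exact: cvg_cst|apply: cvgM => //; exact: cvg_cst].
have iF : L1B F.
  apply: L1BD; first exact: L2B_mul Lv (continuous_L2B cQ).
  apply: (@L1B_eq _ (fun x => g 0 x * G 0 x + g 1 x * G 1 x + g 2%R x * G 2%R x)).
    by move=> x _; rewrite big_ord3.
  by apply: L1BD; [apply: L1BD|]; exact: L2B_mul (Lg _) (continuous_L2B (cG _)).
have ivP : L1B (fun x => v x * P x) by exact: L2B_mul Lv (continuous_L2B cP).
have -> : ip v psi = \int[mu]_(x in B) (v x * P x).
  by apply: ipE => x Bx; rewrite psiE.
(* Pointwise, the energy density is [F + chi v P]. *)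
rewrite -RintegralZl// -[RHS]add0r -F0 -RintegralD//; last exact: L1BZ.
apply: eq_Rintegral => x _.
rewrite /energy /F /Q /G -radial_big !big_ord3 !tangentialE.
move: (partial 0 P x) (partial 1 P x) (partial 2%R P x) (radial P x) => p0 p1 p2 e.
move: (g 0 x) (g 1 x) (g 2%R x) (v x) (P x) => g0 g1 g2 vx p.
by move: (coord3 0 x) (coord3 1 x) (coord3 2%R x) (dot3 x x) => x0 x1 x2 d; ring.
Qed.

End green_identity.

(** * Spectral estimates *)

Section energy_form.
Local Open Scope classical_set_scope.
Context {R : realType}.
Local Notation R3 := (R * R * R)%type.
Local Notation mu := (@leb3 R).
Local Notation B := (@B3 R).
Implicit Types (v w : R3 -> R) (g h : 'I_3 -> R3 -> R) (c : R).

Lemma L1B_energy v g w h c : L2B v -> (forall i, L2B (g i)) -> L2B w ->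
  (forall i, L2B (h i)) -> L1B (energy v g w h c).
Proof.
move=> Lv Lg Lw Lh.
have Lsum (k : 'I_3 -> R3 -> R) : (forall i, L2B (k i)) ->
    L2B (fun x => \sum_(i < 3) coord3 i x * k i x).
  move=> Lk; under eq_fun do rewrite big_ord3.
  have Lc i : L2B (fun x => coord3 i x * k i x).
    by apply: continuous_mul_L2B => //; exact: continuous_dot3r.
  exact: L2BD (L2BD (Lc 0) (Lc 1)) (Lc 2%R).
have i1 : L1B (fun x => \sum_(i < 3) g i x * h i x).
  under eq_fun do rewrite big_ord3.
  have Lc i : L1B (fun x => g i x * h i x) by exact: L2B_mul.
  exact: L1BD (L1BD (Lc 0) (Lc 1)) (Lc 2%R).
have i2 := L2B_mul (Lsum _ Lg) (Lsum _ Lh).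
have Lv' : L2B (fun x => c ^+ 2 * dot3 x x * v x).
  apply: continuous_mul_L2B => // x.
  by apply: cvgM; [exact: cvg_cst|exact: continuous_dot3xx].
have i3 := L2B_mul Lv' Lw.
apply: L1B_eq (L1BD (L1BB i1 i2) i3) => x _.
by rewrite /energy !mulrA.
Qed.

Lemma energy_subZ v g w h c (t : R) x :
  energy (fun y => v y - t * w y) (fun i y => g i y - t * h i y)
         (fun y => v y - t * w y) (fun i y => g i y - t * h i y) c x =
  energy v g v g c x - 2 * t * energy v g w h c x + t ^+ 2 * energy w h w h c x.
Proof. by rewrite /energy !big_ord3; ring. Qed.

Lemma energy_ge0 v g c x : B x -> 0 <= energy v g v g c x.
Proof.
move=> /B3E; rewrite /energy dot3_coord3 !big_ord3.
move: (coord3 0 x) (coord3 1 x) (coord3 2%R x) (g 0 x) (g 1 x) (g 2%R x) (v x).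
move=> a0 a1 a2 b0 b1 b2 u h.
apply: addr_ge0; last first.
  apply: mulr_ge0; last by rewrite -expr2 sqr_ge0.
  apply: mulr_ge0; first exact: sqr_ge0.
  by rewrite !addr_ge0// -expr2 sqr_ge0.
(* Cauchy-Schwarz through Lagrange's identity; with [|x| < 1] it shows that the subtracted radial
   square is at most [|g|^2]. *)
have : (a0 * b0 + a1 * b1 + a2 * b2) ^+ 2 <=
    (a0 * a0 + a1 * a1 + a2 * a2) * (b0 * b0 + b1 * b1 + b2 * b2).
  have := sqr_ge0 (a0 * b1 - a1 * b0); have := sqr_ge0 (a0 * b2 - a2 * b0).
  by have := sqr_ge0 (a1 * b2 - a2 * b1); nra.
have : 0 <= b0 * b0 + b1 * b1 + b2 * b2.
  by rewrite !addr_ge0// -expr2 sqr_ge0.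
by rewrite subr_ge0 -expr2; nra.
Qed.

(** The gradient part is at most [|g|^2] and the potential part at most [c^2 v^2]; the factor
    [1 + c^2] dominates both coefficients. *)
Lemma energy_le v g c x : B x ->
  energy v g v g c x <= (1 + c ^+ 2) * (v x * v x + \sum_(i < 3) g i x * g i x).
Proof.
move=> /B3E /ltW d1; have d0 := dot3_ge0 x; rewrite /energy.
have s0 : 0 <= \sum_(i < 3) g i x * g i x.
  by apply: sumr_ge0 => i _; rewrite -expr2 sqr_ge0.
have v0 : 0 <= v x * v x by rewrite -expr2 sqr_ge0.
set s := \sum_(i < 3) _ in s0 *; set u := \sum_(i < 3) _.
have u0 : 0 <= u * u by rewrite -expr2 sqr_ge0.
have c0 : 0 <= c ^+ 2 by exact: sqr_ge0.
have : c ^+ 2 * dot3 x x * (v x * v x) <= c ^+ 2 * (v x * v x).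
  by rewrite ler_wpM2r// ler_piMr.
have : 0 <= c ^+ 2 * s by rewrite mulr_ge0.
lra.
Qed.

Lemma real_weak_gradient_subZ v g w h (t : R) : L2B v -> L2B w ->
  real_weak_gradient v g -> real_weak_gradient w h ->
  real_weak_gradient (fun y => v y - t * w y) (fun i y => g i y - t * h i y).
Proof.
move=> Lv Lw [Lg wg] [Lh wh]; split.
  by move=> i; apply: L2BB => //; exact: L2BZ.
move=> i phi tphi; have [sphi _ _] := tphi.
have Lphi : L2B phi by exact/continuous_L2B/smooth_continuous.
have Ldphi : L2B (partial i phi).
  by apply: continuous_L2B; exact/smooth_continuous/smooth_partial.
have E (a b k : R3 -> R) : L2B a -> L2B b -> L2B k ->
    \int[mu]_(x in B) ((a x - t * b x) * k x) =
    \int[mu]_(x in B) (a x * k x) - t * \int[mu]_(x in B) (b x * k x).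
  move=> La Lb Lk; have := ipBl La (L2BZ t Lb) Lk.
  by rewrite ipZl.
by rewrite !E// wg// wh//; ring.
Qed.

End energy_form.

(** * Bessel's inequality for the energy and the estimate of the high modes *)

Section spectral_projection.
Local Open Scope classical_set_scope.
Context {R : realType}.
Local Notation R3 := (R * R * R)%type.
Local Notation mu := (@leb3 R).
Local Notation B := (@B3 R).
Variables (I : choiceType) (D : set I) (e : I -> R3 -> R).
Implicit Types (f u v w : R3 -> R) (g h : 'I_3 -> R3 -> R) (s S : seq I).
Hypothesis Le : forall k, D k -> L2B (e k).
Hypothesis e_on : forall j k, D j -> D k -> ip (e j) (e k) = (j == k)%:R.

Definition residual s f : R3 -> R :=
  fun x => f x - \sum_(k <- s) ip f (e k) * e k x.

Lemma L2B_lin s (a : I -> R) : [set` s] `<=` D ->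
  L2B (fun x => \sum_(k <- s) a k * e k x).
Proof.
elim: s => [|k s IH] sD.
  by under eq_fun do rewrite big_nil; exact: L2B_cst.
under eq_fun do rewrite big_cons; apply: L2BD.
  by apply/L2BZ/Le/sD; rewrite /= mem_head.
by apply: IH => j js; apply: sD; rewrite /= inE js orbT.
Qed.

Lemma ip_linl s (a : I -> R) f : [set` s] `<=` D -> L2B f ->
  ip (fun x => \sum_(k <- s) a k * e k x) f = \sum_(k <- s) a k * ip (e k) f.
Proof.
move=> + Lf; elim: s => [|k s IH] sD.
  rewrite big_nil /ip -[RHS](mul0r (fine (mu B))) -Rintegral_cst; last first.
    exact: measurable_B3.
  by apply: ipE => x _; rewrite big_nil mul0r.
have sD' : [set` s] `<=` D by move=> j js; apply: sD; rewrite /= inE js orbT.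
have Dk : D k by apply: sD; rewrite /= mem_head.
rewrite big_cons -IH// -ipZl//; last exact: Le.
rewrite -ipDl//; [|exact/L2BZ/Le|exact: L2B_lin].
by apply: ipE => x _; rewrite big_cons.
Qed.

Lemma L2B_residual s f : [set` s] `<=` D -> L2B f -> L2B (residual s f).
Proof. by move=> sD Lf; apply: L2BB => //; exact: L2B_lin. Qed.

Lemma ip_residual_basis s f j : [set` s] `<=` D -> uniq s -> L2B f -> D j ->
  ip (residual s f) (e j) = if j \in s then 0 else ip f (e j).
Proof.
move=> sD us Lf Dj; rewrite ipBl//; [|exact: L2B_lin|exact: Le].
rewrite ip_linl//; last exact: Le.
have -> : \sum_(k <- s) ip f (e k) * ip (e k) (e j) =
    \sum_(k <- s | k == j) ip f (e k).
  rewrite [RHS]big_mkcond; apply: eq_big_seq => k ks.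
  by rewrite e_on//; [case: eqP; rewrite ?mulr1 ?mulr0|exact: sD].
case: ifPn => js; last first.
  rewrite big1_seq ?subr0// => k /andP[/eqP -> ks].
  by rewrite ks in js.
by rewrite -big_filter filter_pred1_uniq// big_seq1 subrr.
Qed.

Lemma ip_residual s f : [set` s] `<=` D -> uniq s -> L2B f ->
  ip (residual s f) (residual s f) = ip f f - \sum_(k <- s) ip f (e k) ^+ 2.
Proof.
move=> sD us Lf; have Lr := L2B_residual sD Lf.
rewrite {1}/residual ipBl//; last exact: L2B_lin.
rewrite ip_linl// [X in _ - X]big1_seq ?subr0; last first.
  move=> k /andP[_ ks].
  rewrite (ipC (e k)) ip_residual_basis// ?ks ?mulr0//.
  exact: sD.
rewrite ipC {1}/residual ipBl//; last exact: L2B_lin.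
rewrite ip_linl//; congr (_ - _); apply: eq_bigr => k _.
by rewrite (ipC (e k)) expr2.
Qed.

Lemma ip_residual_le s f : [set` s] `<=` D -> uniq s -> L2B f ->
  ip (residual s f) (residual s f) <= ip f f.
Proof.
move=> sD us Lf; rewrite ip_residual// gerBl.
by apply: sumr_ge0 => k _; exact: sqr_ge0.
Qed.

Lemma residualB s u v x : [set` s] `<=` D -> L2B u -> L2B v ->
  residual s (fun y => u y - v y) x = residual s u x - residual s v x.
Proof.
move=> sD Lu Lv; rewrite /residual.
have -> : \sum_(k <- s) ip (fun y => u y - v y) (e k) * e k x =
    \sum_(k <- s) ip u (e k) * e k x - \sum_(k <- s) ip v (e k) * e k x.
  rewrite -sumrB; apply: eq_big_seq => k ks.
  by rewrite ipBl//; [rewrite mulrBl|exact/Le/sD].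
by ring.
Qed.

(** The residual [r] and the competitor [q] differ by an element of the span of [s], to which [r] is
    orthogonal. Hence [|r|^2 = <q, r>], and Cauchy-Schwarz gives [|r| <= |q|]. *)
Lemma best_approximation s (F : seq I) (a : I -> R) f (d : R) :
  [set` s] `<=` D -> uniq s -> {subset F <= s} -> L2B f ->
  ip (fun x => f x - \sum_(k <- F) a k * e k x)
     (fun x => f x - \sum_(k <- F) a k * e k x) <= d ->
  ip (residual s f) (residual s f) <= d.
Proof.
move=> sD us Fs Lf; set q := fun x => _.
have FD : [set` F] `<=` D by move=> k kF; apply/sD/Fs.
have Lq : L2B q by apply: L2BB => //; exact: L2B_lin.
have Lr := L2B_residual sD Lf.
have E : ip (residual s f) (residual s f) = ip q (residual s f).
  rewrite {1}/residual ipBl//; last exact: L2B_lin.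
  rewrite /q ipBl//; last exact: L2B_lin.
  rewrite !ip_linl//; congr (_ - _); rewrite !big1_seq// => k /andP[_ ks].
    by rewrite (ipC (e k)) ip_residual_basis// ?(Fs _ ks) ?mulr0//; exact/sD/Fs.
  by rewrite (ipC (e k)) ip_residual_basis// ?ks ?mulr0//; exact/sD.
move=> qd; have := ip_cauchy_schwarz Lq Lr; rewrite -E.
have := ip_ge0 (residual s f); set r := ip (residual s f) _ => r0.
rewrite expr2; have [->|rn0] := eqVneq r 0.
  by move=> _; exact: le_trans (ip_ge0 q) qd.
have rp : 0 < r by rewrite lt_def rn0.
by rewrite ler_pM2r// => h; exact: le_trans h qd.
Qed.

Variables (c : R) (chi : I -> R) (P : I -> R3 -> R).
Hypothesis sP : forall k, D k -> smooth (P k).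
Hypothesis eP : forall k x, D k -> B x -> e k x = P k x.
Hypothesis green : forall k v g, D k -> L2B v -> real_weak_gradient v g ->
  \int[mu]_(x in B) energy v g (P k) (fun i => partial i (P k)) c x =
  chi k * ip v (e k).

(** Induction on [s]: by [green], subtracting [<v, e k> P k] from [v] lowers the energy by exactly
    [chi k <v, e k>^2], and by orthonormality it leaves the other coefficients unchanged. At the end
    the energy is still nonnegative. *)
Lemma bessel_energy s v g : [set` s] `<=` D -> uniq s -> L2B v ->
  real_weak_gradient v g ->
  \sum_(k <- s) chi k * ip v (e k) ^+ 2 <=
  \int[mu]_(x in B) energy v g v g c x.
Proof.
elim: s v g => [|k s IH] v g sD us Lv wg.
  by rewrite big_nil; apply: Rintegral_ge0 => x; exact: energy_ge0.
have sD' : [set` s] `<=` D by move=> j js; apply: sD; rewrite /= inE js orbT.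
have Dk : D k by apply: sD; rewrite /= mem_head.
move: us => /= /andP[ks us].
have LP : L2B (P k) by exact/continuous_L2B/smooth_continuous/sP.
have wP := smooth_weak_gradient (sP Dk).
pose t := ip v (e k).
have Lv' : L2B (fun y => v y - t * P k y) by apply: L2BB => //; exact: L2BZ.
have := IH _ _ sD' us Lv' (real_weak_gradient_subZ t Lv LP wg wP).
have Pe w : ip (P k) w = ip (e k) w by apply: ipE => x Bx; rewrite eP.
have -> : \sum_(j <- s) chi j * ip (fun y => v y - t * P k y) (e j) ^+ 2 =
    \sum_(j <- s) chi j * ip v (e j) ^+ 2.
  apply: eq_big_seq => j js; have Dj := sD' _ js.
  rewrite ipBl//; [|exact: L2BZ|exact: Le].
  rewrite ipZl//; last exact: Le.
  rewrite Pe e_on// (_ : k == j = false) ?mulr0 ?subr0//.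
  by apply/eqP => kj; rewrite kj js in ks.
have Lg := wg.1; have LdP := wP.1; have mB := @measurable_B3 R.
have i1 := L1B_energy c Lv Lg Lv Lg.
have i2 := L1B_energy c Lv Lg LP LdP.
have i3 := L1B_energy c LP LdP LP LdP.
have -> : \int[mu]_(x in B) energy (fun y => v y - t * P k y)
     (fun i y => g i y - t * partial i (P k) y) (fun y => v y - t * P k y)
     (fun i y => g i y - t * partial i (P k) y) c x =
    \int[mu]_(x in B) energy v g v g c x - chi k * t ^+ 2.
  transitivity (\int[mu]_(x in B) (energy v g v g c x
    - 2 * t * energy v g (P k) (fun i => partial i (P k)) c x
    + t ^+ 2 * energy (P k) (fun i => partial i (P k))
        (P k) (fun i => partial i (P k)) c x)).
    by apply: eq_Rintegral => x _; exact: energy_subZ.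
  rewrite RintegralD; [|exact: mB|exact: L1BB i1 (L1BZ _ i2)|exact: L1BZ].
  rewrite RintegralB; [|exact: mB|exact: i1|exact: L1BZ].
  rewrite !RintegralZl; [|exact: mB|exact: i3|exact: mB|exact: i2].
  rewrite !green// Pe e_on// eqxx -/t /=; ring.
by rewrite big_cons -/t; lra.
Qed.

Definition sqH1 v g : R := ip v v + \sum_(i < 3) ip (g i) (g i).

Lemma energy_le_sqH1 v g : L2B v -> real_weak_gradient v g ->
  \int[mu]_(x in B) energy v g v g c x <= (1 + c ^+ 2) * sqH1 v g.
Proof.
move=> Lv [Lg _]; have mB := @measurable_B3 R.
have ii i : L1B (fun x => g i x * g i x) by exact: L2B_mul.
have iv : L1B (fun x => v x * v x) by exact: L2B_mul.
have is3 : L1B (fun x => g 0 x * g 0 x + g 1 x * g 1 x + g 2%R x * g 2%R x).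
  exact: L1BD (L1BD (ii 0) (ii 1)) (ii 2%R).
rewrite /sqH1 big_ord3 /ip.
rewrite -RintegralD; [|exact: mB|exact: ii|exact: ii].
rewrite -RintegralD; [|exact: mB|exact: L1BD (ii 0) (ii 1)|exact: ii].
rewrite -RintegralD; [|exact: mB|exact: iv|exact: is3].
rewrite -RintegralZl; [|exact: mB|exact: L1BD iv is3].
apply: le_Rintegral; [exact: mB|exact: L1B_energy|exact/L1BZ/(L1BD iv is3)|].
by move=> x Bx; have := energy_le v g c Bx; rewrite big_ord3.
Qed.

Hypothesis complete : forall f, L2B f -> forall d : R, 0 < d ->
  exists (F : seq I) (a : I -> R), [set` F] `<=` D /\
    ip (fun x => f x - \sum_(k <- F) a k * e k x)
       (fun x => f x - \sum_(k <- F) a k * e k x) < d.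

Variables (eps : R) (S : seq I).
Hypothesis eps0 : 0 < eps.
Hypothesis SE : forall k, k \in S <-> D k /\ chi k <= 1 / eps.
Hypothesis uS : uniq S.

Let SD : [set` S] `<=` D. Proof. by move=> k /SE[]. Qed.

(** Density provides a finite set [T] of further modes such that the residual for [S ++ T] is at
    most [d]; the residual for [S] is then at most [d] plus the sum over [T]. There
    [eps * chi k > 1], so Bessel's inequality for the energy bounds this sum. *)
Lemma residual_H1 v g : L2B v -> real_weak_gradient v g ->
  ip (residual S v) (residual S v) <= eps * (1 + c ^+ 2) * sqH1 v g.
Proof.
move=> Lv wg; apply/ler_addgt0Pr => d d0.
have [F [a [FD Fd]]] := complete Lv d0.
pose T := [seq k <- undup F | k \notin S].
have TD : [set` T] `<=` D.
  by move=> k; rewrite /= mem_filter mem_undup => /andP[_]; exact: FD.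
have uT : uniq T by rewrite filter_uniq// undup_uniq.
have uST : uniq (S ++ T).
  rewrite cat_uniq uS uT andbT; apply/hasPn => k.
  by rewrite mem_filter => /andP[].
have STD : [set` (S ++ T)] `<=` D.
  by move=> k; rewrite /= mem_cat => /orP[]; [exact: SD|exact: TD].
have FST : {subset F <= S ++ T}.
  move=> k kF; rewrite mem_cat mem_filter mem_undup kF andbT.
  by case: (k \in S).
have := best_approximation STD uST FST Lv (ltW Fd).
rewrite !ip_residual// big_cat/= => h.
have : \sum_(k <- T) ip v (e k) ^+ 2 <= eps * \sum_(k <- T) chi k * ip v (e k) ^+ 2.
  rewrite mulr_sumr big_seq [leRHS]big_seq; apply: ler_sum => k kT.
  rewrite mulrA ler_peMl ?sqr_ge0//.
  have nS : k \notin S by move: kT; rewrite mem_filter => /andP[].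
  have : 1 / eps < chi k.
    by rewrite ltNge; apply: contra nS => le; apply/SE; split => //; exact: TD.
  by rewrite ltr_pdivrMr// mulrC => /ltW.
have := bessel_energy TD uT Lv wg; have := energy_le_sqH1 Lv wg.
set b := \sum_(k <- T) chi k * _; set A := Rintegral _ _ _ => h1 h2 h3.
have : eps * b <= eps * ((1 + c ^+ 2) * sqH1 v g).
  by rewrite ler_pM2l//; exact: le_trans h2 h1.
lra.
Qed.

Lemma residual_K2 u v g (t l : R) : L2B u -> L2B v -> real_weak_gradient v g ->
  l = t ^+ 2 / (eps * (1 + c ^+ 2)) ->
  l / (1 + l) * ip (residual S u) (residual S u) <=
  ip (fun x => u x - v x) (fun x => u x - v x) + t ^+ 2 * sqH1 v g.
Proof.
move=> Lu Lv wg lE; have mB := @measurable_B3 R.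
have c1 : 0 < 1 + c ^+ 2 by rewrite ltr_pwDl// sqr_ge0.
have l0 : 0 <= l by rewrite lE divr_ge0 ?sqr_ge0// mulr_ge0// ltW.
have Luv := L2BB Lu Lv.
have Ruv := L2B_residual SD Luv; have Ru := L2B_residual SD Lu.
have Rv := L2B_residual SD Lv.
apply: (@le_trans _ _ (ip (residual S (fun x => u x - v x))
   (residual S (fun x => u x - v x)) + l * ip (residual S v) (residual S v))).
  rewrite /ip -!RintegralZl//; [|exact: L2B_mul..].
  rewrite -RintegralD//; [|exact: L2B_mul|by apply: L1BZ; exact: L2B_mul].
  apply: le_Rintegral => //.
  - by apply: L1BZ; exact: L2B_mul.
  - by apply: L1BD; [exact: L2B_mul|apply: L1BZ; exact: L2B_mul].
  move=> x _; rewrite residualB//.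
  move: (residual S u x) (residual S v x) => p q.
  rewrite mulrAC ler_pdivrMr; last by rewrite ltr_pwDl.
  (* After multiplication by [1 + l], the two sides differ by exactly this square; it vanishes at
     the minimizer [q = p / (1 + l)]. *)
  have := sqr_ge0 (p - q - l * q); nra.
apply: lerD; first exact: ip_residual_le.
have := residual_H1 Lv wg => h.
apply: le_trans (ler_wpM2l l0 h) _.
rewrite lE mulrA le_eqVlt; apply/orP; left; apply/eqP; congr (_ * _).
by field; rewrite !gt_eqF.
Qed.

End spectral_projection.

(** * Interpolation *)

Section interpolation_constant.
Local Open Scope classical_set_scope.
Context {R : realType}.
Local Notation lam := (@lebesgue_measure R).

Import HBNNSimple.

(* [ge0_le_integral] requires measurability, which is not known for the
   K-functional. *)
Lemma ge0_le_integral_nm d (T : measurableType d) (mu : {measure set T -> \bar R})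
    (D : set T) (f g : T -> \bar R) :
  (forall x, D x -> 0 <= f x)%E -> (forall x, D x -> f x <= g x)%E ->
  (\int[mu]_(x in D) f x <= \int[mu]_(x in D) g x)%E.
Proof.
move=> f0 fg; rewrite integral_mkcond [leRHS]integral_mkcond.
have g0 x : D x -> (0 <= g x)%E by move=> Dx; exact: le_trans (f0 x Dx) (fg x Dx).
have fD0 x : (0 <= (f \_ D) x)%E by exact: erestrict_ge0.
have gD0 x : (0 <= (g \_ D) x)%E by exact: erestrict_ge0.
(* The integral of a nonnegative function is the supremum over the simple functions below it, hence
   monotone for arbitrary functions. *)
rewrite !ge0_integralTE//; apply: le_ereal_sup => _ [h hf <-]; exists h => // x.
by apply: le_trans (hf x) _; exact: lee_restrict.
Qed.

(** Both sides are measures that agree on half-open intervals, which determine Lebesgue measure. *)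
Lemma lebesgue_measure_scale (a : R) (a0 : 0 < a) (A : set (measurableTypeR R)) :
  measurable A ->
  lam A = (a%:E * lam ((fun t => (a * t)%R) @^-1` A))%E.
Proof.
move=> mA.
pose phi : measurableTypeR R -> measurableTypeR R := fun t => a * t.
have mphi : measurable_fun setT phi by exact: mulrl_measurable.
pose mphi_mixin := isMeasurableFun.Build _ _ _ _ _ mphi.
pose phi' : {mfun measurableTypeR R >-> measurableTypeR R} :=
  HB.pack phi mphi_mixin.
have := @lebesgue_measure_unique R (mscale (NngNum (ltW a0)) (pushforward lam phi')).
apply => //= _ [[x y] _ <-]/=.
rewrite /mscale/= /pushforward.
have -> : phi @^-1` `]x, y] = `]x / a, y / a]%classic.
  apply/seteqP; split => t /=; rewrite !in_itv/= /phi.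
    by rewrite ltr_pdivrMr// ler_pdivlMr// mulrC.
  by rewrite ltr_pdivrMr// ler_pdivlMr// mulrC.
rewrite !lebesgue_measure_itv/= !lte_fin ltr_pM2r ?invr_gt0//.
case: ifPn => _; last by rewrite mule0.
by rewrite -!EFinB -EFinM; congr EFin; field; rewrite gt_eqF.
Qed.

(** The substitution [t -> a t]: Lebesgue measure is [a] times its own image under this dilation,
    and the dilation preserves the half-line. *)
Lemma integral_scale (a : R) (f : R -> \bar R) : 0 < a ->
  measurable_fun setT (f : measurableTypeR R -> \bar R) ->
  (forall t, 0 <= f t)%E ->
  (\int[lam]_(t in `]0%R, +oo[) f t =
   a%:E * \int[lam]_(t in `]0%R, +oo[) f (a * t)%R)%E.
Proof.
move=> a0 mf f0.
pose phi : measurableTypeR R -> measurableTypeR R := fun t => a * t.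
have mphi : measurable_fun setT phi by exact: mulrl_measurable.
pose mphi_mixin := isMeasurableFun.Build _ _ _ _ _ mphi.
pose phi' : {mfun measurableTypeR R >-> measurableTypeR R} :=
  HB.pack phi mphi_mixin.
have mD : measurable (`]0%R, +oo[ : set (measurableTypeR R)).
  exact: measurable_itv.
pose m0 : {measure set (measurableTypeR R) -> \bar R} :=
  mscale (NngNum (ltW a0)) (pushforward lam phi').
pose m := m0 mphi.
have -> : (\int[lam]_(t in `]0%R, +oo[) f t = \int[m]_(t in `]0%R, +oo[) f t)%E.
  have mE (A : set (measurableTypeR R)) : measurable A ->
      A `<=` (`]0%R, +oo[ : set (measurableTypeR R)) -> lam A = m A.
    by move=> mA _; exact: (lebesgue_measure_scale a0 mA).
  exact: (eq_measure_integral m mE).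
have mfD : measurable_fun (`]0%R, +oo[ : set (measurableTypeR R)) f.
  exact: measurable_funTS.
rewrite /m /m0 ge0_integral_mscale//; congr (_ * _)%E.
rewrite ge0_integral_pushforward//.
rewrite (_ : phi' @^-1` `]0, +oo[ = `]0, +oo[)//.
by apply/seteqP; split => t /=; rewrite !in_itv/= !andbT /phi pmulr_rgt0.
Qed.

Lemma integral_powR_le1 (p : R) : 0 < p ->
  (\int[lam]_(t in `]0%R, 1%R]) (t `^ (p - 1))%:E <= p^-1%:E)%E.
Proof.
move=> p0.
(* The singularity at 0 is exhausted by compact intervals; [n.+2] keeps the left end strictly below
   1. *)
pose F (n : nat) : set (measurableTypeR R) := `[n.+2%:R^-1, 1].
have UF : `]0%R, 1%R]%classic = \bigcup_n F n.
  apply/seteqP; split => t; rewrite /= in_itv/=.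
    move=> /andP[t0 t1]; have [n tn] : exists n : nat, t^-1 <= n%:R.
      by exists (Num.bound t^-1); apply/ltW/archi_boundP; rewrite invr_ge0 ltW.
    exists n => //; rewrite /F/= in_itv/= t1 andbT.
    rewrite invf_ple ?posrE ?ltr0Sn//; apply: le_trans tn _.
    by rewrite ler_nat -addn2 leq_addr.
  move=> [n _]; rewrite /F/= in_itv/= => /andP[tn ->]; rewrite andbT.
  by apply: lt_le_trans tn; rewrite invr_gt0 ltr0Sn.
have mF n : measurable (F n) by exact: measurable_itv.
have nF : nondecreasing_seq F.
  move=> m n mn; apply/subsetPset => t; rewrite /F/= !in_itv/= => /andP[mt ->].
  rewrite andbT; apply: le_trans mt.
  by rewrite lef_pV2 ?posrE ?ltr0Sn// ler_nat ltnS.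
have mf (A : set (measurableTypeR R)) : measurable_fun A (fun t => (t `^ (p - 1))%:E).
  by apply/measurable_EFinP; apply: measurable_funTS; exact: measurable_powR.
have := @ge0_nondecreasing_set_cvg_integral _ _ _ F (fun t => (t `^ (p - 1))%:E)
  lam nF mF (fun n => mf _) (fun n x _ => ltac:(by rewrite lee_fin powR_ge0)).
rewrite -UF => lim; rewrite -(cvg_lim _ lim)//.
apply: lime_le; first by apply/cvg_ex; eexists; exact: lim.
apply: nearW => n; rewrite /F.
have n01 : n.+2%:R^-1 < 1 :> R by rewrite invf_lt1 ?ltr0Sn// ltr1n.
have n0 : 0 < n.+2%:R^-1 :> R by rewrite invr_gt0 ltr0Sn.
pose G (t : R) := p^-1 * t `^ p.
have dG (t : R) : 0 < t -> is_derive t (1 : R) G (t `^ (p - 1)).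
  move=> t0; apply: is_derive_eq (is_deriveZ p^-1 (is_derive1_powR p t0)) _.
  rewrite /GRing.scale/= mulrA mulVf ?mul1r//.
  by rewrite gt_eqF.
have cpow q (t : R) : 0 < t -> {for t, continuous (fun t : R => t `^ q)}.
  move=> t0; apply: differentiable_continuous; apply/derivable1_diffP.
  by case: (is_derive1_powR q t0).
rewrite (@continuous_FTC2 _ _ G _ _ n01).
- rewrite -EFinB lee_fin /G powR1 mulr1 gerBl mulr_ge0 ?powR_ge0//.
  by rewrite invr_ge0 ltW.
- apply: continuous_in_subspaceT => t; rewrite inE/= in_itv/= => /andP[nt _].
  by apply: cpow; exact: lt_le_trans nt.
- have cG (t : R) : 0 < t -> {for t, continuous G}.
    by move=> t0; apply: differentiable_continuous; apply/derivable1_diffP;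
      case: (dG t t0).
  split.
  + by move=> t; rewrite in_itv/= => /andP[nt _]; case: (dG t (lt_trans n0 nt)).
  + exact/cvg_at_right_filter/cG.
  + exact/cvg_at_left_filter/cG.
- move=> t; rewrite in_itv/= => /andP[nt _].
  by rewrite derive1E; case: (dG t (lt_trans n0 nt)).
Qed.

Lemma integral_powR_ge1 (q : R) : 0 < q ->
  (\int[lam]_(t in `[1%R, +oo[) (t `^ (- q - 1))%:E = q^-1%:E)%E.
Proof.
move=> q0; pose G (t : R) := - q^-1 * t `^ (- q).
have dG (t : R) : 0 < t -> is_derive t (1 : R) G (t `^ (- q - 1)).
  move=> t0.
  apply: is_derive_eq (is_deriveZ (- q^-1) (is_derive1_powR (- q) t0)) _.
  rewrite /GRing.scale/= mulrA mulrNN mulVf ?mul1r//.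
  by rewrite gt_eqF.
have cpow r (t : R) : 0 < t -> {for t, continuous (fun t : R => t `^ r)}.
  move=> t0; apply: differentiable_continuous; apply/derivable1_diffP.
  by case: (is_derive1_powR r t0).
have cG (t : R) : 0 < t -> {for t, continuous G}.
  by move=> t0; apply: differentiable_continuous; apply/derivable1_diffP;
    case: (dG t t0).
rewrite (@ge0_continuous_FTC2y _ _ G _ 0).
- by rewrite /G powR1 mulr1 sub0e -EFinN opprK.
- by move=> t _; exact: powR_ge0.
- apply: continuous_in_subspaceT => t; rewrite inE/= in_itv/= andbT => t1.
  by apply: cpow; exact: lt_le_trans t1.
- have p0 : t `^ (- q) @[t --> +oo%R] --> (0 : R).
    apply/cvgrPdist_le => d d0; near=> t.
    rewrite sub0r normrN ger0_norm ?powR_ge0// powRN.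
    (* This threshold solves [t^(- q) = d]. *)
    have A0 : 0 < d `^ (- q^-1) by exact: powR_gt0.
    have At : d `^ (- q^-1) <= t.
      by near: t; apply: nbhs_pinfty_ge; rewrite num_real.
    have : (d `^ (- q^-1)) `^ q <= t `^ q.
      have tn : t \is Num.nneg by rewrite nnegrE (le_trans (ltW A0) At).
      have An : d `^ (- q^-1) \is Num.nneg by rewrite nnegrE ltW.
      exact: (ge0_ler_powR (ltW q0) An tn At).
    rewrite -powRrM mulNr mulVf ?gt_eqF// powR_inv1 ?(ltW d0)// => h.
    rewrite -[leRHS]invrK lef_pV2// ?posrE ?invr_gt0// powR_gt0//.
  rewrite -[0](mulr0 (- q^-1)); apply: cvgM => //; exact: cvg_cst.
- by move=> t t1; case: (dG t (lt_trans ltr01 t1)).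
- exact/cvg_at_right_filter/cG.
- move=> t; rewrite in_itv/= andbT => t1.
  by rewrite derive1E; case: (dG t (lt_trans ltr01 t1)).
Unshelve. all: by end_near. Qed.

End interpolation_constant.

(** * The weight integral and its scaling *)

Section interpolation_weight.
Local Open Scope classical_set_scope.
Context {R : realType}.
Local Notation lam := (@lebesgue_measure R).
Variable s : R.
Hypotheses (s0 : 0 < s) (s1 : s < 1).

Let kap (t : R) : R := t `^ (1 - 2 * s) / (1 + t ^+ 2).

Let den_gt0 (t : R) : 0 < 1 + t ^+ 2.
Proof. by rewrite ltr_pwDl// sqr_ge0. Qed.

Let kap_ge0 t : 0 <= kap t.
Proof. by rewrite divr_ge0 ?powR_ge0// ltW. Qed.

Let cden : continuous (fun t : R => (1 + t ^+ 2)^-1).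
Proof.
move=> t; apply: cvgV; first by rewrite gt_eqF.
apply: cvgD; first exact: cvg_cst.
by apply: exprn_continuous.
Qed.

Let measurable_kap : measurable_fun setT kap.
Proof.
apply: measurable_funM; first exact: measurable_powR.
exact: continuous_measurable_fun.
Qed.

Let J : \bar R := (\int[lam]_(t in `]0%R, +oo[) (kap t)%:E)%E.

(** [interp_const] inverts the real number [fine J], so [J] has to be finite and positive to avoid
    the defaults [fine +oo = 0] and [0^-1 = 0]. Here [kap] is at most [t^(1 - 2 s)] on []0, 1]],
    integrable as [s < 1], and at most [t^(- 1 - 2 s)] beyond 1, integrable as [s > 0]. *)
Let J_lty : (J < +oo)%E.
Proof.
have mk (A : set (measurableTypeR R)) : measurable_fun A (EFin \o kap).
  by apply/measurable_EFinP; exact: measurable_funTS.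
have mpow (A : set (measurableTypeR R)) p :
    measurable_fun A (fun t => (t `^ p)%:E : \bar R).
  by apply/measurable_EFinP; apply: measurable_funTS; exact: measurable_powR.
have UE : `]0%R, +oo[%classic = `]0%R, 1%R] `|` `]1%R, +oo[ :> set R.
  apply/seteqP; split => t; rewrite /= !in_itv/= !andbT.
    by move=> t0; case: (leP t 1) => t1; [left; rewrite t0|right].
  by case=> [/andP[]//|t1]; exact: lt_trans t1.
have dUE : disj_set (`]0%R, 1%R] : set R) `]1%R, +oo[.
  apply/disj_setPS => t [] /=; rewrite !in_itv/= andbT => /andP[_ t1].
  by rewrite ltNge t1.
rewrite /J UE ge0_integral_setU//; [|by move=> t _; rewrite lee_fin].
have p0 : 0 < 2 - 2 * s by rewrite subr_gt0 gtr_pMr.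
have q0 : 0 < 2 * s by rewrite mulr_gt0.
apply: (@le_lt_trans _ _ (\int[lam]_(t in `]0%R, 1%R]) (t `^ (2 - 2 * s - 1))%:E
   + \int[lam]_(t in `]1%R, +oo[) (t `^ (- (2 * s) - 1))%:E)%E); last first.
  have -> : (\int[lam]_(t in `]1%R, +oo[) (t `^ (- (2 * s) - 1))%:E)%E
      = ((2 * s)^-1)%:E.
    rewrite integral_itv_obnd_cbnd; first exact: integral_powR_ge1 q0.
    exact: mpow.
  by rewrite lte_add_pinfty ?ltry// (le_lt_trans (integral_powR_le1 p0)) ?ltry.
apply: leeD; apply: ge0_le_integral_nm => t; rewrite ?lee_fin// /= in_itv/=.
- move=> /andP[t0 t1]; rewrite /kap; have -> : 2 - 2 * s - 1 = 1 - 2 * s by ring.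
  by rewrite ler_pdivrMr// ler_peMr ?powR_ge0// lerDl sqr_ge0.
- rewrite andbT => t1; have t0 : 0 < t by exact: lt_trans t1.
  have -> : - (2 * s) - 1 = 1 - 2 * s - 2 by ring.
  have -> : t `^ (1 - 2 * s - 2) = t `^ (1 - 2 * s) / t ^+ 2.
    by rewrite powRB ?(gt_eqF t0) ?implybT// powR_mulrn// ltW.
  rewrite /kap ler_pM2l ?powR_gt0//.
  by rewrite lef_pV2 ?posrE ?exprn_gt0// lerDr.
Qed.

(** On [[1, 2]] the integrand is at least 1/10, because [t^(1 - 2 s) >= 1/t >= 1/2] and
    [1 + t^2 <= 5]. *)
Let J_gt0 : (0 < J)%E.
Proof.
apply: (@lt_le_trans _ _ (\int[lam]_(t in `]0%R, +oo[)
   (if t \in `[1, 2] then 10^-1 else 0)%:E)%E); last first.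
  apply: ge0_le_integral_nm => t.
    by rewrite lee_fin; case: ifPn.
  rewrite /= in_itv/= andbT lee_fin => t0; case: ifPn => // /[!in_itv]/= /andP[t1 t2].
  rewrite /kap ler_pdivlMr//.
  have : t^-1 <= t `^ (1 - 2 * s).
    rewrite -(powR_inv1 (ltW t0)) ler_powR//.
    have : 2 * s <= 2 by rewrite ger_pMr// ltW.
    by rewrite lerBrDr -lerBrDl opprK.
  have : 2^-1 <= t^-1 by rewrite lef_pV2 ?posrE.
  have : t ^+ 2 <= 4 by nra.
  by lra.
have -> : (\int[lam]_(t in `]0%R, +oo[)
   (if t \in `[1%R, 2%R] then 10^-1 else 0)%:E)%E =
   (\int[lam]_(t in `[1%R, 2%R]) (10^-1)%:E)%E.
  rewrite integral_mkcond [RHS]integral_mkcond; apply: eq_integral => t _.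
  rewrite !patchE !mem_setE; case: ifPn => [|/[!in_itv]/= t0]; first by case: ifPn.
  case: ifPn => // /andP[t1 _]; move: t0; rewrite andbT.
  by rewrite (lt_le_trans ltr01 t1).
rewrite (integral_cst lam (measurable_itv _)) /=.
rewrite lebesgue_measure_itv/= lte_fin ltr1n -EFinB -EFinM lte_fin.
by rewrite mulr_gt0// subr_gt0 ltr1n.
Qed.

(** With [a = sqrt W] the integrand is [a^(1 + 2 s) kap (a t)]; the substitution contributes
    [1 / a], which leaves [a^(2 s) = W^s]. *)
Lemma integral_scaled_weight (W : R) : 0 < W ->
  (\int[lam]_(t in `]0%R, +oo[)
     (t `^ (- 1 - 2 * s) * (t ^+ 2 * W / (1 + t ^+ 2 * W)))%:E
   = (W `^ s)%:E * J)%E.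
Proof.
move=> W0; pose a := Num.sqrt W.
have a0 : 0 < a by rewrite sqrtr_gt0.
have a2 : a ^+ 2 = W by rewrite sqr_sqrtr// ltW.
have fE (t : R) : 0 < t ->
    t `^ (- 1 - 2 * s) * (t ^+ 2 * W / (1 + t ^+ 2 * W)) =
    a `^ (1 + 2 * s) * kap (a * t).
  move=> t0; rewrite /kap powRM ?ltW// exprMn a2.
  have -> : t `^ (- 1 - 2 * s) = t `^ (1 - 2 * s) / t ^+ 2.
    rewrite -powR_mulrn ?ltW// -powRB ?(gt_eqF t0) ?implybT//.
    by congr (_ `^ _); ring.
  have : a `^ (1 + 2 * s) * a `^ (1 - 2 * s) = W.
    rewrite -powRD ?(gt_eqF a0) ?implybT// -a2 -powR_mulrn ?ltW//.
    by congr (_ `^ _); ring.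
  move: (a `^ (1 + 2 * s)) (a `^ (1 - 2 * s)) (t `^ (1 - 2 * s)) => x y z xy.
  rewrite 2!(mulrA x) xy (mulrC W (t ^+ 2)).
  field; rewrite (gt_eqF t0) andbT gt_eqF//.
  by rewrite ltr_pwDl// mulr_ge0 ?sqr_ge0// ltW.
transitivity (\int[lam]_(t in `]0%R, +oo[)
    ((a `^ (1 + 2 * s))%:E * (kap (a * t))%:E))%E.
  by apply: eq_integral => t; rewrite inE/= in_itv/= andbT => t0; rewrite fE.
have mk : measurable_fun setT ((fun t => (kap t)%:E) : measurableTypeR R -> \bar R).
  exact/measurable_EFinP.
rewrite ge0_integralZl//; last 3 first.
- apply: measurable_funTS; apply/measurable_EFinP.
  by apply: (measurableT_comp measurable_kap); exact: mulrl_measurable.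
- by move=> t _; rewrite lee_fin.
- by rewrite lee_fin powR_ge0.
have := integral_scale a0 mk (fun t => ltac:(by rewrite lee_fin)).
rewrite -/J => ->; rewrite muleA -EFinM; congr (_%:E * _)%E; apply: esym.
rewrite -a2 -powR_mulrn ?ltW// -powRrM -[X in _ * X](powRr1 (ltW a0)).
by rewrite -powRD ?(gt_eqF a0) ?implybT//; congr (_ `^ _); ring.
Qed.

(** The lower bound for [K] integrates to [W^s N J], and the factor [J] is what [interp_const]
    divides out. *)
Lemma interpolation_lower_bound (W N : R) (K : R -> \bar R) : 0 < W -> 0 <= N ->
  (forall t : R, 0 < t ->
    ((t ^+ 2 * W / (1 + t ^+ 2 * W) * N)%:E <= K t)%E) ->
  ((W `^ s * N)%:E <= (interp_const s)%:E *
     \int[lam]_(t in `]0%R, +oo[) ((t `^ (- 1 - 2 * s))%:E * K t))%E.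
Proof.
move=> W0 N0 NK.
have d0 (t : R) : 0 < 1 + t ^+ 2 * W.
  by rewrite ltr_pwDl// mulr_ge0 ?sqr_ge0// ltW.
have w0 (t : R) : 0 <= t `^ (- 1 - 2 * s) * (t ^+ 2 * W / (1 + t ^+ 2 * W)).
  rewrite mulr_ge0 ?powR_ge0// divr_ge0 ?(ltW (d0 t))//.
  by rewrite mulr_ge0 ?sqr_ge0// ltW.
have Jfin : J \is a fin_num by rewrite ge0_fin_numE// ltW.
have fJ0 : 0 < fine J by rewrite fine_gt0// J_gt0.
have -> : interp_const s = (fine J)^-1 by [].
apply: (@le_trans _ _ ((fine J)^-1%:E * (N%:E * ((W `^ s)%:E * J)))%E).
  rewrite -{2}(fineK Jfin) -!EFinM lee_fin le_eqVlt; apply/orP; left; apply/eqP.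
  by field; rewrite gt_eqF.
apply: lee_wpmul2l; first by rewrite lee_fin invr_ge0 ltW.
rewrite -integral_scaled_weight// -ge0_integralZl_EFin//; last 2 first.
- by move=> t _; rewrite lee_fin.
- apply: measurable_funTS; apply/measurable_EFinP.
  apply: measurable_funM; first exact: measurable_powR.
  apply: continuous_measurable_fun => t.
  have ct : {for t, continuous (fun t : R => t ^+ 2 * W)}.
    by apply: cvgM; [exact: exprn_continuous|exact: cvg_cst].
  apply: cvgM => //; apply: cvgV; first by rewrite gt_eqF.
  by apply: cvgD => //; exact: cvg_cst.
apply: ge0_le_integral_nm => t; rewrite /= in_itv/= andbT => t0.
  by rewrite -EFinM lee_fin mulr_ge0.
rewrite -EFinM mulrCA EFinM lee_wpmul2l ?lee_fin ?powR_ge0//.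
by rewrite mulrC; exact: NK.
Qed.

End interpolation_weight.

(** * Complex valued functions *)

Section complex_to_real.
Local Open Scope classical_set_scope.
Context {R : realType}.
Local Notation R3 := (R * R * R)%type.
Local Notation mu := (@leb3 R).
Local Notation B := (@B3 R).
Implicit Types (u v : R3 -> R[i]) (f : R3 -> R).
Local Notation re u := (fun x => complex.Re (u x)).
Local Notation im u := (fun x => complex.Im (u x)).

Lemma Re_mul_real (z : R[i]) (a : R) : complex.Re (z * a%:C%C) = complex.Re z * a.
Proof. by case: z => x y /=; rewrite mulr0 subr0. Qed.

Lemma Im_mul_real (z : R[i]) (a : R) : complex.Im (z * a%:C%C) = complex.Im z * a.
Proof. by case: z => x y /=; rewrite mulr0 add0r. Qed.

Lemma ReB (z w : R[i]) : complex.Re (z - w) = complex.Re z - complex.Re w.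
Proof. by case: z w => [? ?] [? ?]. Qed.

Lemma ImB (z w : R[i]) : complex.Im (z - w) = complex.Im z - complex.Im w.
Proof. by case: z w => [? ?] [? ?]. Qed.

Lemma Re_sum_real (I : Type) (s : seq I) (z : I -> R[i]) (a : I -> R) :
  complex.Re (\sum_(k <- s) z k * (a k)%:C%C) = \sum_(k <- s) complex.Re (z k) * a k.
Proof.
elim: s => [|k s IH]; first by rewrite !big_nil.
rewrite !big_cons -IH -Re_mul_real; move: (z k * _) (\sum_(_ <- _) _).
by move=> [? ?] [? ?].
Qed.

Lemma Im_sum_real (I : Type) (s : seq I) (z : I -> R[i]) (a : I -> R) :
  complex.Im (\sum_(k <- s) z k * (a k)%:C%C) = \sum_(k <- s) complex.Im (z k) * a k.
Proof.
elim: s => [|k s IH]; first by rewrite !big_nil.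
rewrite !big_cons -IH -Im_mul_real; move: (z k * _) (\sum_(_ <- _) _).
by move=> [? ?] [? ?].
Qed.

Lemma inner_real u f : inner u (fun x => (f x)%:C%C) =
  (ip (re u) f +i* ip (im u) f)%C.
Proof.
rewrite /inner /cintegral; congr (_ +i* _)%C; apply: ipE => x _.
  by case: (u x) => a b /=; rewrite oppr0 mulr0 subr0.
by case: (u x) => a b /=; rewrite oppr0 mulr0 add0r.
Qed.

Lemma weak_gradient_real v g : weak_gradient v g ->
  real_weak_gradient (re v) (fun i => re (g i)) /\
  real_weak_gradient (im v) (fun i => im (g i)).
Proof.
move=> [Lg wg]; split; split.
- by move=> i; have /L2P[] := Lg i.
- move=> i phi tphi; have := congr1 (@complex.Re R) (wg i phi tphi).
  rewrite /cintegral /= => e.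
  transitivity (\int[mu]_(x in B) complex.Re (v x * (partial i phi x)%:C%C)).
    by apply: ipE => x _; rewrite Re_mul_real.
  by rewrite e; congr (- _); apply: ipE => x _; rewrite Re_mul_real.
- by move=> i; have /L2P[] := Lg i.
- move=> i phi tphi; have := congr1 (@complex.Im R) (wg i phi tphi).
  rewrite /cintegral /= => e.
  transitivity (\int[mu]_(x in B) complex.Im (v x * (partial i phi x)%:C%C)).
    by apply: ipE => x _; rewrite Im_mul_real.
  by rewrite e; congr (- _); apply: ipE => x _; rewrite Im_mul_real.
Qed.

Lemma H1_norm_sqE v : H1 v -> (H1_norm v `^ 2%R =
  (sqH1 (re v) (fun i => re (wgrad v i)) + sqH1 (im v) (fun i => im (wgrad v i)))%:E)%E.
Proof.
(* Membership in [H1] guarantees that [wgrad v] is a weak gradient rather than the default value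
   0. *)
move=> [Lv Hv]; have [Lg _] : weak_gradient v (wgrad v) by exact: xgetPex Hv.
have -> : H1_norm v = ((sqL2 v + \sum_(i < 3) sqL2 (wgrad v i))%:E `^ (2^-1))%E.
  by rewrite /H1_norm L2_norm_sqE// !big_ord3 !L2_norm_sqE.
rewrite -poweRrM mulVf// poweRe1; last first.
  rewrite lee_fin addr_ge0 ?sqL2_ge0// sumr_ge0// => i _; exact: sqL2_ge0.
congr (_%:E); rewrite /sqH1 /sqL2 !big_ord3; ring.
Qed.

End complex_to_real.

Section finiteness.

Local Open Scope classical_set_scope.

Lemma finite_absz_le (m : nat) : finite_set [set i : int | (absz i <= m)%N].
Proof.
apply: (@sub_finite_set _ _
  (((fun n => n%:Z) @` `I_m.+1) `|` ((fun n => - n%:Z) @` `I_m.+1))).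
  by move=> [n|n] /= h; [left; exists n|right; exists n.+1; rewrite ?NegzE].
by rewrite finite_setU; split; exact/finite_image/finite_II.
Qed.

Lemma finite_pswf_index (R : realType) (chi : nat -> nat -> R) (M : R) :
  finite_set [set k : nat * nat | chi k.1 k.2 <= M] ->
  finite_set [set k : nat * nat * int | pswf_index k /\ (chi k.1.1 k.1.2 <= M)%R].
Proof.
move=> fin; apply: (@sub_finite_set _ _
  (\bigcup_(p in [set k : nat * nat | chi k.1 k.2 <= M])
     ((fun i : int => (p, i)) @` [set i : int | (absz i <= p.1)%N]))).
  by move=> [p i] [/= pi cM]; exists p => //; exists i.
by apply: bigcup_finite => // p _; exact/finite_image/finite_absz_le.
Qed.

End finiteness.

Section prolate_projection.
Local Open Scope classical_set_scope.
Context {R : realType}.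
Local Notation R3 := (R * R * R)%type.
Local Notation mu := (@leb3 R).
Local Notation B := (@B3 R).
Local Notation idx := (nat * nat * int)%type.
Local Notation re u := (fun x => complex.Re (u x)).
Local Notation im u := (fun x => complex.Im (u x)).
Variables (c : R) (Y : nat -> int -> R3 -> R).
Variables (psi : nat -> nat -> int -> R3 -> R) (alpha : nat -> nat -> R[i]).
Variable chi : nat -> nat -> R.
Hypothesis hpsi : pswf_system c Y psi alpha chi.

Let e (k : idx) : R3 -> R := psi k.1.1 k.1.2 k.2.

Lemma L2B_pswf (k : idx) : pswf_index k -> L2B (e k).
Proof. by have [Lp _ _] := pswf_complete hpsi => /Lp/L2P[]. Qed.

Lemma ip_pswf (j k : idx) : pswf_index j -> pswf_index k ->
  ip (e j) (e k) = (j == k)%:R.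
Proof.
have [_ on _] := pswf_complete hpsi => Dj Dk.
have := on _ _ Dj Dk; rewrite -[cpsi psi k]/(fun x => (e k x)%:C%C) inner_real.
move/(congr1 (@complex.Re R)) => /= ->.
by case: (j == k).
Qed.

(** Replacing complex coefficients by their real parts only drops the imaginary part of the error.
    Density is applied with [sqrt d] because it bounds a norm, while the conclusion bounds its
    square. *)
Lemma pswf_complete_real f : L2B f -> forall d : R, 0 < d ->
  exists (F : seq idx) (a : idx -> R), [set` F] `<=` @pswf_index /\
    ip (fun x => f x - \sum_(k <- F) a k * e k x)
       (fun x => f x - \sum_(k <- F) a k * e k x) < d.
Proof.
move=> Lf d d0; have [_ _ dense] := pswf_complete hpsi.
have Lu : L2 (fun x => (f x)%:C%C) by apply/L2P; split => //; exact: L2B_cst.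
have sd0 : 0 < Num.sqrt d by rewrite sqrtr_gt0.
have [F [a [FD near]]] := dense _ Lu _ sd0.
exists F, (fun k => complex.Re (a k)); split => //.
set w := fun x => _ in near.
have rw x : complex.Re (w x) = f x - \sum_(k <- F) complex.Re (a k) * e k x.
  by rewrite /w ReB Re_sum_real.
have iw x : complex.Im (w x) = - \sum_(k <- F) complex.Im (a k) * e k x.
  by rewrite /w ImB Im_sum_real sub0r.
have Lw : L2 w.
  apply/L2P; split.
    under [X in L2B X]eq_fun do rewrite rw.
    by apply: L2BB => //; exact: L2B_lin L2B_pswf _ _ FD.
  under [X in L2B X]eq_fun do rewrite iw -mulN1r.
  by apply: L2BZ; exact: L2B_lin L2B_pswf _ _ FD.
have le : ip (fun x => f x - \sum_(k <- F) complex.Re (a k) * e k x)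
   (fun x => f x - \sum_(k <- F) complex.Re (a k) * e k x) <= sqL2 w.
  rewrite /sqL2; under [X in ip X _ <= _]eq_fun do rewrite -rw.
  under [X in ip _ X <= _]eq_fun do rewrite -rw.
  by rewrite lerDl ip_ge0.
apply: le_lt_trans le _; move: near.
rewrite L2_normE// poweR_EFin lte_fin -[_ `^ _]/(_) => h.
rewrite -(sqr_sqrtr (ltW d0)) -[ltLHS](@sqr_sqrtr R)// ?sqL2_ge0//.
rewrite ltr_pXn2r ?nnegrE ?sqrtr_ge0//.
by rewrite -powR12_sqrt ?sqL2_ge0.
Qed.

(** This collects, mode by mode, what the spectral estimates assume of [P]; the parameters of the
    Fourier integral depend on the mode through [alpha], hence the choice. *)
Lemma pswf_smooth_extension : exists P : idx -> R3 -> R, forall k, pswf_index k ->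
  [/\ smooth (P k), (forall x, B x -> e k x = P k x) &
   forall v g, L2B v -> real_weak_gradient v g ->
   \int[mu]_(x in B) energy v g (P k) (fun i => partial i (P k)) c x =
   chi k.1.1 k.1.2 * ip v (e k)].
Proof.
suff /choice[P hP] : forall k, exists Pk : R3 -> R, pswf_index k ->
  [/\ smooth Pk, (forall x, B x -> e k x = Pk x) &
   forall v g, L2B v -> real_weak_gradient v g ->
   \int[mu]_(x in B) energy v g Pk (fun i => partial i Pk) c x =
   chi k.1.1 k.1.2 * ip v (e k)] by exists P.
move=> [[m n] l]; have [Dk|] := pselect (pswf_index (m, n, l)); last first.
  by move=> nD; exists (fun=> 0) => /nD.
have Lk := L2B_pswf Dk; have L1k := L2B_L1B Lk.
have [a [b E]] := eigen_fou L1k (pswf_alpha_neq0 hpsi m n) (pswf_fourier hpsi Dk).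
exists (fou c a b (e (m, n, l))) => _; split => //.
  exact: fou_smooth.
move=> v g Lv wg; apply: green_identity => //.
exact: (pswf_differential hpsi Dk).
Qed.

Variable eps : R.
Hypothesis eps0 : 0 < eps.

Let S : seq idx := finmap.enum_fset (fset_set [set k : idx |
  pswf_index k /\ (chi k.1.1 k.1.2 <= 1 / eps)%R]).

Let finS : finite_set [set k : idx |
  pswf_index k /\ (chi k.1.1 k.1.2 <= 1 / eps)%R].
Proof. exact/finite_pswf_index/(pswf_chi_cvgy hpsi). Qed.

Let SE k : k \in S <-> pswf_index k /\ chi k.1.1 k.1.2 <= 1 / eps.
Proof. by rewrite /S in_fset_set// inE. Qed.

Let SD : [set` S] `<=` @pswf_index. Proof. by move=> k /SE[]. Qed.

Let uS : uniq S. Proof. exact: finmap.fset_uniq. Qed.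

Lemma pswf_projE u x : pswf_proj psi chi eps u x =
  \sum_(k <- S) (ip (re u) (e k) +i* ip (im u) (e k))%C * (e k x)%:C%C.
Proof. by rewrite /pswf_proj fsbig_finite//; apply: eq_bigr => k _; rewrite -inner_real. Qed.

Lemma Re_pswf_error u x : complex.Re (pswf_proj psi chi eps u x - u x) =
  - residual e S (re u) x.
Proof. by rewrite ReB pswf_projE Re_sum_real /residual opprB. Qed.

Lemma Im_pswf_error u x : complex.Im (pswf_proj psi chi eps u x - u x) =
  - residual e S (im u) x.
Proof. by rewrite ImB pswf_projE Im_sum_real /residual opprB. Qed.

Lemma L2_pswf_error u : L2 u -> L2 (fun x => pswf_proj psi chi eps u x - u x).
Proof.
move=> /L2P[Lr Li]; apply/L2P; split.
  under [X in L2B X]eq_fun do rewrite Re_pswf_error -mulN1r.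
  exact/L2BZ/(L2B_residual L2B_pswf).
under [X in L2B X]eq_fun do rewrite Im_pswf_error -mulN1r.
exact/L2BZ/(L2B_residual L2B_pswf).
Qed.

Lemma sqL2_pswf_error u : sqL2 (fun x => pswf_proj psi chi eps u x - u x) =
  ip (residual e S (re u)) (residual e S (re u)) +
  ip (residual e S (im u)) (residual e S (im u)).
Proof.
rewrite /sqL2; congr (_ + _); apply: ipE => x _.
  by rewrite Re_pswf_error mulrNN.
by rewrite Im_pswf_error mulrNN.
Qed.

(** The [psi] are real, so the projection acts separately on real and imaginary parts; the two
    instances of [residual_K2] add up to the squared complex norms, for every competitor [v] of the
    infimum. *)
Lemma pswf_error_K2 u (t W : R) : L2 u -> 0 < t ->
  W = (eps * (1 + c ^+ 2))^-1 ->
  ((t ^+ 2 * W / (1 + t ^+ 2 * W) *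
      sqL2 (fun x => pswf_proj psi chi eps u x - u x))%:E <=
   K2 [set v | H1 v] (@L2_norm R) (@H1_norm R) t u)%E.
Proof.
move=> Lu t0 WE; apply: le_ereal_inf_tmp => _ [v /= Hv <-].
have [Lv Gv] := Hv; have wg : weak_gradient v (wgrad v) by exact: xgetPex Gv.
have [wr wi] := weak_gradient_real wg.
have /L2P[Lur Lui] := Lu; have /L2P[Lvr Lvi] := Lv.
have Luv : L2 (u - v).
  apply/L2P; split.
    by under [X in L2B X]eq_fun do rewrite fctE ReB; exact: L2BB.
  by under [X in L2B X]eq_fun do rewrite fctE ImB; exact: L2BB.
rewrite L2_norm_sqE// H1_norm_sqE// -EFinM -EFinD lee_fin sqL2_pswf_error mulrDr.
have -> : sqL2 (u - v) = ip (fun x => complex.Re (u x) - complex.Re (v x))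
    (fun x => complex.Re (u x) - complex.Re (v x)) +
  ip (fun x => complex.Im (u x) - complex.Im (v x))
    (fun x => complex.Im (u x) - complex.Im (v x)).
  by rewrite /sqL2; congr (_ + _); apply: ipE => x _; rewrite !fctE ?ReB ?ImB.
have [P hP] := pswf_smooth_extension.
have K v' u' g' : L2B u' -> L2B v' -> real_weak_gradient v' g' ->
    t ^+ 2 * W / (1 + t ^+ 2 * W) * ip (residual e S u') (residual e S u') <=
    ip (fun x => u' x - v' x) (fun x => u' x - v' x) + t ^+ 2 * sqH1 v' g'.
  move=> Lu' Lv' wg'.
  apply: (@residual_K2 R _ (@pswf_index) e L2B_pswf ip_pswf c
    (fun k => chi k.1.1 k.1.2) P _ _ _ _ eps S) => //.
  - by move=> k /hP[].
  - by move=> k x Dk; have [_ E _] := hP _ Dk; exact: E.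
  - by move=> k v0 g0 /hP[_ _]; exact.
  - exact: pswf_complete_real.
  - by rewrite WE.
rewrite [in leRHS]mulrDr [leRHS]addrACA; apply: lerD.
  exact: K Lur Lvr wr.
exact: K Lui Lvi wi.
Qed.

End prolate_projection.

Theorem theorem1 (R : realType) (c : R) (hc : 0 < c)
    (Y : nat -> int -> R * R * R -> R)
    (psi : nat -> nat -> int -> R * R * R -> R)
    (alpha : nat -> nat -> R[i]) (chi : nat -> nat -> R)
    (hpsi : pswf_system c Y psi alpha chi)
    (s : R) (hs0 : 0 < s) (hs1 : s < 1) (eps : R) (heps : 0 < eps)
    (u : R * R * R -> R[i]) (hu : Hs s u) :
  (L2_norm (fun x => (pswf_proj psi chi eps u x - u x)%R) <=
   (eps `^ (s / 2) * (1 + c ^+ 2) `^ (s / 2))%R%:E * Hs_norm s u)%E.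
Proof.
have [Lu _] := hu.
pose W := (eps * (1 + c ^+ 2))^-1.
have c1 : 0 < 1 + c ^+ 2 by rewrite ltr_pwDl// sqr_ge0.
have W0 : 0 < W by rewrite invr_gt0 mulr_gt0.
pose N := sqL2 (fun x => pswf_proj psi chi eps u x - u x).
have N0 : 0 <= N by exact: sqL2_ge0.
have := interpolation_lower_bound hs0 hs1 W0 N0
  (fun t t0 => pswf_error_K2 hpsi heps Lu t0 erefl).
rewrite L2_normE; last exact: (L2_pswf_error hpsi eps Lu).
rewrite /Hs_norm /interp_norm -/N.
set X := (_ * integral _ _ _)%E => le.
have WX : ((W `^ s * N)%:E `^ (2^-1) <= X `^ (2^-1))%E.
  apply: gt0_ler_poweR => //.
  - by rewrite in_itv/= leey andbT lee_fin; apply: mulr_ge0 => //; exact: powR_ge0.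
  - rewrite in_itv/= leey andbT; apply: le_trans le.
    by rewrite lee_fin; apply: mulr_ge0 => //; exact: powR_ge0.
rewrite -powRM ?(ltW heps) ?(ltW c1)//.
(* [W] is the inverse of [eps (1 + c^2)], so the prefactor cancels the square root of [W^s]. *)
have -> : (N%:E `^ (2^-1) = ((eps * (1 + c ^+ 2)) `^ (s / 2))%:E *
    (W `^ s * N)%:E `^ (2^-1))%E.
  rewrite !poweR_EFin -EFinM; congr (_%:E).
  rewrite (powRM _ (powR_ge0 W s) N0) -powRrM mulrA -powRM ?(ltW W0)//; last first.
    by rewrite mulr_ge0 ?(ltW heps) ?(ltW c1).
  by rewrite mulfV ?powR1 ?mul1r// (gt_eqF (mulr_gt0 heps c1)).
by apply: lee_pmul => //; rewrite ?lee_fin ?powR_ge0// poweR_ge0.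
Qed.
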